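(* Assume $n_i/N\to\kappa_i\in(0,1]$, $i=1,\dots,a$, as $\min(n_1,\dots,n_a)\to\infty$, where $N=\sum_{i=1}^an_i$. Let $\boldsymbol C\in\mathbb R^{m\times ap_u}$ and $\boldsymbol\zeta\in\mathbb R^m$. Let $\boldsymbol E_N\in\mathbb R^{m\times m}$ be (possibly random) matrices with $\boldsymbol E_N\xrightarrow{\mathcal P}\boldsymbol E$, where $\boldsymbol E\in\mathbb R^{m\times m}$ is symmetric. Then, under the null hypothesis $\mathcal H_0^{\boldsymbol r}:\boldsymbol C\boldsymbol r=\boldsymbol\zeta$, the quadratic form $$\widehat Q_{\boldsymbol r}=N\left[\boldsymbol C\widehat{\boldsymbol r}-\boldsymbol\zeta\right]^\top\boldsymbol E_N\left[\boldsymbol C\widehat{\boldsymbol r}-\boldsymbol\zeta\right]$$ has asymptotically a weighted $\chi^2$-distribution, i.e. for $N\to\infty$ $$\widehat Q_{\boldsymbol r}\xrightarrow{\ \mathcal D\ }\sum_{\ell=1}^{ap_u}\lambda_\ell B_\ell,$$ where $\lambda_\ell$, $\ell=1,\dots,ap_u$, are the eigenvalues of $\boldsymbol\Upsilon^{1/2}\boldsymbol C^\top\boldsymbol E\boldsymbol C\boldsymbol\Upsilon^{1/2}$ and $B_1,\dots,B_{ap_u}$ are i.i.d. $\chi^2_1$-distributed.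
   Context: Model: $d\ge2$, $a\ge1$; $\boldsymbol X_{ik}=\boldsymbol\mu_i+\boldsymbol\epsilon_{ik}$, $i=1,\dots,a$, $k=1,\dots,n_i$, are independent $d$-dimensional random vectors. Within each group $i$ the residuals $\boldsymbol\epsilon_{i1},\dots,\boldsymbol\epsilon_{in_i}$ are i.i.d. with $\mathbb E(\boldsymbol\epsilon_{i1})=\boldsymbol 0_d$ and $\mathbb E(\|\boldsymbol\epsilon_{i1}\|^4)<\infty$; across groups they are only independent (distributions may differ). $\operatorname{Cov}(\boldsymbol\epsilon_{i1})=\boldsymbol V_i=(V_{ijk})_{j,k\le d}$ has positive diagonal $V_{i11},\dots,V_{idd}>0$. $\boldsymbol R_i$ is the correlation matrix of group $i$. Vectorizations: $p=d(d+1)/2$, $p_u=d(d-1)/2$. For a $d\times d$ matrix $\boldsymbol A=(A_{jk})$, $\operatorname{vech}(\boldsymbol A)=(A_{11},A_{12},\dots,A_{1d},A_{22},\dots,A_{2d},\dots,A_{dd})^\top\in\mathbb R^p$ and $\operatorname{vech}^-(\boldsymbol A)=(A_{12},\dots,A_{1d},A_{23},\dots,A_{2d},\dots,A_{(d-1)d})^\top\in\mathbb R^{p_u}$. $\boldsymbol v_i=\operatorname{vech}(\boldsymbol V_i)$, $\boldsymbol r_i=\operatorname{vech}^-(\boldsymbol R_i)$, $\boldsymbol r=(\boldsymbol r_1^\top,\dots,\boldsymbol r_a^\top)^\top$, $\boldsymbol\Sigma_i=\operatorname{Cov}(\operatorname{vech}(\boldsymbol\epsilon_{i1}\boldsymbol\epsilon_{i1}^\top))$.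 Estimators: $\widehat{\boldsymbol V}_i=\frac1{n_i-1}\sum_{k=1}^{n_i}(\boldsymbol X_{ik}-\overline{\boldsymbol X}_i)(\boldsymbol X_{ik}-\overline{\boldsymbol X}_i)^\top$ is the empirical covariance matrix; $\widehat{\boldsymbol R}_i=\widehat{\boldsymbol V}_{i,0}^{-1/2}\widehat{\boldsymbol V}_i\widehat{\boldsymbol V}_{i,0}^{-1/2}$ is the empirical correlation matrix, $\widehat{\boldsymbol V}_{i,0}$ being the diagonal matrix with the diagonal of $\widehat{\boldsymbol V}_i$ (defined arbitrarily on the asymptotically negligible event that a diagonal entry vanishes); $\widehat{\boldsymbol r}_i=\operatorname{vech}^-(\widehat{\boldsymbol R}_i)$, $\widehat{\boldsymbol r}=(\widehat{\boldsymbol r}_1^\top,\dots,\widehat{\boldsymbol r}_a^\top)^\top$. Auxiliary matrices: $\boldsymbol e_{k,p}$ is the $k$-th standard basis vector of $\mathbb R^p$. $\boldsymbol a=(a_1,\dots,a_d)$ is the row vector with $a_k=1+\sum_{j=1}^{k-1}(d+1-j)$. $\boldsymbol b\in\mathbb R^{p_u}$ contains the numbers $1,\dots,p$ in ascending order without the elements of $\boldsymbol a$. $\boldsymbol H=\boldsymbol 1_d\boldsymbol a$ is the $d\times d$ matrix all of whose rows equal $\boldsymbol a$; $\boldsymbol h_1=\operatorname{vech}^-(\boldsymbol H)$, $\boldsymbol h_2=\operatorname{vech}^-(\boldsymbol H^\top)$, with $\ell$-th components $h_{1,\ell},h_{2,\ell}$. Then $\boldsymbol M_1=\sum_{\ell=1}^{p_u}\boldsymbol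 e_{\ell,p_u}(\boldsymbol e_{h_{1,\ell},p}+\boldsymbol e_{h_{2,\ell},p})^\top$, $\boldsymbol L_p^u=\sum_{\ell=1}^{p_u}\boldsymbol e_{\ell,p_u}\boldsymbol e_{b_\ell,p}^\top$, and $$\boldsymbol M(\boldsymbol v_i,\boldsymbol r_i)=\left[\boldsymbol L_p^u-\tfrac12\operatorname{diag}(\boldsymbol r_i)\boldsymbol M_1\right]\operatorname{diag}\Big(\operatorname{vech}\big((V_{i11},\dots,V_{idd})^\top(V_{i11},\dots,V_{idd})\big)\Big)^{-1/2},$$ $$\boldsymbol\Upsilon_i=\boldsymbol M(\boldsymbol v_i,\boldsymbol r_i)\boldsymbol\Sigma_i\boldsymbol M(\boldsymbol v_i,\boldsymbol r_i)^\top,\qquad \boldsymbol\Upsilon=\bigoplus_{i=1}^a\kappa_i^{-1}\boldsymbol\Upsilon_i,$$ where $\operatorname{diag}(\boldsymbol x)$ is the diagonal matrix with diagonal $\boldsymbol x$ and $\bigoplus$ is the direct sum (block diagonal matrix). $\xrightarrow{\mathcal P}$ and $\xrightarrow{\mathcal D}$ denote convergence in probability and in distribution. *)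

(* Defs.v *)
From HB Require Import structures.
From mathcomp Require Import all_boot all_order all_algebra finmap.
From mathcomp Require Import all_classical all_reals all_analysis.

Set Implicit Arguments.
Unset Strict Implicit.
Unset Printing Implicit Defensive.

Import Order.TTheory GRing.Theory Num.Theory.
Import numFieldNormedType.Exports.

Local Open Scope classical_set_scope.
Local Open Scope ring_scope.

(* Matrices, hence column vectors, carry the Borel sigma-algebra, so that
   {RV P >-> 'cV[R]_d} is the type of d-dimensional random vectors. *)
HB.instance Definition _ (R : realType) (m n : nat) :=
  isMeasurable.Build (sigma_display (@open 'M[R]_(m, n))) 'M[R]_(m, n)
    (@sigma_algebra0 _ setT open) (@sigma_algebraC _ open)
    (@sigma_algebra_bigcup _ setT open).

Section probability.
Context {d d'} {T : measurableType d} {T' : measurableType d'} {R : realType}.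
Implicit Type P : probability T R.

Definition mutually_independent P (I : choiceType) (X : I -> {RV P >-> T'}) :=
  forall (J : {fset I}) (B : I -> set T'), (forall j, measurable (B j)) ->
  P (\bigcap_(j in [set` J]) (X j @^-1` B j)) =
  (\prod_(j <- J) P (X j @^-1` B j))%E.

Definition identically_distributed P (X Y : {RV P >-> T'}) :=
  forall B, measurable B -> distribution P X B = distribution P Y B.

(* The chi-square law with one degree of freedom is the law of Z ^+ 2 for a
   standard normal Z. *)
Definition chi2_1_distributed P (X : {RV P >-> R}) :=
  forall B, measurable B ->
  distribution P X B = normal_prob 0 1 ((fun z : R => z ^+ 2) @^-1` B).

Definition mean P n (X : T -> 'cV[R]_n) : 'cV[R]_n :=
  \col_j fine ('E_P[fun w => X w j 0%R])%E.

Definition cov_mx P n (X : T -> 'cV[R]_n) : 'M[R]_n :=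
  \matrix_(j, k) fine (covariance P (fun w => X w j 0) (fun w => X w k 0)).

Definition cvg_in_probability P m n (X : nat -> T -> 'M[R]_(m, n))
    (A : 'M[R]_(m, n)) :=
  forall e : R, 0 < e -> P [set w | e < `|X nu w - A|] @[nu --> \oo] --> 0%E.

Definition cvg_in_distribution P (P' : probability T' R)
    (X : nat -> T -> R) (Y : T' -> R) :=
  forall f : R -> R, continuous f -> (exists M, forall x, `|f x| <= M) ->
  'E_P[f \o X nu]%E @[nu --> \oo] --> 'E_P'[f \o Y]%E.

End probability.

Section matrices.
Variable R : realType.

(* The norm of the library on matrices is the maximum norm. *)
Definition enorm n (x : 'cV[R]_n) : R := Num.sqrt (\sum_j x j 0 ^+ 2).

Definition psd n (A : 'M[R]_n) :=
  A^T = A /\ forall x : 'cV[R]_n, 0 <= (x^T *m A *m x) 0 0.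

Definition sqrt_mx n (A : 'M[R]_n) : 'M[R]_n :=
  xget 0 [set S | psd S /\ S *m S = A].

(* diag(x)^(-1/2); entries of x that are not positive give the entry 0. *)
Definition diag_isqrt n (x : 'cV[R]_n) : 'M[R]_n :=
  diag_mx (\row_j (Num.sqrt (x j 0))^-1).

Definition diag_of n (A : 'M[R]_n) : 'cV[R]_n := \col_j A j j.

Definition corr_mx n (V : 'M[R]_n) : 'M[R]_n :=
  diag_isqrt (diag_of V) *m V *m diag_isqrt (diag_of V).

(* lambda lists the eigenvalues of A with their multiplicities. *)
Definition eigenvalues_of n (A : 'M[R]_n) (lambda : 'I_n -> R) :=
  char_poly A = \prod_l ('X - (lambda l)%:P).

End matrices.

Definition dim_vech (d : nat) : nat := (d * d.+1)./2.
Definition dim_vechm (d : nat) : nat := (d * d.-1)./2.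

(* The two sequences have sizes dim_vech d and dim_vechm d, so the default
   value of `_ is never used. *)
Definition vech (K : nmodType) d (A : 'M[K]_d) : 'cV[K]_(dim_vech d) :=
  \col_l [seq A j k | j : 'I_d <- enum 'I_d,
                   k : 'I_d <- [seq k : 'I_d <- enum 'I_d | (j <= k)%N]]`_l.

Definition vechm (K : nmodType) d (A : 'M[K]_d) : 'cV[K]_(dim_vechm d) :=
  \col_l [seq A j k | j : 'I_d <- enum 'I_d,
                   k : 'I_d <- [seq k : 'I_d <- enum 'I_d | (j < k)%N]]`_l.

Section auxiliary_matrices.
Variables (R : realType) (d : nat).
Let p := dim_vech d.
Let pu := dim_vechm d.

(* Positions are counted from 0: the values of diag_pos, offdiag_pos, h1, h2
   and the index of std_basis are one less than in the usual notation. *)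
Definition std_basis n (k : nat) : 'cV[R]_n := \col_i ((i : nat) == k)%:R.

Definition diag_pos : 'rV[nat]_d := \row_k (\sum_(j < k) (d - j))%N.

Definition offdiag_pos : seq nat :=
  [seq x <- iota 0 p | x \notin [seq diag_pos 0 k | k <- enum 'I_d]].

Definition H_mx : 'M[nat]_d := \matrix_(j, k) diag_pos 0 k.
Definition h1 : 'cV[nat]_pu := vechm H_mx.
Definition h2 : 'cV[nat]_pu := vechm H_mx^T.

Definition M1 : 'M[R]_(pu, p) :=
  \sum_(l < pu)
    std_basis pu l *m (std_basis p (h1 l 0) + std_basis p (h2 l 0))^T.

Definition Lpu : 'M[R]_(pu, p) :=
  \sum_(l < pu) std_basis pu l *m (std_basis p (nth 0%N offdiag_pos l))^T.

Definition M_mx (V : 'M[R]_d) (r : 'cV[R]_pu) : 'M[R]_(pu, p) :=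
  (Lpu - 2^-1 *: (diag_mx r^T *m M1)) *m
  diag_isqrt (vech (diag_of V *m (diag_of V)^T)).

End auxiliary_matrices.

Section estimators.
Variables (R : realType) (d : nat).

(* The sample of size n consists of x 0, ..., x n.-1. *)
Definition sample_mean (n : nat) (x : nat -> 'cV[R]_d) : 'cV[R]_d :=
  n%:R^-1 *: \sum_(k < n) x k.

Definition sample_cov (n : nat) (x : nat -> 'cV[R]_d) : 'M[R]_d :=
  (n%:R - 1)^-1 *: \sum_(k < n)
    (x k - sample_mean n x) *m (x k - sample_mean n x)^T.

End estimators.

(* Dimension of a vectors in R^pu stacked; equal to a * pu. *)
Definition dim_stack (a d : nat) : nat := (\sum_(i < a) dim_vechm d)%N.

Section model.
Context {disp} {Omega : measurableType disp} {R : realType}.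
Variables (P : probability Omega R) (d a : nat).
Variable eps : 'I_a -> nat -> {RV P >-> 'cV[R]_d}.

Definition V_ (i : 'I_a) : 'M[R]_d := cov_mx P (eps i 0%N).

Definition r_ (i : 'I_a) : 'cV[R]_(dim_vechm d) := vechm (corr_mx (V_ i)).

Definition r_stack : 'cV[R]_(dim_stack a d) := \mxcol_(i < a) r_ i.

Definition Sigma_ (i : 'I_a) : 'M[R]_(dim_vech d) :=
  cov_mx P (fun w => vech ((eps i 0%N w : 'cV[R]_d) *m (eps i 0%N w)^T)).

Definition Upsilon_ (i : 'I_a) : 'M[R]_(dim_vechm d) :=
  M_mx (V_ i) (r_ i) *m Sigma_ i *m (M_mx (V_ i) (r_ i))^T.

Definition Upsilon (kappa : 'I_a -> R) : 'M[R]_(dim_stack a d) :=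
  \mxdiag_(i < a) ((kappa i)^-1 *: Upsilon_ i).

Definition obs (mu : 'I_a -> 'cV[R]_d) (i : 'I_a) (k : nat) (w : Omega) :
  'cV[R]_d := mu i + eps i k w.

Definition rhat (mu : 'I_a -> 'cV[R]_d) (n : 'I_a -> nat) (w : Omega) :
    'cV[R]_(dim_stack a d) :=
  \mxcol_(i < a) vechm (corr_mx (sample_cov (n i) (fun k => obs mu i k w))).

Definition Qhat (mu : 'I_a -> 'cV[R]_d) (n : 'I_a -> nat) m
    (C : 'M[R]_(m, dim_stack a d)) (zeta : 'cV[R]_m)
    (EN : Omega -> 'M[R]_m) (w : Omega) : R :=
  (\sum_(i < a) n i)%:R *
  ((C *m rhat mu n w - zeta)^T *m EN w *m (C *m rhat mu n w - zeta)) 0 0.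

End model.

(* Main.v *)
(** The delta method turns [sqrt N (rhat - r)] into a linear statistic [Y]: a sum of
    independent centred variables with limiting covariance [Upsilon], up to an error that
    vanishes in probability.  Diagonalizing [S C^T E C S] with [S = sqrt_mx Upsilon], the
    quadratic form in [Y] becomes [\sum_l lambda_l (G Y)_l^2], where [G Upsilon G^T] is the
    identity on the indices with [lambda_l != 0].

    Characteristic functions are used in real form.  For independent [X_i] and
    [rho_i] in [0, 1], expanding the cosine of a sum gives
    [|E cos (\sum X_i + c) - \prod rho_i cos c| <= \sum |E cos X_i - rho_i| + |E sin X_i|],
    and with Gaussian [rho_i] this is the central limit theorem.

    No continuity theorem for characteristic functions is needed: [w_l^2] is locally uniformly
    approximated by [2 (1 - cos (th w_l)) / th^2], which is bounded, so a test function of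
    [\sum_l lambda_l w_l^2] may be replaced by a polynomial in these cosines; product-to-sum
    formulas reduce its expectation to those of [cos (\sum_l u_l w_l)]. *)

Require Import Defs.
From HB Require Import structures.
From mathcomp Require Import all_boot all_order all_fingroup all_algebra finmap.
From mathcomp Require Import all_classical all_reals all_analysis.
From mathcomp Require Import measurable_realfun ring lra zify.

Import Order.TTheory GRing.Theory Num.Theory.
Import numFieldNormedType.Exports.

Local Open Scope classical_set_scope.
Local Open Scope ring_scope.

Set Implicit Arguments.
Unset Strict Implicit.
Unset Printing Implicit Defensive.

(** * Symmetric real matrices *)

(** The matrix [E] is only symmetric and [Upsilon] may be singular, so the [lambda l] may have any
    sign or vanish. Coordinates of [G Y] with [lambda l = 0] are not asymptotically standard normal
    (the rows of [G] constructed there are zero). Convergence of characteristic functions is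
    therefore stated for vectors [u] that vanish where [lambda] does; the product-to-sum recursion
    preserves this class, since a shift in direction [l] carries the factor [lambda l]. Singularity
    of [Upsilon] also means that the eigenvectors describe the form on the range of [S] only; what
    remains has a factor whose limiting variance is zero and which vanishes in probability.

    The limit is given by chi-square variables [B l]. As the cosine is even, products of
    [cos (u_l sqrt B_l)] have the same expectations as for independent normal variables, so that
    both sides of the limit obey one recursion, [gauss_moment].

    Inverse square roots are 0 at nonpositive arguments. Their expansion is written with a slope
    function that makes it an identity at every argument, so the delta method discards no event. *)

Section spectral_theorem.
Variable R : realType.

Lemma mulmx_tr_sum n (x y : 'rV[R]_n) :
  (x *m y^T) 0 0 = \sum_j x 0 j * y 0 j.
Proof. by rewrite mxE; apply: eq_bigr => j _; rewrite mxE. Qed.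

Lemma row_sqr_ge0 n (x : 'rV[R]_n) : 0 <= (x *m x^T) 0 0.
Proof. by rewrite mulmx_tr_sum sumr_ge0// => j _; rewrite -expr2 sqr_ge0. Qed.

Lemma row_sqr_eq0 n (x : 'rV[R]_n) : (x *m x^T) 0 0 = 0 -> x = 0.
Proof.
rewrite mulmx_tr_sum => /eqP; rewrite psumr_eq0; last first.
  by move=> j _; rewrite -expr2 sqr_ge0.
move=> /allP x0; apply/rowP => j; rewrite mxE.
by have := x0 j (mem_index_enum j); rewrite /= mulf_eq0 orbb => /eqP.
Qed.

(** If [y = x *m B] were nonzero, a small step from [x] against [y] would make the form negative: at
    [x - t y] its value is [- 2 t s + t^2 q], with [s = |y|^2] and [q] the form at [y]. *)
Lemma psd_null n (B : 'M[R]_n) (x : 'rV[R]_n) : B^T = B ->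
  (forall y : 'rV[R]_n, 0 <= (y *m B *m y^T) 0 0) ->
  (x *m B *m x^T) 0 0 = 0 -> x *m B = 0.
Proof.
move=> Bs Bp x0; apply: row_sqr_eq0.
set y := x *m B.
pose q := (y *m B *m y^T) 0 0; pose s := (y *m y^T) 0 0.
have q0 : 0 <= q by exact: Bp.
have s0 : 0 <= s by exact: row_sqr_ge0.
have yBx : (y *m B *m x^T) 0 0 = s.
  by rewrite /s {2}/y trmx_mul Bs mulmxA.
have xBy : (x *m B *m y^T) 0 0 = s by [].
(* The minimizer would be [s / q]; the added 1 covers [q = 0]. The value becomes [- t^2 (q + 2)],
   which forces [t = 0]. *)
pose t := s / (q + 1).
have := Bp (x - t *: y).
have -> : ((x - t *: y) *m B *m (x - t *: y)^T) 0 0 = - 2 * t * s + t ^+ 2 * q.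
  rewrite [(x - _)^T]linearB /= [(t *: y)^T]linearZ /=.
  rewrite !mulmxBl !mulmxBr -!scalemxAl -!scalemxAr.
  have mxB (C D : 'M[R]_1) : (C - D) 0 0 = C 0 0 - D 0 0 by rewrite !mxE.
  have mxZ c (C : 'M[R]_1) : (c *: C) 0 0 = c * C 0 0 by rewrite !mxE.
  by rewrite !(mxB, mxZ) x0 yBx xBy -/q; ring.
have tq : t * (q + 1) = s by rewrite /t divfK// gt_eqF// ltr_wpDl.
have t0 : 0 <= t by rewrite divr_ge0// addr_ge0.
move=> h; apply/eqP; rewrite eq_le s0 andbT -/s.
suff : t = 0 by move=> t00; rewrite -tq t00 mul0r.
nra.
Qed.

Lemma continuous_quadratic_form n (A : 'M[R]_n) :
  continuous (fun x : 'rV[R]_n => (x *m A *m x^T) 0 0).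
Proof.
have -> : (fun x : 'rV[R]_n => (x *m A *m x^T) 0 0) =
    (fun x : 'rV[R]_n => \sum_k (\sum_j x 0 j * A j k) * x 0 k).
  by apply/funext => y; rewrite mulmx_tr_sum; apply: eq_bigr => k _; rewrite mxE.
apply: (@continuous_big _ _ +%R) => [|k _]; first exact: add_continuous.
move=> x; apply: (@continuousM _ _ _ _ x); last exact: coord_continuous.
apply: (@continuous_big _ _ +%R) => [|j _]; first exact: add_continuous.
by move=> y; apply: continuousM; [exact: coord_continuous|exact: cst_continuous].
Qed.

(** A maximizer [x] of the quadratic form on the unit sphere is an eigenvector: [mu - A] is then
    positive semidefinite and its form is zero at [x], so [psd_null] applies. *)
Lemma symmetric_eigenvector n (A : 'M[R]_n.+1) : A^T = A ->
  exists (x : 'rV[R]_n.+1) (mu : R), (x *m x^T) 0 0 = 1 /\ x *m A = mu *: x.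
Proof.
move=> As.
pose sphere := [set x : 'rV[R]_n.+1 | (x *m x^T) 0 0 = 1].
have n1 (x : 'rV[R]_n.+1) : (x *m x^T) = x *m 1%:M *m x^T by rewrite mulmx1.
have cs : compact sphere.
  apply: bounded_closed_compact.
    exists 1; split; first exact: num_real.
    move=> r r1 x /= xs; apply: ltW; apply: le_lt_trans r1.
    rewrite [leLHS]mx_normrE.
    apply/bigmax_leP; split => //= -[i j] _ /=; rewrite ord1.
    have : x 0 j * x 0 j <= 1.
      rewrite -xs mulmx_tr_sum (bigD1 j)//= lerDl sumr_ge0// => k _.
      by rewrite -expr2 sqr_ge0.
    by rewrite -expr2 -real_normK ?num_real// expr_le1.
  have -> : sphere = (fun x => (x *m 1%:M *m x^T) 0 0) @^-1` [set 1].
    by apply/seteqP; split => x /=; rewrite mulmx1.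
  apply: (@preimage_closed _ _ _ [set (1 : R)]); last exact: closed_eq.
  by move=> x _; exact: continuous_quadratic_form.
have s0 : sphere !=set0.
  exists (delta_mx 0 0); rewrite /sphere /= mulmx_tr_sum (bigD1 0)//= big1.
    by rewrite mxE !eqxx mulr1 addr0.
  by move=> j j0; rewrite mxE (negbTE j0) andbF mul0r.
have [x xs xm] := EVT_max_rV s0 cs
  (@continuous_subspaceT _ _ sphere _ (@continuous_quadratic_form _ A)).
rewrite inE /sphere/= in xs.
pose mu := (x *m A *m x^T) 0 0.
exists x, mu; split => //.
apply/eqP; rewrite -subr_eq0 -opprB oppr_eq0; apply/eqP.
have -> : mu *: x - x *m A = x *m (mu%:M - A) by rewrite mulmxBr mul_mx_scalar.
have qB (y : 'rV[R]_n.+1) : (y *m (mu%:M - A) *m y^T) 0 0 =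
   mu * (y *m y^T) 0 0 - (y *m A *m y^T) 0 0.
  by rewrite mulmxBr mul_mx_scalar mulmxBl -scalemxAl !mxE.
apply: psd_null.
- by rewrite linearB /= tr_scalar_mx As.
- move=> y; rewrite qB subr_ge0.
  have [y0|y0] := eqVneq ((y *m y^T) 0 0) 0.
    by rewrite (row_sqr_eq0 y0) !mul0mx mxE mulr0.
  have yp : 0 < (y *m y^T) 0 0 by rewrite lt_neqAle eq_sym y0 row_sqr_ge0.
  pose c := (Num.sqrt ((y *m y^T) 0 0))^-1.
  have c2 : c * c * ((y *m y^T) 0 0) = 1.
    by rewrite -invfM -expr2 sqr_sqrtr ?ltW// mulVf.
  have sc (B : 'M[R]_n.+1) : ((c *: y) *m B *m (c *: y)^T) 0 0 =
     c * c * (y *m B *m y^T) 0 0.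
    by rewrite linearZ /= -!scalemxAl -scalemxAr scalerA !mxE.
  have := xm (c *: y); rewrite inE /sphere/= n1 sc mulmx1 => /(_ c2).
  rewrite sc -/mu => h.
  have cc : 0 < c * c by rewrite mulr_gt0// invr_gt0 sqrtr_gt0.
  by rewrite -(ler_pM2l cc) (mulrCA _ mu) c2 mulr1.
- by rewrite qB xs -/mu; ring.
Qed.

(** The reflection in the hyperplane orthogonal to [x - e] exchanges [x] and the first basis vector
    [e]; if the two coincide, the identity serves. *)
Lemma householder n (x : 'rV[R]_n.+1) : (x *m x^T) 0 0 = 1 ->
  exists Q : 'M[R]_n.+1, [/\ Q^T = Q, Q *m Q = 1%:M & delta_mx 0 0 *m Q = x].
Proof.
move=> x1; pose e : 'rV[R]_n.+1 := delta_mx 0 0; pose v := x - e.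
pose s := (v *m v^T) 0 0.
have vv : v *m v^T = s%:M by rewrite [LHS]mx11_scalar.
have [s0|s0] := eqVneq s 0.
  exists 1%:M; rewrite trmx1 mulmx1; split => //.
  by rewrite mulmx1; apply/eqP; rewrite eq_sym -subr_eq0 -/e -/v (row_sqr_eq0 s0).
exists (1%:M - (2 / s) *: (v^T *m v)); split.
- by rewrite [LHS]linearB /= [X in _ - X]linearZ /= trmx_mul trmxK trmx1.
- rewrite mulmxBr mulmx1 mulmxBl mul1mx -!scalemxAl -!scalemxAr scalerA.
  rewrite -mulmxA [v *m (_ *m _)]mulmxA vv mul_scalar_mx -scalemxAr scalerA.
  rewrite -scalerBl -addrA -opprD -scalerDl.
  rewrite [X in X *: _](_ : _ = 0); last by field.
  by rewrite scale0r subr0.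
- rewrite mulmxBr mulmx1 -scalemxAr mulmxA -/e.
  have ee : (e *m e^T) 0 0 = 1.
    rewrite mulmx_tr_sum (bigD1 0)//= big1; first by rewrite mxE !eqxx mulr1 addr0.
    by move=> j j0; rewrite mxE (negbTE j0) andbF mul0r.
  have xe : (x *m e^T) 0 0 = (e *m x^T) 0 0.
    by rewrite !mulmx_tr_sum; apply: eq_bigr => j _; rewrite mulrC.
  have mxB (C D : 'M[R]_1) : (C - D) 0 0 = C 0 0 - D 0 0 by rewrite !mxE.
  have sE : s = 2 - 2 * (e *m x^T) 0 0.
    by rewrite /s /v [(_ - _)^T]linearB /= mulmxBr !mulmxBl !mxB x1 ee xe; ring.
  have -> : e *m v^T = (- (s / 2))%:M.
    rewrite [LHS]mx11_scalar; congr (_%:M).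
    by rewrite /v linearB /= mulmxBr mxB ee sE; field.
  rewrite mul_scalar_mx scalerA.
  have -> : 2 / s * - (s / 2) = - 1 by field.
  by rewrite scaleN1r opprK /v addrC subrK.
Qed.

(** Conjugation by a reflection that carries the first basis vector to an eigenvector clears the
    first row up to its diagonal entry. By symmetry the first column is cleared too, and the
    induction hypothesis handles the remaining block. *)
Lemma spectral n (A : 'M[R]_n) : A^T = A ->
  exists (U : 'M[R]_n) (mu : 'rV[R]_n),
    U *m U^T = 1%:M /\ A = U^T *m diag_mx mu *m U.
Proof.
elim: n A => [|n IH] A As.
  by exists 1%:M, 0; split; [rewrite trmx1 mulmx1|apply/matrixP => -[]].
have [x [mu [x1 xA]]] := symmetric_eigenvector As.
have [Q [Qs QQ eQ]] := householder x1.
pose A' : 'M[R]_(1 + n) := Q *m A *m Q.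
have A's : A'^T = A' by rewrite /A' !trmx_mul Qs As mulmxA.
have eA' : (delta_mx 0 0 : 'rV[R]_n.+1) *m A' = mu *: delta_mx 0 0.
  rewrite /A' !mulmxA eQ xA -scalemxAl; congr (_ *: _).
  by rewrite -eQ -mulmxA QQ mulmx1.
have A'row j : A' 0 j = mu * (j == 0)%:R.
  have /matrixP /(_ 0 j) := eA'.
  by rewrite -rowE !mxE eqxx.
have ul : ulsubmx A' = mu%:M.
  apply/matrixP => i j; rewrite !ord1 !mxE lshift0 eqxx mulr1n.
  by have := A'row 0; rewrite mxE eqxx mulr1.
have ur : ursubmx A' = 0.
  apply/matrixP => i j; rewrite !ord1 mxE mxE lshift0 A'row [RHS]mxE.
  by rewrite -val_eqE /= mulr0.
have dl : dlsubmx A' = 0 by rewrite -A's -trmx_ursub ur trmx0.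
have A'E : A' = block_mx mu%:M 0 0 (drsubmx A') by rewrite -[LHS]submxK ul ur dl.
have drs : (drsubmx A')^T = drsubmx A' by rewrite trmx_drsub A's.
have [U [nu [UU UA]]] := IH _ drs.
pose U1 : 'M[R]_(1 + n) := block_mx 1%:M 0 0 U.
have U1T : U1^T = block_mx 1%:M 0 0 U^T.
  by rewrite /U1 tr_block_mx !trmx0 trmx1.
have U1U1 : U1 *m U1^T = 1%:M.
  rewrite U1T mulmx_block !mulmx0 !mul0mx UU mulmx1.
  by rewrite !addr0 add0r -scalar_mx_block.
have A'D : A' = U1^T *m diag_mx (row_mx mu%:M nu) *m U1.
  rewrite U1T diag_mx_row /U1 !mulmx_block.
  rewrite !mulmx0 !mul0mx !mulmx1 !mul1mx !addr0 !add0r ?mulmx0 ?mul0mx -UA.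
  by rewrite [LHS]A'E; congr block_mx; apply/matrixP => i j; rewrite !ord1 !mxE.
exists (U1 *m Q), (row_mx mu%:M nu); split.
  by rewrite trmx_mul Qs mulmxA -(mulmxA U1) QQ mulmx1.
have -> : A = Q *m A' *m Q.
  by rewrite /A' !mulmxA QQ mul1mx -mulmxA QQ mulmx1.
by rewrite trmx_mul Qs {1}A'D !mulmxA.
Qed.

(** [sqrt_mx] picks a positive semidefinite square root as soon as one exists; [U^T diag(sqrt mu) U]
    is one. *)
Lemma sqrt_mxP n (A : 'M[R]_n) : psd A ->
  psd (sqrt_mx A) /\ sqrt_mx A *m sqrt_mx A = A.
Proof.
move=> [As Ap]; rewrite /sqrt_mx; case: xgetP => [S _ //|noS]; exfalso.
have [U [mu [UU AE]]] := spectral As.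
have mu0 i : 0 <= mu 0 i.
  pose x := U^T *m (delta_mx i 0 : 'cV_n).
  have Ux : U *m x = delta_mx i 0 by rewrite mulmxA UU mul1mx.
  have := Ap x; rewrite AE -!mulmxA Ux !mulmxA -trmx_mul Ux trmx_delta.
  by rewrite -rowE -colE !mxE eqxx.
pose D := diag_mx (\row_i Num.sqrt (mu 0 i)).
have Ds : D^T = D by rewrite tr_diag_mx.
apply: (noS (U^T *m D *m U)); split; first split.
- by rewrite !trmx_mul trmxK Ds mulmxA.
- move=> x; pose y := (U *m x)^T.
  have -> : x^T *m (U^T *m D *m U) *m x = y *m D *m y^T.
    by rewrite /y trmxK trmx_mul !mulmxA.
  rewrite mulmx_tr_sum sumr_ge0// => j _.
  rewrite mul_mx_diag !mxE mulrAC mulr_ge0 ?sqrtr_ge0//.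
  by rewrite -expr2 sqr_ge0.
- rewrite AE !mulmxA; congr (_ *m _); rewrite -3!mulmxA (mulmxA U) UU mul1mx.
  rewrite /D mulmx_diag; congr (_ *m diag_mx _).
  by apply/rowP => i; rewrite !mxE -expr2 sqr_sqrtr.
Qed.

(** [lambda] is known only through the characteristic polynomial. Unique factorization makes it a
    permutation of the spectral diagonal, and the rows of [U] are permuted accordingly. *)
Lemma spectral_eigenvalues_of n (A : 'M[R]_n) (lambda : 'I_n -> R) : A^T = A ->
  eigenvalues_of A lambda ->
  exists U : 'M[R]_n,
    U *m U^T = 1%:M /\ A = U^T *m diag_mx (\row_i lambda i) *m U.
Proof.
move=> As; rewrite /eigenvalues_of => lA.
have [U [mu [UU AE]]] := spectral As.
have UtU : U^T *m U = 1%:M by rewrite mulmx1C.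
have : char_poly A = \prod_i ('X - (mu 0 i)%:P).
  have Uu : U \in unitmx by have /mulmx1_unit[] := UU.
  have -> : char_poly A = char_poly (diag_mx mu).
    rewrite /char_poly /char_poly_mx AE !map_mxM/=.
    pose V := map_mx polyC U.
    have VV : map_mx polyC U^T *m V = 1%:M by rewrite -map_mxM UtU map_mx1.
    have XE : ('X%:M : 'M[_]_n) = map_mx polyC U^T *m ('X%:M) *m V.
      by rewrite mul_mx_scalar -scalemxAl VV scalemx1.
    rewrite {1}XE -mulmxBl -mulmxBr !det_mulmx mulrAC -det_mulmx VV det1 mul1r.
    by [].
  rewrite char_poly_trig; last first.
    by apply/is_trig_mxP => i j ij; rewrite mxE -val_eqE /= ltn_eqF.
  by apply: eq_bigr => i _; rewrite mxE eqxx.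
rewrite lA => eq_prod.
pose s := [tuple lambda i | i < n]; pose t := [tuple mu 0 i | i < n].
have : perm_eq s t.
  apply: prod_XsubC_eq; rewrite !big_map.
  exact: eq_prod.
move=> /tuple_permP[p sp].
have lp i : lambda i = mu 0 (p i).
  by have := tnth_mktuple lambda i; rewrite -/s (val_inj sp) tnth_mktuple tnth_mktuple.
exists (row_perm p U); split.
  apply/matrixP => i j; rewrite !mxE.
  have /matrixP /(_ (p i) (p j)) := UU; rewrite !mxE (inj_eq perm_inj) => <-.
  by apply: eq_bigr => k _; rewrite !mxE.
rewrite AE; apply/matrixP => i j; rewrite !mxE (reindex_inj (@perm_inj _ p)) /=.
by apply: eq_bigr => k _; rewrite !mul_mx_diag !mxE lp.
Qed.

Lemma mulmx_orthogonal_diag n (U : 'M[R]_n) (a b : 'rV[R]_n) : U *m U^T = 1%:M ->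
  (U^T *m diag_mx a *m U) *m (U^T *m diag_mx b *m U) =
  U^T *m diag_mx (\row_i (a 0 i * b 0 i)) *m U.
Proof.
move=> UU; rewrite !mulmxA; congr (_ *m _).
by rewrite -3!mulmxA (mulmxA U) UU mul1mx mulmx_diag.
Qed.

(* When [S = sqrt_mx Ups] is singular, the eigenvectors of [S *m K *m S] only
   describe the form [K] on the range of [S]; the remainder has a factor
   [N *m y], which vanishes on that range. *)
Lemma quadratic_form_decomposition n (Ups K : 'M[R]_n) (lambda : 'I_n -> R) :
  psd Ups -> K^T = K ->
  eigenvalues_of (sqrt_mx Ups *m K *m sqrt_mx Ups) lambda ->
  exists (G N W : 'M[R]_n),
    [/\ forall l k, lambda l != 0 -> lambda k != 0 ->
          (G *m Ups *m G^T) l k = (l == k)%:R,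
        N *m Ups *m N^T = 0 &
        forall y : 'cV[R]_n, (y^T *m K *m y) 0 0 =
          \sum_l lambda l * (G *m y) l 0 ^+ 2 +
          ((N *m y)^T *m (W *m y)) 0 0].
Proof.
move=> /sqrt_mxP[]; set S := sqrt_mx Ups => -[Ss _] SS Ks.
set A := S *m K *m S => lA.
have As : A^T = A by rewrite /A !trmx_mul Ss Ks mulmxA.
have [U [UU AE]] := spectral_eigenvalues_of As lA.
have [V [s [VV SE]]] := spectral Ss.
have VtV : V^T *m V = 1%:M by rewrite mulmx1C.
pose L : 'M[R]_n := diag_mx (\row_i lambda i).
pose Li : 'M[R]_n := diag_mx (\row_i (lambda i)^-1).
pose P : 'M[R]_n := diag_mx (\row_i (lambda i != 0)%:R).
have UA : U *m A = L *m U by rewrite AE !mulmxA UU mul1mx.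
have LiL : Li *m L = P.
  rewrite mulmx_diag; congr diag_mx; apply/rowP => i; rewrite !mxE.
  by have [->|l0] := eqVneq (lambda i) 0; rewrite ?mulr0// mulVf.
(* [Li] inverts [L] on the nonzero eigenvalues and is 0 elsewhere ([0^-1 = 0]), so that
   [G S = Li U A = Li L U = P U]. *)
pose G := Li *m U *m S *m K.
have GS : G *m S = P *m U by rewrite /G -!mulmxA (mulmxA S) -/A UA mulmxA LiL.
clearbody G.
(* [Z] and [Q] are the orthogonal projections onto the kernel and the range of [S], and [Si] is the
   pseudo-inverse of [S]. *)
pose Z := V^T *m diag_mx (\row_i (s 0 i == 0)%:R) *m V.
pose Si := V^T *m diag_mx (\row_i (s 0 i)^-1) *m V.
pose Q := V^T *m diag_mx (\row_i (s 0 i != 0)%:R) *m V.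
have ZQ : Z + Q = 1%:M.
  rewrite /Z /Q -mulmxDl -mulmxDr -linearD /= -VtV -[in RHS](mulmx1 V^T).
  congr (_ *m _ *m _); rewrite -diag_const_mx; congr diag_mx.
  by apply/rowP => i; rewrite !mxE; case: eqP; rewrite ?addr0 ?add0r.
have tr_sym (a : 'rV[R]_n) : (V^T *m diag_mx a *m V)^T = V^T *m diag_mx a *m V.
  by rewrite !trmx_mul trmxK tr_diag_mx mulmxA.
have SSi : S *m Si = Q.
  rewrite SE /Si mulmx_orthogonal_diag// /Q; congr (_ *m diag_mx _ *m _).
  apply/rowP => i; rewrite !mxE.
  by have [->|l0] := eqVneq (s 0 i) 0; rewrite ?invr0 ?mulr0// divff.
have SiS : Si *m S = Q.
  rewrite SE /Si mulmx_orthogonal_diag// /Q; congr (_ *m diag_mx _ *m _).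
  apply/rowP => i; rewrite !mxE.
  by have [->|l0] := eqVneq (s 0 i) 0; rewrite ?invr0 ?mul0r ?mulr0// mulVf.
have ZS : Z *m S = 0.
  rewrite SE /Z mulmx_orthogonal_diag//.
  rewrite [X in diag_mx X](_ : _ = 0) ?linear0 ?mulmx0 ?mul0mx//.
  apply/rowP => i; rewrite !mxE.
  by have [->|l0] := eqVneq (s 0 i) 0; rewrite ?mul0r ?mulr0.
have Zs : Z^T = Z by exact: tr_sym.
have Qs : Q^T = Q by exact: tr_sym.
clearbody Z Q.
(* What is left of [K] once the diagonalized part is removed; as a bilinear form it vanishes on the
   range of [S]. *)
pose D := K - G^T *m L *m G.
have Ls : L^T = L by rewrite tr_diag_mx.
have Ds : D^T = D.
  by rewrite /D [LHS]linearB /= Ks !trmx_mul trmxK Ls mulmxA.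
have SDS : S *m D *m S = 0.
  rewrite /D mulmxBr mulmxBl -/A.
  have -> : S *m (G^T *m L *m G) *m S = (G *m S)^T *m L *m (G *m S).
    by rewrite trmx_mul Ss !mulmxA.
  have PLP : P *m L *m P = L.
    rewrite !mulmx_diag; congr diag_mx; apply/rowP => i; rewrite !mxE.
    by have [->|l0] := eqVneq (lambda i) 0; rewrite ?mulr0 ?mul0r// mul1r mulr1.
  by rewrite GS trmx_mul tr_diag_mx AE -/L -{1}PLP !mulmxA subrr.
have QDQ : Q *m D *m Q = 0.
  have -> : Q *m D *m Q = Si *m (S *m D *m S) *m Si.
    by rewrite -{1}SiS -SSi !mulmxA.
  by rewrite SDS mulmx0 mul0mx.
exists G, Z, (D + D *m Q); split.
- move=> l k l0 k0; rewrite -SS mulmxA.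
  have -> : G *m S *m S *m G^T = (G *m S) *m (G *m S)^T.
    by rewrite trmx_mul Ss !mulmxA.
  rewrite GS trmx_mul tr_diag_mx -mulmxA (mulmxA U) UU mul1mx mulmx_diag !mxE.
  by rewrite l0 mulr1.
- by rewrite -SS mulmxA ZS !mul0mx.
- move=> y.
  have mxD (B C : 'M[R]_1) : (B + C) 0 0 = B 0 0 + C 0 0 by rewrite mxE.
  have -> : (y^T *m K *m y) 0 0 =
      ((G *m y)^T *m L *m (G *m y)) 0 0 + (y^T *m D *m y) 0 0.
    rewrite -mxD; congr (fun_of_matrix _ 0 0).
    by rewrite trmx_mul /D mulmxBr mulmxBl !mulmxA addrC subrK.
  congr (_ + _).
    rewrite mul_mx_diag mxE; apply: eq_bigr => i _.
    by rewrite !mxE mulrAC mulrC expr2.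
  have trE (M : 'M[R]_n) : (y^T *m M *m y) 0 0 = (y^T *m M^T *m y) 0 0.
    have <- : (y^T *m M *m y)^T 0 0 = (y^T *m M *m y) 0 0 by rewrite mxE.
    by rewrite !trmx_mul trmxK mulmxA.
  (* As [Q D Q = 0], splitting the identity into [Z + Q] leaves only terms with a factor [Z].
     Transposing the second one brings [Z] to the left, next to [y^T]; this is where [W = D + D Q]
     comes from. *)
  have DE : D = Z *m D + Q *m D *m Z.
    rewrite -[LHS]mul1mx -ZQ mulmxDl; congr (_ + _).
    by rewrite -[LHS]mulmx1 -ZQ mulmxDr QDQ addr0.
  clearbody D; rewrite {1}DE mulmxDr mulmxDl.
  rewrite mxD (trE (Q *m D *m Z)) !trmx_mul Zs Qs Ds -mxD; congr (fun_of_matrix _ 0 0).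
  by rewrite !mulmxDl !mulmxDr !mulmxA.
Qed.
End spectral_theorem.

(** * Positions in vech and vech^- *)

Section vectorization.
Local Open Scope nat_scope.

(** The index pairs in the order in which [vech] lists the entries. Entries of [vech] become lookups
    in this list, which makes the positions used by [M1] and [Lpu] computable. *)
Definition upper_pairs d : seq ('I_d * 'I_d) :=
  [seq (j, k) | j : 'I_d <- enum 'I_d, k : 'I_d <- [seq k : 'I_d <- enum 'I_d | j <= k]].

Definition strict_upper_pairs d : seq ('I_d * 'I_d) :=
  [seq (j, k) | j : 'I_d <- enum 'I_d, k : 'I_d <- [seq k : 'I_d <- enum 'I_d | j < k]].

Lemma size_filter_leq_enum d m : size [seq k : 'I_d <- enum 'I_d | m <= k] = d - m.
Proof.
rewrite -(size_map val) -filter_map val_enum_ord.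
elim: d => [|d IH]; first by rewrite sub0n.
rewrite -addn1 iotaD filter_cat size_cat IH /= add0n.
by case: ifP => /=; lia.
Qed.

Lemma size_upper_pairs d : size (upper_pairs d) = dim_vech d.
Proof.
rewrite size_allpairs_dep sumnE big_map big_enum /=.
under eq_bigr do rewrite size_filter_leq_enum.
rewrite /dim_vech; elim: d => [|d IH]; first by rewrite big_ord0.
rewrite big_ord_recl subn0; under eq_bigr do rewrite lift0 subSS.
by rewrite IH; nia.
Qed.

Lemma size_strict_upper_pairs d : size (strict_upper_pairs d) = dim_vechm d.
Proof.
rewrite size_allpairs_dep sumnE big_map big_enum /=.
under eq_bigr do rewrite (size_filter_leq_enum _ _.+1).
rewrite /dim_vechm; elim: d => [|d IH]; first by rewrite big_ord0.
rewrite big_ord_recl; under eq_bigr do rewrite lift0 subSS.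
by rewrite IH; case: d {IH} => //= d; nia.
Qed.

Lemma strict_upper_pairsE d :
  strict_upper_pairs d = [seq q : 'I_d * 'I_d <- upper_pairs d | q.1 < q.2].
Proof.
rewrite /strict_upper_pairs /upper_pairs filter_flatten -map_comp.
congr flatten; apply: eq_map => j /=.
rewrite filter_map -filter_predI; congr map; apply: eq_filter => k /=.
by case: ltngtP.
Qed.

Lemma upper_pairs_uniq d : uniq (upper_pairs d).
Proof.
apply: allpairs_uniq_dep; first exact: enum_uniq.
  by move=> j _; rewrite filter_uniq// enum_uniq.
by move=> [j k] [j' k'] _ _ /= [-> ->].
Qed.

Lemma mem_upper_pairs d (q : 'I_d * 'I_d) : (q \in upper_pairs d) = (q.1 <= q.2).
Proof.
case: q => j k; apply/allpairsPdep/idP => /=.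
  by case=> j' [k' [_]]; rewrite mem_filter => /andP[h _] [-> ->].
move=> jk; exists j, k; split=> //; first by rewrite mem_enum.
by rewrite mem_filter jk mem_enum.
Qed.

Lemma drop_enum_ord d (k : 'I_d) :
  drop k (enum 'I_d) = k :: drop k.+1 (enum 'I_d).
Proof.
rewrite (drop_nth k) ?size_enum_ord//; congr cons.
by apply: val_inj; rewrite /= nth_enum_ord.
Qed.

Lemma take_enum_ord_lt d (k j : 'I_d) : j \in take k (enum 'I_d) -> j < k.
Proof.
move=> /(map_f val); rewrite map_take val_enum_ord take_iota mem_iota add0n.
by move=> /=; lia.
Qed.

(** The block of row [k] starts with [(k, k)], and each earlier row [j] contributes [d - j] pairs;
    these add up to [diag_pos]. *)
Lemma upper_pairs_split d (k : 'I_d) : exists s t,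
  upper_pairs d = s ++ (k, k) :: t /\ size s = diag_pos d 0%R k.
Proof.
pose row (j : 'I_d) := [seq (j, l) | l : 'I_d <- enum 'I_d & j <= l].
have rowk : row k = (k, k) :: [seq (k, l) | l : 'I_d <- drop k.+1 (enum 'I_d) & k <= l].
  rewrite /row -{1}(cat_take_drop k (enum 'I_d)) filter_cat drop_enum_ord /=.
  rewrite leqnn (_ : seq.filter _ (take _ _) = [::])//; apply/eqP.
  rewrite -[_ == _]negbK -has_filter.
  by apply/hasPn => j /take_enum_ord_lt; rewrite ltnNge.
exists (flatten [seq row j | j <- take k (enum 'I_d)]).
exists (behead (row k) ++ flatten [seq row j | j <- drop k.+1 (enum 'I_d)]).
split.
  have -> : (k, k) :: behead (row k) ++ flatten (map row (drop k.+1 (enum 'I_d)))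
      = flatten (map row (drop k (enum 'I_d))).
    by rewrite drop_enum_ord /= rowk.
  by rewrite -flatten_cat -map_cat cat_take_drop.
rewrite size_flatten sumnE /shape -map_comp big_map mxE.
rewrite (eq_bigr (fun j : 'I_d => d - j)); last first.
  by move=> j _ /=; rewrite size_map size_filter_leq_enum.
rewrite -(big_map val predT (fun j => d - j)) map_take val_enum_ord take_iota.
rewrite (minn_idPl (ltnW (ltn_ord k))).
by rewrite -(big_mkord predT (fun j => d - j)) /index_iota subn0.
Qed.

Lemma nth_diag_pos d (k : 'I_d) q :
  diag_pos d 0%R k < dim_vech d /\ nth q (upper_pairs d) (diag_pos d 0%R k) = (k, k).
Proof.
have [s [t [E <-]]] := upper_pairs_split k.
rewrite -size_upper_pairs E size_cat /= addnS ltnS leq_addr; split => //.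
by rewrite nth_cat ltnn subnn.
Qed.

(** A position is diagonal exactly when the pair found there is. Deleting the diagonal positions
    therefore selects the strict pairs, in unchanged order. *)
Lemma nth_offdiag_pos d q l : l < dim_vechm d ->
  nth 0 (offdiag_pos d) l < dim_vech d /\
  nth q (upper_pairs d) (nth 0 (offdiag_pos d) l) = nth q (strict_upper_pairs d) l.
Proof.
move=> ld.
have diag_posP x : x < dim_vech d ->
    (x \notin [seq diag_pos d 0%R k | k <- enum 'I_d]) =
    ((nth q (upper_pairs d) x).1 < (nth q (upper_pairs d) x).2).
  move=> xd; have xu : x < size (upper_pairs d) by rewrite size_upper_pairs.
  have := mem_nth q xu; rewrite mem_upper_pairs leq_eqVlt.
  set y := nth _ _ _; have [yy _|/= yy -> ] := eqVneq (y.1 : nat) y.2.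
    rewrite yy ltnn; apply/negbTE; rewrite negbK; apply/mapP.
    exists y.1; first by rewrite mem_enum.
    have [klt kE] := nth_diag_pos y.1 q; rewrite -size_upper_pairs in klt.
    apply/eqP; rewrite -(nth_uniq q xu klt (upper_pairs_uniq d)) kE -/y.
    by rewrite [y]surjective_pairing (val_inj yy).
  apply/negP => /mapP[k _ xk]; move: yy; rewrite /y xk (nth_diag_pos k q).2.
  by rewrite eqxx.
have posE : [seq nth q (upper_pairs d) x | x <- offdiag_pos d] =
    strict_upper_pairs d.
  rewrite strict_upper_pairsE -{2}(mkseq_nth q (upper_pairs d)) /mkseq.
  rewrite size_upper_pairs filter_map; congr map; apply: eq_in_filter => x.
  by rewrite mem_iota add0n => /diag_posP.
have sz : size (offdiag_pos d) = dim_vechm d.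
  by rewrite -size_strict_upper_pairs -posE size_map.
split; last by rewrite -posE (nth_map 0)// sz.
have : nth 0 (offdiag_pos d) l \in offdiag_pos d by rewrite mem_nth// sz.
by rewrite mem_filter mem_iota add0n => /andP[].
Qed.

Local Open Scope ring_scope.

Lemma vech_nth (K : nmodType) d (A : 'M[K]_d) q l :
  vech A l 0 =
  A (nth q (upper_pairs d) l).1 (nth q (upper_pairs d) l).2.
Proof.
rewrite mxE -(nth_map q 0 (fun p => A p.1 p.2)) ?size_upper_pairs//.
by rewrite map_flatten -map_comp; congr (flatten _)`_l; apply: eq_map => j /=;
  rewrite -map_comp.
Qed.

Lemma vechm_nth (K : nmodType) d (A : 'M[K]_d) q l :
  vechm A l 0 =
  A (nth q (strict_upper_pairs d) l).1 (nth q (strict_upper_pairs d) l).2.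
Proof.
rewrite mxE -(nth_map q 0 (fun p => A p.1 p.2)) ?size_strict_upper_pairs//.
by rewrite map_flatten -map_comp; congr (flatten _)`_l; apply: eq_map => j /=;
  rewrite -map_comp.
Qed.

(** The pair is its own default value: later lookups can use [q] as default, although ['I_d] has no
    canonical element. *)
Lemma vechm_strict_upper d (l : 'I_(dim_vechm d)) : exists q : 'I_d * 'I_d,
  (q.1 < q.2)%N /\ nth q (strict_upper_pairs d) l = q.
Proof.
have ls : (l < size (strict_upper_pairs d))%N by rewrite size_strict_upper_pairs.
case E : (strict_upper_pairs d) => [|q0 s]; first by rewrite E in ls.
rewrite -E; exists (nth q0 (strict_upper_pairs d) l).
split; last by apply: set_nth_default.
have := mem_nth q0 ls; set q := nth _ _ _.
by rewrite strict_upper_pairsE mem_filter => /andP[].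
Qed.

Lemma sum_std_basis (R : realType) n (z : 'cV[R]_n) k (kn : (k < n)%N) :
  ((std_basis R n k)^T *m z) 0 0 = z (Ordinal kn) 0.
Proof.
rewrite mxE (bigD1 (Ordinal kn))//= big1 => [|i ik].
  by rewrite !mxE eqxx mul1r addr0.
by rewrite !mxE -val_eqE /= in ik *; rewrite (negbTE ik) mul0r.
Qed.

Lemma sum_std_basis_mul (R : realType) n m (b : 'I_n -> 'rV[R]_m) (z : 'cV[R]_m) l :
  ((\sum_(i < n) std_basis R n i *m b i) *m z) l 0 = (b l *m z) 0 0.
Proof.
rewrite mulmx_suml summxE (bigD1 l)//= big1 => [|i il].
  rewrite addr0 -mulmxA [LHS]mxE big_ord_recl big_ord0 addr0 !mxE eqxx mul1r.
  by apply: eq_bigr => ? _; rewrite ord1.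
rewrite -mulmxA [LHS]mxE big_ord_recl big_ord0 addr0 mxE.
by rewrite eq_sym -val_eqE /= in il; rewrite (negbTE il) mul0r.
Qed.

(** For positive [V j j] and [r] the correlations of [V], the right-hand side is the differential at
    [V], in the direction [D], of the correlation [V j k / sqrt (V j j * V k k)] with
    [q = (j, k)]. *)
Lemma M_mx_vech (R : realType) d (V D : 'M[R]_d) (r : 'cV[R]_(dim_vechm d))
    (q : 'I_d * 'I_d) (l : 'I_(dim_vechm d)) : nth q (strict_upper_pairs d) l = q ->
  let isq x : R := (Num.sqrt x)^-1 in
  (M_mx V r *m vech D) l 0 =
  isq (V q.1 q.1 * V q.2 q.2) * D q.1 q.2
  - 2^-1 * r l 0 * (isq (V q.1 q.1 * V q.1 q.1) * D q.1 q.1 +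
                    isq (V q.2 q.2 * V q.2 q.2) * D q.2 q.2).
Proof.
move=> lq isq; rewrite /M_mx -mulmxA; set z := diag_isqrt _ *m _.
have zE i : z i 0 = let p := nth q (upper_pairs d) i in
    isq (V p.1 p.1 * V p.2 p.2) * D p.1 p.2.
  rewrite /z /diag_isqrt mul_diag_mx [LHS]mxE [in X in X * _]mxE !(vech_nth _ q).
  by rewrite mxE big_ord_recl big_ord0 addr0 !mxE.
rewrite mulmxBl -scalemxAl -mulmxA mul_diag_mx.
rewrite [LHS]mxE [X in _ + X]mxE [X in _ - X]mxE [X in _ - _ * X]mxE.
rewrite -[r^T 0 l]/(_) [r^T 0 l]mxE mulrA; congr (_ - _ * _).
  have [bp bq] := nth_offdiag_pos q (ltn_ord l).
  by rewrite /Lpu sum_std_basis_mul (sum_std_basis _ bp) zE /= bq lq.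
have [p1 q1] := nth_diag_pos q.1 q; have [p2 q2] := nth_diag_pos q.2 q.
rewrite /M1 sum_std_basis_mul linearD /= mulmxDl mxE.
have -> : h1 d l 0 = diag_pos d 0 q.2 by rewrite (vechm_nth _ q) lq mxE.
have -> : h2 d l 0 = diag_pos d 0 q.1 by rewrite (vechm_nth _ q) lq !mxE.
by rewrite (sum_std_basis _ p1) (sum_std_basis _ p2) !zE /= q1 q2 addrC.
Qed.

End vectorization.

(** * Polynomial approximation and elementary bounds *)

Section weierstrass.
Variable R : realType.

Lemma heine_cantor (f : R -> R) (T e : R) : continuous f -> 0 < e ->
  exists2 del, 0 < del & forall x y, `|x| <= T -> `|x - y| < del ->
    `|f x - f y| < e.
Proof.
move=> cf e0.
have Kc : compact `[- T, T]%classic by exact: segment_compact.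
move/compact_near_coveringP : Kc => /(_ _ (0^'+ : set_system R) 
  (fun del x => forall y, `|x - y| < del -> `|f x - f y| < e) _) [].
  move=> x _.
  have e2 : 0 < e / 2 by rewrite divr_gt0.
  have := cf x; move=> /cvgrPdist_lt /(_ _ e2) [d /= d0 dP].
  have d2 : 0 < d / 2 by rewrite divr_gt0.
  near=> x' del => /= y xy.
  have xx' : `|x - x'| < d / 2 by near: x'; exact: (@cvgr_dist_lt _ _ _ (nbhs x) _ id).
  have deld : del < d / 2 by near: del; exact: nbhs_right_lt.
  have h1 : `|f x - f x'| < e / 2.
    by apply: dP => /=; apply: lt_trans xx' _; rewrite ltr_pdivrMr// ltr_pMr// ltr1n.
  have h2 : `|f x - f y| < e / 2.
    apply: dP => /=; rewrite (_ : x - y = (x - x') + (x' - y)); last by ring.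
    apply: le_lt_trans (ler_normD _ _) _.
    by rewrite [ltRHS]splitr ltrD// (lt_trans xy).
  rewrite (_ : f x' - f y = (f x - f y) - (f x - f x')); last by ring.
  apply: le_lt_trans (ler_normB _ _) _.
  by rewrite [ltRHS]splitr ltrD.
move=> d /= d0 dP; exists (d / 2); first by rewrite divr_gt0.
move=> x y xT xy; apply: (dP (d / 2)) => //=.
- by rewrite sub0r normrN gtr0_norm ?divr_gt0// ltr_pdivrMr// ltr_pMr// ltr1n.
- by rewrite divr_gt0.
- by rewrite in_itv /= -ler_norml.
Unshelve. all: by end_near. Qed.

(* The Bernstein polynomial of degree [N] of the function [k/N |-> phi k],
   built by de Casteljau's recursion instead of binomial coefficients. *)
Fixpoint bernstein N (phi : nat -> R) : {poly R} :=
  if N is N'.+1 then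
    (1 - 'X) * bernstein N' phi + 'X * bernstein N' (phi \o S)
  else (phi 0%N)%:P.

(** For a binomial variable [k] with parameters [N] and [x], the polynomial is the expectation of
    [phi k], and the bracket on the right is the expectation of [(k - a)^2], variance plus squared
    bias. The recursion conditions on one trial; a success replaces [a] by [a - 1]. *)
Lemma bernstein_bound N phi (x a c e C : R) : 0 <= x <= 1 ->
  (forall k, (k <= N)%N -> `|phi k - c| <= e + C * (k%:R - a) ^+ 2) ->
  `|(bernstein N phi).[x] - c| <=
    e + C * (N%:R * (x * (1 - x)) + (N%:R * x - a) ^+ 2).
Proof.
move=> /andP[x0 x1]; elim: N phi a => [|N IH] phi a h /=.
  by rewrite hornerC !mul0r add0r; exact: h.
rewrite !hornerE.
have h1 := IH phi a (fun k kN => h k (leqW kN)).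
have h2 : `|(bernstein N (phi \o S)).[x] - c| <=
    e + C * (N%:R * (x * (1 - x)) + (N%:R * x - (a - 1)) ^+ 2).
  apply: IH => k kN /=.
  have -> : k%:R - (a - 1) = k.+1%:R - a by rewrite -natr1; ring.
  exact: h.
set u := _.[x] in h1 *; set v := _.[x] in h2 *.
rewrite (_ : _ - c = (1 - x) * (u - c) + x * (v - c)); last by ring.
apply: le_trans (ler_normD _ _) _; rewrite !normrM (ger0_norm x0).
rewrite (@ger0_norm _ (1 - x)) ?subr_ge0//.
apply: le_trans (lerD (ler_wpM2l _ h1) (ler_wpM2l x0 h2)) _; first by rewrite subr_ge0.
rewrite [leLHS](_ : _ = e + C * ((N%:R + 1) * (x * (1 - x)) +
  ((N%:R + 1) * x - a) ^+ 2)); last by ring.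
by rewrite natr1 mulrA.
Qed.

Lemma weierstrass (f : R -> R) (T e : R) : continuous f -> 0 < T -> 0 < e ->
  exists p : {poly R}, forall x, `|x| <= T -> `|f x - p.[x]| < e.
Proof.
move=> cf T0 e0.
have e3 : 0 < e / 3 by rewrite divr_gt0.
have [d d0 dP] := heine_cantor T cf e3.
have [M M0 MP] : exists2 M, 0 < M & forall x, `|x| <= T -> `|f x| <= M.
  have [x _ xM] := @EVT_max _ (fun x => `|f x|) (- T) T (ltW (gtrN T0))
    (@continuous_subspaceT _ _ _ _ (fun y => cvg_norm (cf y))).
  exists (`|f x| + 1); first by rewrite ltr_wpDl.
  move=> y yT; apply: le_trans (xM y _) _; first by rewrite in_itv /= -ler_norml.
  by rewrite lerDl.
(* [|f (x_k) - f x| <= e/3 + C (k - N t)^2] with [x_k = 2T k/N - T] *)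
pose K := 8 * M * T ^+ 2 / d ^+ 2.
have K0 : 0 < K by rewrite divr_gt0 ?exprn_gt0// !mulr_gt0// exprn_gt0.
have [N N0 NP] : exists2 N, (0 < N)%N & K / N%:R < e / 3.
  exists (Num.truncn (K / (e / 3))).+1 => //.
  rewrite ltr_pdivrMr ?ltr0n// -ltr_pdivrMl// mulrC.
  by rewrite truncnS_gt.
have NR0 : 0 < N%:R :> R by rewrite ltr0n.
pose phi k := f (2 * T * (k%:R / N%:R) - T).
pose q := bernstein N phi.
exists (q \Po ((2 * T)^-1 *: ('X + T%:P))) => y yT.
rewrite horner_comp !hornerE.
set x := _ * (y + T).
have yE : y = 2 * T * x - T.
  by rewrite /x mulrA divff ?mul1r ?addrK// mulf_neq0 ?gt_eqF.
have x01 : 0 <= x <= 1.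
  have := yT; rewrite ler_norml => /andP[y1 y2].
  rewrite /x mulrC; apply/andP; split.
    by apply: divr_ge0; lra.
  by rewrite ler_pdivrMr ?mulr_gt0//; lra.
have phib k : (k <= N)%N -> `|phi k - f y| <= e / 3 + K / N%:R ^+ 2 * (k%:R - N%:R * x) ^+ 2.
  move=> kN.
  have kT : `|2 * T * (k%:R / N%:R) - T| <= T.
    have k0 : 0 <= k%:R / N%:R :> R by rewrite divr_ge0.
    have k1 : k%:R / N%:R <= 1 :> R by rewrite ler_pdivrMr// mul1r ler_nat.
    have := mulr_ge0 (ltW T0) k0; have := ler_piMr (ltW T0) k1.
    by rewrite ler_norml -mulrA; set z := T * _ => ? ?; apply/andP; split; lra.
  (* Nodes within [d] of [y] are covered by uniform continuity. For the others
     [2 M <= 2 M (x_k - y)^2 / d^2], and [x_k - y = 2 T (k - N x) / N] produces the constant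
     [8 M T^2 / d^2] of [K]. *)
  have [kd|kd] := ltP `|2 * T * (k%:R / N%:R) - T - y| d.
    apply: le_trans (ltW (dP _ _ kT kd)) _; rewrite lerDl mulr_ge0 ?sqr_ge0//.
    by rewrite divr_ge0 ?ltW// exprn_gt0.
  apply: le_trans (ler_normB _ _) _.
  apply: le_trans (lerD (MP _ kT) (MP _ yT)) _.
  have -> : K / N%:R ^+ 2 * (k%:R - N%:R * x) ^+ 2 =
      2 * M * ((2 * T * (k%:R / N%:R) - T - y) ^+ 2 / d ^+ 2).
    by rewrite /K yE; field; rewrite gt_eqF//= gt_eqF.
  have h : 1 <= (2 * T * (k%:R / N%:R) - T - y) ^+ 2 / d ^+ 2.
    rewrite ler_pdivlMr ?exprn_gt0// mul1r -[leRHS]real_normK ?num_real//.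
    by rewrite lerXn2r// nnegrE// ltW.
  nra.
have := bernstein_bound x01 phib; rewrite subrr expr0n /= addr0 -/q => h.
rewrite distrC; apply: le_lt_trans h _.
have xx : x * (1 - x) <= 1 by case/andP: x01 => ? ?; nra.
have -> : K / N%:R ^+ 2 * (N%:R * (x * (1 - x))) = K / N%:R * (x * (1 - x)).
  by field; rewrite gt_eqF.
have KN0 : 0 <= K / N%:R by rewrite divr_ge0// ltW.
have : K / N%:R * (x * (1 - x)) <= K / N%:R by rewrite ler_piMr.
move: NP; set z := K / N%:R; lra.
Qed.

End weierstrass.

Section elementary_inequalities.
Variable R : realType.

Lemma ge0_of_derive_ge0 (f f' : R -> R) : (forall x : R, is_derive x 1 f (f' x)) ->
  (forall x, 0 <= x -> 0 <= f' x) -> f 0 = 0 -> forall x, 0 <= x -> 0 <= f x.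
Proof.
move=> df f'0 f0 x; rewrite le_eqVlt => /predU1P[<-|x0]; first by rewrite f0.
have cf : {within `[0, x], continuous f}.
  apply: continuous_subspaceT => y; apply: differentiable_continuous.
  exact/derivable1_diffP/(@ex_derive _ _ _ _ _ _ _ (df y)).
have [c /itvP c0] := MVT x0 (fun y _ => df y) cf.
rewrite f0 !subr0 => ->; apply: mulr_ge0; last exact: ltW.
by apply: f'0; rewrite ltW// c0.
Qed.

(** Both bounds come from the sign of a derivative. The lower one leads to [cos y >= 1 - y^2 / 2],
    which is [sin (y / 2)^2 <= (y / 2)^2] by the double-angle formula. *)
Lemma sin_bounds (x : R) : 0 <= x -> x - x ^+ 3 / 6 <= sin x <= x.
Proof.
have sin_le (y : R) : 0 <= y -> sin y <= y :> R.
  move=> y0; rewrite -subr_ge0.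
  apply: (@ge0_of_derive_ge0 (fun y => y - sin y) (fun y => 1 - cos y)) => //.
  by rewrite sin0 subrr.
move=> x0; rewrite sin_le// andbT.
suff : 0 <= sin x + x ^+ 3 / 6 - x by lra.
apply: (@ge0_of_derive_ge0 (fun y => sin y + y ^+ 3 / 6 - y)
  (fun y => cos y + y ^+ 2 / 2 - 1)) => //.
- move=> y; apply: is_derive_eq.
  rewrite scaler0 scaler0 add0r; congr (_ + _ - _).
  by rewrite /GRing.scale /= !mulr1; lra.
- move=> y y0.
  have y2 : 0 <= y / 2 by rewrite divr_ge0.
  have sy : sin (y / 2) ^+ 2 <= (y / 2) ^+ 2.
    rewrite -[leLHS]real_normK ?num_real// lerXn2r ?nnegrE// ler_norml sin_le// andbT.
    have [yp|yp] := leP y pi.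
      apply: (@le_trans _ _ 0); first by rewrite oppr_le0.
      apply: sin_ge0_pi; rewrite y2/= (le_trans _ yp)// ler_pdivrMr//.
      by rewrite ler_peMr// ler1n.
    apply: le_trans (sin_geN1 _); rewrite lerN2 ler_pdivlMr// mul1r.
    exact: le_trans (pi_ge2 _) (ltW yp).
  have cE : cos y = 1 - 2 * sin (y / 2) ^+ 2.
    rewrite {1}(_ : y = (y / 2) *+ 2); last by rewrite -mulr_natr divfK.
    by rewrite cos_mulr2n cos2sin2 !mulr2n; ring.
  rewrite cE; move: sy; rewrite expr_div_n; set a := sin _ ^+ 2; lra.
- by rewrite sin0 expr0n /= mul0r; ring.
Qed.

Lemma sin_sub_bound (x : R) : `|sin x - x| <= `|x| ^+ 3 /\ `|sin x - x| <= x ^+ 2.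
Proof.
wlog x0 : x / 0 <= x.
  move=> h; have [/h//|x0] := leP 0 x.
  have [] := h (- x); first by rewrite oppr_ge0 ltW.
  by rewrite sinN -opprD !normrN sqrrN.
have /andP[s1 s2] := sin_bounds x0.
rewrite distrC ger0_norm ?subr_ge0// (ger0_norm x0).
have x30 : 0 <= x ^+ 3 by exact: exprn_ge0.
split; first by lra.
have [x2|x2] := leP x 2.
  have : x ^+ 3 <= x ^+ 2 * 2 by rewrite exprSr ler_wpM2l// sqr_ge0.
  have := sqr_ge0 x; lra.
have := sin_geN1 x.
have : 2 * x <= x ^+ 2 by nra.
lra.
Qed.

Lemma norm_sin_le (x : R) : `|sin x| <= `|x|.
Proof.
wlog x0 : x / 0 <= x.
  move=> h; have [/h//|x0] := leP 0 x.
  by have := h (- x); rewrite sinN !normrN; apply; rewrite oppr_ge0 ltW.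
have /andP[s1 s2] := sin_bounds x0.
rewrite (ger0_norm x0) ler_norml s2 andbT.
have [x2|x2] := leP x 2.
  have : x ^+ 3 <= x * 4.
    by rewrite exprS ler_wpM2l//; nra.
  lra.
have := sin_geN1 x; lra.
Qed.

(** With [y = x / 2] the expression equals [2 (y - sin y) (y + sin y)], which reduces both bounds to
    estimates for the sine. *)
Lemma cos_sub_bound (x : R) :
  `|cos x - 1 + x ^+ 2 / 2| <= `|x| ^+ 3 /\ `|cos x - 1 + x ^+ 2 / 2| <= x ^+ 2.
Proof.
pose y := x / 2.
have xE : x = y *+ 2 by rewrite -mulr_natr /y divfK.
have E : cos x - 1 + x ^+ 2 / 2 = 2 * ((y - sin y) * (y + sin y)).
  by rewrite {1 2}xE cos_mulr2n cos2sin2 !mulr2n; field.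
have [h1 h2] := sin_sub_bound y.
have h3 := norm_sin_le y.
have s : `|y + sin y| <= `|x|.
  rewrite xE mulr2n; apply: le_trans (ler_normD _ _) _.
  rewrite -mulr2n normrMn mulr2n; lra.
rewrite E normrM normrM (ger0_norm (_ : 0 <= 2 :> R))//.
have y1 : `|y - sin y| <= `|x| ^+ 3 / 8.
  have yx : `|y| = `|x| / 2 by rewrite /y normrM (ger0_norm (_ : 0 <= 2^-1)) ?invr_ge0.
  rewrite distrC; apply: le_trans h1 _; rewrite yx.
  by rewrite le_eqVlt; apply/orP; left; apply/eqP; field.
have x0 : 0 <= `|x| by [].
have E1 : 2 * (`|y - sin y| * `|y + sin y|) <= `|x| ^+ 4 / 4.
  apply: (@le_trans _ _ (2 * (`|x| ^+ 3 / 8 * `|x|))).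
    by rewrite ler_pM2l// ler_pM.
  by rewrite (exprSr `|x| 3); lra.
have E2 : 2 * (`|y - sin y| * `|y + sin y|) <= x ^+ 2.
  rewrite -normrM -subr_sqr ger0_norm; last first.
    rewrite subr_ge0 -[leLHS]real_normK ?num_real// -[leRHS]real_normK ?num_real//.
    by rewrite lerXn2r// nnegrE.
  have -> : x ^+ 2 = 4 * y ^+ 2 by rewrite /y; field.
  by have := sqr_ge0 y; have := sqr_ge0 (sin y); lra.
split=> //; have [x2|x2] := leP `|x| 1; last first.
  apply: le_trans E2 _; rewrite -(real_normK (num_real x)).
  by apply: ler_weXn2l => //; exact: ltW.
apply: le_trans E1 _; rewrite exprS; have : 0 <= `|x| ^+ 3 by exact: exprn_ge0.
by nra.
Qed.

(** The upper estimate is [expR x >= 1 + x] inverted: [expR (- x) <= 1 / (1 + x) <= 1 - x + x^2]. *)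
Lemma expRN_bound (x : R) : 0 <= x -> `|expR (- x) - (1 - x)| <= x ^+ 2.
Proof.
move=> x0.
have h1 := expR_ge1Dx (- x).
have h2 : expR (- x) <= (1 + x)^-1.
  by rewrite expRN lef_pV2 ?posrE ?expR_gt0 ?expR_ge1Dx// ltr_wpDr.
have h3 : (1 + x)^-1 <= 1 - x + x ^+ 2.
  rewrite -[leLHS]mul1r ler_pdivrMr ?ltr_wpDr//.
  have := exprn_ge0 3 x0; rewrite (exprS x 2); lra.
by rewrite ler_norml; apply/andP; split; have := sqr_ge0 x; lra.
Qed.

End elementary_inequalities.

(** * Integrals of real functions *)

Notation L1 mu f := (mu.-integrable [set: _] (EFin \o f)).

Section integrable_functions.
Context {d} {T : measurableType d} {R : realType} (mu : {measure set T -> \bar R}).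
Implicit Types f g : T -> R.

Lemma L1_measurable f : L1 mu f -> measurable_fun [set: T] f.
Proof. by move=> /measurable_int/measurable_EFinP. Qed.

Lemma L1D f g : L1 mu f -> L1 mu g -> L1 mu (fun x => f x + g x).
Proof. exact: integrableD. Qed.

Lemma L1Z c f : L1 mu f -> L1 mu (fun x => c * f x).
Proof. by move=> h; exact: (integrableZl measurableT c h). Qed.

Lemma L1B f g : L1 mu f -> L1 mu g -> L1 mu (fun x => f x - g x).
Proof.
move=> fi gi; apply: L1D => //; under eq_fun do rewrite -mulN1r.
exact: L1Z.
Qed.

Lemma L1_sum I (r : seq I) (F : I -> T -> R) : (forall i, L1 mu (F i)) ->
  L1 mu (fun x => \sum_(i <- r) F i x).
Proof.
move=> Fi; elim: r => [|i r IH].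
  by under eq_fun do rewrite big_nil; exact: integrable0.
by under eq_fun do rewrite big_cons; exact: L1D.
Qed.

Lemma L1_le f g : measurable_fun [set: T] f -> (forall x, `|f x| <= g x) ->
  L1 mu g -> L1 mu f.
Proof.
move=> mf fg; apply: le_integrable => //; first exact/measurable_EFinP.
by move=> x _; rewrite lee_fin; apply: le_trans (fg x) (ler_norm _).
Qed.

Lemma L1_norm f : L1 mu f -> L1 mu (fun x => `|f x|).
Proof. by move=> /integrable_abse. Qed.

Lemma L1M_bounded f g M : L1 mu f -> measurable_fun [set: T] g ->
  (forall x, `|g x| <= M) -> L1 mu (fun x => f x * g x).
Proof.
move=> fi mg gM; apply: (@L1_le _ (fun x => M * `|f x|)).
- by apply: measurable_funM => //; exact: L1_measurable.
- by move=> x; rewrite normrM mulrC ler_wpM2r.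
- exact/L1Z/L1_norm.
Qed.

Lemma RintD f g : L1 mu f -> L1 mu g ->
  \int[mu]_x (f x + g x) = \int[mu]_x f x + \int[mu]_x g x.
Proof. exact: RintegralD. Qed.

Lemma RintB f g : L1 mu f -> L1 mu g ->
  \int[mu]_x (f x - g x) = \int[mu]_x f x - \int[mu]_x g x.
Proof. exact: RintegralB. Qed.

Lemma RintZ c f : L1 mu f -> \int[mu]_x (c * f x) = c * \int[mu]_x f x.
Proof. by move=> fi; exact: RintegralZl. Qed.

Lemma Rint_sum I (r : seq I) (F : I -> T -> R) : (forall i, L1 mu (F i)) ->
  \int[mu]_x (\sum_(i <- r) F i x) = \sum_(i <- r) \int[mu]_x F i x.
Proof.
move=> Fi; elim: r => [|i r IH].
  rewrite big_nil; under eq_Rintegral do rewrite big_nil.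
  by rewrite /Rintegral integral0.
rewrite big_cons -IH; under eq_Rintegral do rewrite big_cons.
by rewrite RintD//; exact: L1_sum.
Qed.

Lemma Rint_le f g : L1 mu f -> L1 mu g -> (forall x, f x <= g x) ->
  \int[mu]_x f x <= \int[mu]_x g x.
Proof. by move=> fi gi fg; apply: le_Rintegral. Qed.

Lemma Rint_norm_le f g : measurable_fun [set: T] f -> L1 mu g ->
  (forall x, `|f x| <= g x) -> `|\int[mu]_x f x| <= \int[mu]_x g x.
Proof.
move=> mf gi fg; have fi := L1_le mf fg gi.
apply: le_trans (le_normr_Rintegral measurableT fi) _.
by apply: Rint_le => //; exact: L1_norm.
Qed.

Lemma Rint_eq f g : f =1 g -> \int[mu]_x f x = \int[mu]_x g x.
Proof. by move=> fg; apply: eq_Rintegral => x _; exact: fg. Qed.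

Lemma integral_Rint f : L1 mu f -> (\int[mu]_x (f x)%:E)%E = (\int[mu]_x f x)%:E.
Proof. by move=> fi; rewrite /Rintegral fineK// integrable_fin_num. Qed.

Lemma Rint_dominated (F : nat -> T -> R) f g :
  (forall n, measurable_fun [set: T] (F n)) ->
  (forall x, F n x @[n --> \oo] --> f x) -> L1 mu g ->
  (forall n x, `|F n x| <= g x) ->
  L1 mu f /\ \int[mu]_x F n x @[n --> \oo] --> \int[mu]_x f x.
Proof.
move=> mF cF gi Fg.
have [||||fi _ cvF] := @dominated_convergence _ _ _ mu _ measurableT
  (fun n x => (F n x)%:E) (EFin \o f) (EFin \o g) _ _ _ gi _.
- by move=> n; exact/measurable_EFinP.
- by apply/measurable_EFinP; exact: (measurable_fun_cvg mF (fun x _ => cF x)).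
- by apply: aeW => x _; exact/cvg_EFin/(cF x)/nearW.
- by apply: aeW => x n _; rewrite lee_fin.
split => //; apply: fine_cvg; rewrite -integral_Rint//.
Qed.
End integrable_functions.

Section measures_on_sets.
Context {d1 d2 d} {T1 : measurableType d1} {T2 : measurableType d2}
  {T : measurableType d} {R : realType}.
Variables (mu1 : {measure set T1 -> \bar R}) (mu2 : {measure set T2 -> \bar R}).

(* Two weighted laws that agree on measurable sets agree on bounded functions:
   subtracting [(M/2) \1_(g >= M/2)] from [0 <= g <= M] halves the bound. *)
Lemma eq_Rint_of_indic (a : T1 -> R) (b : T2 -> R) (Y : T1 -> T) (Z : T2 -> T)
    (g : T -> R) (M : R) :
  L1 mu1 a -> L1 mu2 b ->
  measurable_fun [set: T1] Y -> measurable_fun [set: T2] Z ->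
  (forall B, measurable B ->
    \int[mu1]_x (a x * \1_B (Y x)) = \int[mu2]_x (b x * \1_B (Z x))) ->
  measurable_fun [set: T] g -> (forall x, `|g x| <= M) ->
  \int[mu1]_x (a x * g (Y x)) = \int[mu2]_x (b x * g (Z x)).
Proof.
move=> ai bi mY mZ ab.
pose A := \int[mu1]_x `|a x|; pose C := \int[mu2]_x `|b x|.
have bound n (h : T -> R) (N : R) : measurable_fun [set: T] h -> (forall x, 0 <= h x <= N) ->
    `|\int[mu1]_x (a x * h (Y x)) - \int[mu2]_x (b x * h (Z x))| <=
    N / 2 ^+ n * (A + C).
  elim: n h N => [|n IH] h N mh hN.
    have hn x : `|h x| <= N by have /andP[h0 h1] := hN x; rewrite ger0_norm.
    rewrite expr0 divr1 mulrDr; apply: le_trans (ler_normB _ _) _.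
    rewrite /A /C -!RintZ; [|exact: L1_norm..].
    apply: lerD; apply: Rint_norm_le.
    - by apply: measurable_funM; [exact: L1_measurable ai|exact: measurableT_comp].
    - exact/L1Z/L1_norm.
    - by move=> x; rewrite normrM mulrC ler_wpM2r.
    - by apply: measurable_funM; [exact: L1_measurable bi|exact: measurableT_comp].
    - exact/L1Z/L1_norm.
    - by move=> x; rewrite normrM mulrC ler_wpM2r.
  pose B := [set x | N / 2 <= h x].
  have mB : measurable B.
    have -> : B = [set: T] `&` h @^-1` `[N / 2, +oo[%classic.
      by apply/seteqP; split => x /=; rewrite in_itv /= andbT => // -[].
    exact: mh.
  pose h' x := h x - N / 2 * \1_B x.
  have mh' : measurable_fun [set: T] h'.
    by apply: measurable_funB => //; apply: measurable_funM => //; exact: measurable_indic.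
  have h'N x : 0 <= h' x <= N / 2.
    rewrite /h' indicE; have /andP[h0 hN'] := hN x; have [|xB] := boolP (x \in B).
      by rewrite inE /B /=; lra.
    have : ~ B x by move=> xB'; rewrite mem_set in xB.
    by rewrite /B /= => /negP; rewrite -ltNge; lra.
  have hE x : h x = h' x + N / 2 * \1_B x by rewrite /h' subrK.
  have hn' x : `|h' x| <= N / 2 by have /andP[? ?] := h'N x; rewrite ger0_norm.
  have bnd1 x : `|\1_B x : R| <= 1.
    by rewrite indicE; case: (x \in B); rewrite ?normr1 ?normr0.
  have m1 : measurable_fun [set: T] (\1_B : T -> R) by exact: measurable_indic.
  have E1 : \int[mu1]_x (a x * h (Y x)) = \int[mu1]_x (a x * h' (Y x)) +
      N / 2 * \int[mu1]_x (a x * \1_B (Y x)).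
    have h1 : L1 mu1 (fun x => a x * h' (Y x)).
      by apply: (L1M_bounded ai) (fun x => hn' (Y x)); exact: measurableT_comp.
    have h2 : L1 mu1 (fun x => a x * \1_B (Y x)).
      by apply: (L1M_bounded ai) (fun x => bnd1 (Y x)); exact: measurableT_comp.
    rewrite -RintZ// -RintD//; last exact: L1Z.
    by apply: Rint_eq => x; rewrite hE; ring.
  have E2 : \int[mu2]_x (b x * h (Z x)) = \int[mu2]_x (b x * h' (Z x)) +
      N / 2 * \int[mu2]_x (b x * \1_B (Z x)).
    have h1 : L1 mu2 (fun x => b x * h' (Z x)).
      by apply: (L1M_bounded bi) (fun x => hn' (Z x)); exact: measurableT_comp.
    have h2 : L1 mu2 (fun x => b x * \1_B (Z x)).
      by apply: (L1M_bounded bi) (fun x => bnd1 (Z x)); exact: measurableT_comp.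
    rewrite -RintZ// -RintD//; last exact: L1Z.
    by apply: Rint_eq => x; rewrite hE; ring.
  rewrite E1 E2 ab// opprD addrACA subrr addr0.
  by apply: le_trans (IH _ _ mh' h'N) _; rewrite exprS invfM !mulrA.
have AC0 : 0 <= A + C by rewrite addr_ge0//; apply: Rintegral_ge0.
have eq_ge0 (h : T -> R) (N : R) : measurable_fun [set: T] h -> (forall x, 0 <= h x <= N) ->
    \int[mu1]_x (a x * h (Y x)) = \int[mu2]_x (b x * h (Z x)).
  move=> mh hN; apply/eqP; rewrite -subr_eq0 -normr_le0; apply/ler_addgt0Pl => e e0.
  rewrite addr0.
  pose n := Num.truncn (N * (A + C) / e).
  apply: le_trans (bound n h N mh hN) _.
  have NA : N * (A + C) <= e * n.+1%:R.
    by rewrite [leRHS]mulrC -ler_pdivrMr// ltW// truncnS_gt.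
  rewrite mulrAC ler_pdivrMr ?exprn_gt0//; apply: le_trans NA _.
  by rewrite ler_pM2l// -natrX ler_nat ltn_expl.
move=> mg gM.
(* A signed [g] is shifted by [M] to become nonnegative. The shift contributes equally to both
   sides, which is the hypothesis for the whole space. *)
have M0 x : 0 <= g x + M <= M + M.
  by have := gM x; rewrite ler_norml => /andP[? ?]; lra.
have := eq_ge0 (fun x => g x + M) _ (measurable_funD mg (measurable_cst M)) M0.
have := ab _ measurableT.
have gi1 : L1 mu1 (fun x => a x * g (Y x)).
  by apply: (L1M_bounded ai) (fun x => gM (Y x)); exact: measurableT_comp.
have gi2 : L1 mu2 (fun x => b x * g (Z x)).
  by apply: (L1M_bounded bi) (fun x => gM (Z x)); exact: measurableT_comp.
rewrite (Rint_eq _ (g := a)); last by move=> x; rewrite indicT mulr1.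
rewrite (Rint_eq _ (g := b)); last by move=> x; rewrite indicT mulr1.
move=> abT.
under eq_Rintegral do rewrite mulrDr [_ * M]mulrC.
under [in RHS]eq_Rintegral do rewrite mulrDr [_ * M]mulrC.
rewrite !RintD ?RintZ//; [|exact: L1Z..].
by rewrite abT => /addIr.
Qed.

End measures_on_sets.

(** * Characteristic functions *)

Section normal_characteristic_function.
Variable R : realType.
Let mu := @lebesgue_measure R.
Let K : R := normal_peak 1.
Let phi (z : R) : R := K * expR (- (z ^+ 2 / 2)).

Let K0 : 0 < K. Proof. by rewrite normal_peak_gt0. Qed.

Let phiE : normal_pdf 0 1 = phi.
Proof.
apply/funext => z; rewrite normal_pdfE ?oner_neq0// /phi; congr (_ * expR _).
by rewrite subr0 expr1n mulNr.
Qed.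

Let phi_ge0 z : 0 <= phi z. Proof. by rewrite mulr_ge0 ?expR_ge0// ltW. Qed.

Let phi_L1 : L1 mu phi.
Proof. by rewrite -phiE; exact: integrable_normal_pdf. Qed.

Let is_derive_phi (z : R) : is_derive z 1 phi (- z * phi z).
Proof.
rewrite /phi; apply: is_derive_eq.
by rewrite /GRing.scale /=; field.
Qed.

(** Of the two factors [expR (- z^2 / 4)] in [phi], one absorbs [|z|]. The other is a multiple of
    the normal density of variance 2, an integrable majorant for differentiation under the
    integral. *)
Let dphi_le (z : R) : `|z| * phi z <= 2 * K * expR (- (z ^+ 2 / 4)).
Proof.
rewrite /phi (_ : z ^+ 2 / 2 = z ^+ 2 / 4 + z ^+ 2 / 4); last by field.
rewrite opprD expRD; set e := expR _.
have e0 : 0 < e by exact: expR_gt0.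
suff ze : `|z| * e <= 2.
  rewrite (_ : `|z| * (K * (e * e)) = K * e * (`|z| * e)); last by ring.
  rewrite (_ : 2 * K * e = K * e * 2); last by ring.
  by rewrite ler_wpM2l// mulr_ge0// ltW.
rewrite /e expRN ler_pdivrMr ?expR_gt0//.
have := expR_ge1Dx (z ^+ 2 / 4); rewrite -[z ^+ 2]real_normK ?num_real//.
have := sqr_ge0 (`|z| / 2 - 1); set E := expR _; nra.
Qed.

Let dphi_L1 : L1 mu (fun z => 2 * K * expR (- (z ^+ 2 / 4))).
Proof.
have s2 : Num.sqrt 2 != 0 :> R by rewrite sqrtr_eq0 -ltNge.
have := @integrable_normal_pdf R 0 (Num.sqrt 2) => h.
have -> : (fun z => 2 * K * expR (- (z ^+ 2 / 4))) =
    (fun z : R => 2 * K / normal_peak (Num.sqrt 2) * normal_pdf 0 (Num.sqrt 2) z).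
  apply/funext => z; rewrite normal_pdfE// mulrA divfK ?gt_eqF ?normal_peak_gt0//.
  congr (_ * expR _); rewrite subr0 sqr_sqrtr// -mulr_natr.
  by field.
exact: L1Z.
Qed.

Let measurable_phi : measurable_fun [set: R] phi.
Proof. by rewrite -phiE; exact: measurable_normal_pdf. Qed.

Let continuous_phi : continuous phi.
Proof. by rewrite -phiE; apply: continuous_normal_pdf; exact: oner_neq0. Qed.

Let g (t : R) := \int[mu]_z (phi z * cos (t * z)).

Let zsin_le (t z : R) : `|- z * phi z * sin (t * z)| <= `|z| * phi z.
Proof.
rewrite (normrM _ (sin _)) (normrM (- z)) normrN (ger0_norm (phi_ge0 z)).
by rewrite ler_piMr ?sin_max// mulr_ge0.
Qed.

Let zsin_L1 (t : R) : L1 mu (fun z => - z * phi z * sin (t * z)).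
Proof.
apply: L1_le dphi_L1 => [|z].
  apply: measurable_funM; first by apply: measurable_funM.
  apply: measurableT_comp; last exact: mulrl_measurable.
  by apply: continuous_measurable_fun; exact: continuous_sin.
apply: le_trans (dphi_le z); exact: zsin_le.
Qed.

Let cos_L1 (t : R) : L1 mu (fun z => phi z * cos (t * z)).
Proof.
apply: L1M_bounded (phi_L1) _ (fun z => cos_max (t * z)).
apply: measurableT_comp; last exact: mulrl_measurable.
by apply: continuous_measurable_fun; exact: continuous_cos.
Qed.

Let is_derive_g (t : R) : is_derive t 1 g (\int[mu]_z (- z * phi z * sin (t * z))).
Proof.
pose f (x z : R) := phi z * cos (x * z).
have df (x z : R) : is_derive x 1 (f ^~ z) (- z * phi z * sin (x * z)).
  rewrite /f; apply: is_derive_eq.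
  by rewrite /GRing.scale /= ?mulr1 ?mulr0 ?add0r ?addr0 ?scaler1; ring.
have d1 x z : partial1of2 f x z = - z * phi z * sin (x * z).
  by rewrite partial1of2E; exact: (@derive_val _ _ _ _ _ _ _ (df x z)).
have tI : `]t - 1, t + 1[%classic t by rewrite /= in_itv /= ltrBlDr ltrDl ltr01.
apply: DeriveDef.
  apply: (@derivable_under_integral R _ _ mu f setT measurableT t
    (t - 1) (t + 1) tI (fun x _ => cos_L1 x)
    (fun x z _ _ => @ex_derive _ _ _ _ _ _ _ (df x z))
    (fun z => 2 * K * expR (- (z ^+ 2 / 4))) _ dphi_L1 _) => [z|x z _ _].
    by rewrite mulr_ge0 ?expR_ge0// mulr_ge0// ltW.
  rewrite d1; apply: le_trans (dphi_le z); exact: zsin_le.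
rewrite -derive1E.
rewrite (@differentiation_under_integral R _ _ mu f setT measurableT t
    (t - 1) (t + 1) tI (fun x _ => cos_L1 x)
    (fun x z _ _ => @ex_derive _ _ _ _ _ _ _ (df x z))
    (fun z => 2 * K * expR (- (z ^+ 2 / 4))) _ dphi_L1 _) => [|z|x z _ _].
- by apply: Rint_eq => z; rewrite d1.
- by rewrite mulr_ge0 ?expR_ge0// mulr_ge0// ltW.
- rewrite d1; apply: le_trans (dphi_le z); exact: zsin_le.
Qed.

(* Integrate the derivative of [phi z * sin (t * z)] over the real line. *)
Let zsinE (t : R) : \int[mu]_z (- z * phi z * sin (t * z)) = - t * g t.
Proof.
pose F (z : R) := phi z * sin (t * z).
pose F' (z : R) := - z * phi z * sin (t * z) + t * (phi z * cos (t * z)).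
have dF (z : R) : is_derive z 1 F (F' z).
  rewrite /F /F'; apply: is_derive_eq.
  by rewrite /phi /GRing.scale /=; field.
have F'i : L1 mu F' by apply: L1D => //; exact: L1Z.
have cF : continuous F.
  move=> z; apply: differentiable_continuous.
  exact/derivable1_diffP/(@ex_derive _ _ _ _ _ _ _ (dF z)).
have cF' : continuous F'.
  move=> z; apply: cvgD.
    apply: cvgM; last by apply: continuous_comp; [exact: mulrl_continuous|exact: continuous_sin].
    by apply: cvgM; [exact: cvgN|exact: continuous_phi].
  apply: cvgM; first exact: cvg_cst.
  apply: cvgM; first exact: continuous_phi.
  by apply: continuous_comp; [exact: mulrl_continuous|exact: continuous_cos].
suff F'0 : \int[mu]_z F' z = 0.
  move: F'0; rewrite RintD// ?RintZ//; last exact: L1Z.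
  by move/eqP; rewrite addr_eq0 => /eqP ->; rewrite mulNr.
(* The intervals exhaust the line; [n.+1] keeps them nondegenerate at [n = 0], as the fundamental
   theorem of calculus requires. *)
pose I n := `[- n.+1%:R, n.+1%:R]%classic : set R.
have mI n : measurable (I n) by rewrite /I; exact: measurable_itv.
have [|||_] := @Rint_dominated _ _ _ mu (fun n z => F' z * \1_(I n) z) F'
  (fun z => `|F' z|) _ _ (L1_norm F'i) _.
- by move=> n; apply: measurable_funM; [exact: L1_measurable F'i|exact: measurable_indic (mI n)].
- move=> z; apply: cvg_near_cst; near=> n.
  rewrite indicE mem_set ?mulr1// /I /= in_itv /= -ler_norml.
  rewrite (le_trans (ltW (truncnS_gt `|z|)))// ler_nat ltnS.
  by near: n; exists (Num.truncn `|z|).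
- move=> n z; rewrite normrM ler_piMr// indicE.
  by case: (_ \in _); rewrite ?normr1 ?normr0.
have -> : (fun n => \int[mu]_z (F' z * \1_(I n) z)) =
    (fun n : nat => F n.+1%:R - F (- n.+1%:R)).
  apply/funext => n.
  have ab : - n.+1%:R < n.+1%:R :> R by rewrite gtrN// ltr0n.
  have := @continuous_FTC2 R F' F _ _ ab (continuous_subspaceT cF').
  rewrite -EFinB => FTC; apply: EFin_inj; rewrite -FTC.
  + rewrite -integral_Rint; last first.
      apply: (L1M_bounded F'i (measurable_indic (mI n))) => // z.
      by rewrite indicE; case: (_ \in _); rewrite ?normr1 ?normr0.
    rewrite [RHS]integral_mkcond; apply: eq_integral => z _.
    by rewrite epatch_indic EFinM.
  + split; first by move=> z _; exact: (@ex_derive _ _ _ _ _ _ _ (dF z)).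
      by apply: cvg_at_right_filter; exact: cF.
    by apply: cvg_at_left_filter; exact: cF.
  + by move=> z _; rewrite derive1E; exact: (@derive_val _ _ _ _ _ _ _ (dF z)).
move=> /cvg_lim <-//; apply: cvg_lim => //.
apply: norm_cvg0.
apply: (@squeeze_cvgr _ _ _ _ (cst 0) (fun n : nat => 4 * K * n.+1%:R^-1)).
- near=> n; rewrite normr_ge0 /=.
  have Fle (z : R) : `|F z| <= phi z.
    by rewrite normrM (ger0_norm (phi_ge0 z)) ler_piMr// sin_max.
  apply: le_trans (ler_normB _ _) _; apply: le_trans (lerD (Fle _) (Fle _)) _.
  have -> : phi (- n.+1%:R) = phi n.+1%:R by rewrite /phi sqrrN.
  set x : R := n.+1%:R; have x0 : 0 < x by rewrite ltr0n.
  (* Since [expR (x^2 / 2) >= 1 + x^2 / 2 >= x / 2], each boundary value is at most [2 K / x]. *)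
  have xE : expR (- (x ^+ 2 / 2)) <= (x / 2)^-1.
    rewrite expRN lef_pV2 ?posrE ?expR_gt0 ?divr_gt0//.
    by apply: le_trans (expR_ge1Dx _); have := sqr_ge0 (x - 1); nra.
  have : phi x <= K * (x / 2)^-1 by rewrite ler_pM2l.
  by rewrite invfM invrK mulrA; set y := x^-1; lra.
- exact: cvg_cst.
- rewrite -[X in _ --> X](mulr0 (4 * K)); apply: cvgM; first exact: cvg_cst.
  exact: cvg_harmonic.
Unshelve. all: by end_near. Qed.

(** The integration by parts in [zsinE] gives [g' = - t g], so [g t * expR (t^2 / 2)] is constant,
    with value 1 at 0. *)
Lemma normal_char_fun (t : R) :
  \int[mu]_z (normal_pdf 0 1 z * cos (t * z)) = expR (- (t ^+ 2 / 2)).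
Proof.
rewrite phiE -/(g t).
pose h (t : R) := g t * expR (t ^+ 2 / 2).
have dh (s : R) : is_derive s 1 h 0.
  have dg := is_derive_g s; rewrite zsinE in dg.
  rewrite /h; apply: is_derive_eq.
  by rewrite /GRing.scale /=; field.
have h0 : h 0 = 1.
  rewrite /h expr0n /= mul0r expR0 mulr1 /g.
  transitivity (\int[mu]_z phi z).
    by apply: Rint_eq => z; rewrite mul0r cos0 mulr1.
  by apply: EFin_inj; rewrite -integral_Rint// -phiE integral_normal_pdf.
have := @is_derive_0_is_cst _ h t 0 dh; rewrite h0 /h => ht.
have E0 : expR (t ^+ 2 / 2) != 0 by rewrite gt_eqF// expR_gt0.
by apply: (mulIf E0); rewrite expRN mulVf// ht.
Qed.

(** An instance of [eq_Rint_of_indic]: weight 1 against the normal law, and the density as weight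
    against Lebesgue measure, agree on indicators. *)
Lemma integral_normal_prob (f : R -> R) M : measurable_fun [set: R] f ->
  (forall z, `|f z| <= M) ->
  \int[normal_prob 0 1]_z f z = \int[mu]_z (normal_pdf 0 1 z * f z).
Proof.
move=> mf fM.
have one_L1 : L1 (normal_prob (0 : R) 1) (cst 1).
  exact: finite_measure_integrable_cst.
transitivity (\int[normal_prob 0 1]_z (cst 1 z * f (id z))).
  by apply: Rint_eq => z; rewrite mul1r.
apply: (@eq_Rint_of_indic _ _ _ _ _ _ R (normal_prob 0 1) mu (cst 1)
  (normal_pdf 0 1) id id f M one_L1 (integrable_normal_pdf 0 1)) => //.
move=> B mB; apply: EFin_inj; rewrite -!integral_Rint; last 2 first.
- apply: (L1M_bounded (integrable_normal_pdf 0 1) (measurable_indic mB) (M := 1)).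
  by move=> z; rewrite indicE; case: (_ \in _); rewrite ?normr1 ?normr0.
- apply: (L1M_bounded one_L1 (measurable_indic mB) (M := 1)).
  by move=> z; rewrite indicE; case: (_ \in _); rewrite ?normr1 ?normr0.
transitivity (normal_prob (0 : R) 1 B).
  by under eq_integral do rewrite mul1r; rewrite integral_indic// setIT.
rewrite [LHS]integral_mkcond; apply: eq_integral => z _.
by rewrite epatch_indic EFinM.
Qed.

Lemma normal_prob_char_fun (t : R) :
  \int[normal_prob 0 1]_z cos (t * z) = expR (- (t ^+ 2 / 2)).
Proof.
rewrite -normal_char_fun (@integral_normal_prob _ 1)//.
  apply: measurableT_comp; last exact: mulrl_measurable.
  by apply: continuous_measurable_fun; exact: continuous_cos.
by move=> z; exact: cos_max.
Qed.

End normal_characteristic_function.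

Section bounded_measurable.
Context {d} {T : measurableType d} {R : realType} (P : probability T R).
Implicit Types f g : T -> R.

Definition bmeas f := measurable_fun [set: T] f /\ exists M, forall x, `|f x| <= M.

Lemma bmeasM f g : bmeas f -> bmeas g -> bmeas (fun x => f x * g x).
Proof.
move=> [mf [M fM]] [mg [N gN]]; split; first exact: measurable_funM.
by exists (M * N) => x; rewrite normrM ler_pM.
Qed.

Lemma bmeas_prod I (s : seq I) (F : I -> T -> R) : (forall i, bmeas (F i)) ->
  bmeas (fun x => \prod_(i <- s) F i x).
Proof.
move=> bF; elim: s => [|i s IH].
  by under eq_fun do rewrite big_nil; split => //; exists 1 => x; rewrite normr1.
by under eq_fun do rewrite big_cons; exact: bmeasM.
Qed.

Lemma L1_cst c : L1 P (fun=> c).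
Proof. exact: finite_measure_integrable_cst. Qed.

Lemma bmeas_L1 f : bmeas f -> L1 P f.
Proof.
move=> [mf [M fM]]; exact: L1_le mf fM (L1_cst M).
Qed.

Lemma Rint_cst c : \int[P]_x c = c.
Proof.
rewrite (_ : (\int[P]_x c)%R = \int[P]_(x in setT) cst c x)//.
by rewrite Rintegral_cst// [X in fine X](_ : _ = 1%E) ?mulr1//; exact: probability_setT.
Qed.

Lemma bmeas_indic d' (T' : measurableType d') (Y : T -> T') (B : set T') :
  measurable_fun [set: T] Y -> measurable B -> bmeas (fun x => \1_B (Y x)).
Proof.
move=> mY mB; split; first by apply: measurableT_comp mY; exact: measurable_indic.
by exists 1 => x; rewrite indicE; case: (_ \in _); rewrite ?normr1 ?normr0.
Qed.

Lemma Rint_indic d' (T' : measurableType d') (Y : T -> T') (B : set T') :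
  measurable_fun [set: T] Y -> measurable B ->
  \int[P]_x \1_B (Y x) = fine (P (Y @^-1` B)).
Proof.
move=> mY mB; rewrite /Rintegral.
have mYB : measurable (Y @^-1` B).
  by rewrite -[X in measurable X]setTI; exact: mY.
by rewrite -[in RHS](setIT (Y @^-1` B)) -(integral_indic P measurableT mYB).
Qed.

Lemma bmeas_cos f : measurable_fun [set: T] f -> bmeas (fun x => cos (f x)).
Proof.
move=> mf; split; last by exists 1 => x; exact: cos_max.
by apply: measurableT_comp mf; apply: continuous_measurable_fun; exact: continuous_cos.
Qed.

Lemma bmeas_sin f : measurable_fun [set: T] f -> bmeas (fun x => sin (f x)).
Proof.
move=> mf; split; last by exists 1 => x; exact: sin_max.
by apply: measurableT_comp mf; apply: continuous_measurable_fun; exact: continuous_sin.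
Qed.

End bounded_measurable.

(** * Independence: expectations of products and cosines of sums *)

Section independence.
Context {d d'} {T : measurableType d} {T' : measurableType d'} {R : realType}.
Variables (P : probability T R) (I : choiceType) (X : I -> {RV P >-> T'}).
Hypothesis Xind : mutually_independent X.

Let mX i : measurable_fun [set: T] (X i).
Proof. exact: measurable_funPT. Qed.

Lemma Rint_prod_indic (s : seq I) (B : I -> set T') : uniq s ->
  (forall i, measurable (B i)) ->
  \int[P]_w (\prod_(i <- s) \1_(B i) (X i w)) =
  \prod_(i <- s) \int[P]_w \1_(B i) (X i w).
Proof.
move=> us mB.
have := Xind [fset i in s]%fset mB.
have ps : perm_eq [fset i in s]%fset s.
  by apply: uniq_perm => // i; rewrite !inE.
rewrite (perm_big _ ps) /=.
have -> : (\prod_(i <- s) P (X i @^-1` B i))%E =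
    (\prod_(i <- s) \int[P]_w \1_(B i) (X i w))%:E.
  elim: s {us ps} => [|i s IH]; first by rewrite !big_nil.
  rewrite !big_cons IH EFinM Rint_indic// fineK// fin_num_measure//.
  by rewrite -[X in measurable X]setTI; exact: mX.
move=> E; apply: EFin_inj; rewrite -E -integral_Rint; last first.
  by apply: bmeas_L1; apply: bmeas_prod => i; exact: bmeas_indic.
have mcap : measurable (\bigcap_(j in [set` [fset i in s]%fset]) X j @^-1` B j).
  apply: fin_bigcap_measurable => // i _.
  by rewrite -[X in measurable X]setTI; exact: mX.
rewrite -[in RHS](setIT (\bigcap_(_ in _) _)) -integral_indic//.
apply: eq_integral => w _; congr EFin.
rewrite indicE; case: (boolP (w \in _)) => [|wn].
  rewrite inE => wB; rewrite big_seq big1// => i si.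
  by rewrite indicE mem_set//; apply: wB; rewrite /= !inE.
have /existsNP[i] : ~ (forall i, i \in s -> B i (X i w)).
  move=> h; move: wn; rewrite notin_setE; apply => i /=.
  by rewrite !inE; exact: h.
move=> /not_implyP[si nB]; rewrite (big_rem i)//= indicE memNset// mul0r.
by [].
Qed.

(** Independence is given on sets; the induction upgrades one indicator at a time to a bounded
    function. By the induction hypothesis, the law of [X i] weighted by the other factors [h] agrees
    on sets with its law weighted by the constant [c], and [eq_Rint_of_indic] extends this to [g i].
    The list [s2] keeps the indicators that the induction hypothesis must still accept. *)
Lemma Rint_prod_indep_indic (s1 s2 : seq I) (g : I -> T' -> R) (B : I -> set T') :
  uniq (s1 ++ s2) -> (forall i, bmeas (g i)) -> (forall i, measurable (B i)) ->
  \int[P]_w ((\prod_(i <- s1) g i (X i w)) * \prod_(i <- s2) \1_(B i) (X i w)) =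
  (\prod_(i <- s1) \int[P]_w g i (X i w)) * \prod_(i <- s2) \int[P]_w \1_(B i) (X i w).
Proof.
move=> + bg; elim: s1 s2 B => [|i s1 IH] s2 B us mB.
  rewrite big_nil mul1r -Rint_prod_indic//.
  by apply: Rint_eq => w; rewrite big_nil mul1r.
have bgX j : bmeas (fun w => g j (X j w)).
  by have [mg [M gM]] := bg j; split; [exact: measurableT_comp|exists M => x].
move: us; rewrite cat_cons cons_uniq mem_cat negb_or => /andP[/andP[i1 i2] us].
pose h w := (\prod_(j <- s1) g j (X j w)) * \prod_(j <- s2) \1_(B j) (X j w).
pose c := (\prod_(j <- s1) \int[P]_w g j (X j w)) *
  \prod_(j <- s2) \int[P]_w \1_(B j) (X j w).
have bh : bmeas h.
  apply: bmeasM; first by apply: bmeas_prod => j; exact: bgX.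
  by apply: bmeas_prod => j; exact: bmeas_indic.
have [mg [M gM]] := bg i.
rewrite big_cons -mulrA -/c mulrC -RintZ; last exact: (bmeas_L1 _ (bgX i)).
rewrite (Rint_eq _ (g := fun w => h w * g i (X i w))); last first.
  by move=> w; rewrite big_cons /h; ring.
apply: (@eq_Rint_of_indic _ _ _ _ _ _ R P P h (fun=> c) (X i) (X i) (g i) M) => //.
- exact: bmeas_L1.
- exact: L1_cst.
move=> C mC.
pose B' j := if j == i then C else B j.
have B's : {in s2, B' =1 B}.
  by move=> j j2; rewrite /B' ifN//; apply: contraNneq i2 => <-.
have us' : uniq (s1 ++ i :: s2).
  by rewrite -cat1s uniq_catCA cat1s cons_uniq mem_cat negb_or i1 i2.
have mB' j : measurable (B' j) by rewrite /B'; case: ifP.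
have B'i : B' i = C by rewrite /B' eqxx.
have E1 w : \prod_(j <- s2) \1_(B' j) (X j w) = \prod_(j <- s2) \1_(B j) (X j w) :> R.
  by apply: eq_big_seq => j js; rewrite (B's _ js).
have E2 : \prod_(j <- s2) \int[P]_w \1_(B' j) (X j w) =
    \prod_(j <- s2) \int[P]_w \1_(B j) (X j w).
  by apply: eq_big_seq => j js; rewrite (B's _ js).
have := IH (i :: s2) B' us' mB'; rewrite big_cons B'i E2.
rewrite RintZ; last by apply: bmeas_L1; exact: bmeas_indic.
rewrite mulrCA mulrC -/c mulrC => <-; apply: Rint_eq => w.
rewrite big_cons B'i /h E1.
by ring.
Qed.

Lemma Rint_prod_indep (s : seq I) (g : I -> T' -> R) :
  uniq s -> (forall i, bmeas (g i)) ->
  \int[P]_w (\prod_(i <- s) g i (X i w)) = \prod_(i <- s) \int[P]_w g i (X i w).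
Proof.
move=> us bg; have := @Rint_prod_indep_indic s [::] g (fun=> setT).
rewrite cats0 big_nil mulr1 => <- //.
by apply: Rint_eq => w; rewrite big_nil mulr1.
Qed.

Variable x : I -> T' -> R.
Hypothesis mx : forall i, measurable_fun [set: T'] (x i).

Let mxX i : measurable_fun [set: T] (fun w => x i (X i w)).
Proof. exact: measurableT_comp. Qed.

(** Induction on [s]: [cos (x + S)] is [cos x cos S - sin x cos (S - pi / 2)], so the leading
    variable moves from the sum to the product. A general constant [c] lets the sine of a sum be
    treated as a cosine. *)
Lemma Rint_prod_cos_sum (s t : seq I) (g : I -> T' -> R) c :
  uniq (s ++ t) -> (forall i, bmeas (g i)) ->
  \int[P]_w ((\prod_(i <- t) g i (X i w)) * cos (\sum_(i <- s) x i (X i w) + c)) =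
  (\prod_(i <- t) \int[P]_w g i (X i w)) *
  \int[P]_w cos (\sum_(i <- s) x i (X i w) + c).
Proof.
elim: s t g c => [|i s IH] t g c us bg.
  rewrite [in RHS](Rint_eq _ (g := fun=> cos c)); last first.
    by move=> w; rewrite big_nil add0r.
  rewrite Rint_cst -Rint_prod_indep// mulrC -RintZ; last first.
    apply: bmeas_L1; apply: bmeas_prod => j; have [mg [M gM]] := bg j.
    by split; [exact: measurableT_comp|exists M => w].
  by apply: Rint_eq => w; rewrite big_nil add0r mulrC.
move: us; rewrite cat_cons cons_uniq mem_cat negb_or => /andP[/andP[is_ it] us].
pose gc j := if j == i then (fun y => cos (x i y)) else g j.
pose gs j := if j == i then (fun y => sin (x i y)) else g j.
have bgc j : bmeas (gc j) by rewrite /gc; case: ifP => // _; exact: bmeas_cos.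
have bgs j : bmeas (gs j) by rewrite /gs; case: ifP => // _; exact: bmeas_sin.
have us1 : uniq (s ++ [:: i]).
  by rewrite cats1 rcons_uniq is_; move: us; rewrite cat_uniq => /andP[].
have us2 : uniq (s ++ i :: t).
  by rewrite -cat1s uniq_catCA cat1s cons_uniq mem_cat negb_or is_ it.
have bS c' : bmeas (fun w => cos (\sum_(j <- s) x j (X j w) + c')).
  apply: bmeas_cos; apply: measurable_funD => //.
  by apply: measurable_sum => j; exact: mxX.
have bgX g' j : (forall j, bmeas (g' j)) -> bmeas (fun w => g' j (X j w)).
  by move=> /(_ j)[mg [M gM]]; split; [exact: measurableT_comp|exists M => y].
have E w : cos (\sum_(j <- i :: s) x j (X j w) + c) =
    cos (x i (X i w)) * cos (\sum_(j <- s) x j (X j w) + c) -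
    sin (x i (X i w)) * cos (\sum_(j <- s) x j (X j w) + (c - pi / 2)).
  by rewrite big_cons -addrA cosD addrA cosBpihalf.
(* Used twice: with [t' = t] to expand the left-hand side, and with [t'] empty to fold the expansion
   back into the expectation of the cosine. *)
have key t' : t' = [::] \/ t' = t -> uniq (s ++ i :: t') ->
  \int[P]_w ((\prod_(j <- t') g j (X j w)) *
    cos (\sum_(j <- i :: s) x j (X j w) + c)) =
  (\prod_(j <- t') \int[P]_w g j (X j w)) *
  ((\int[P]_w cos (x i (X i w))) * (\int[P]_w cos (\sum_(j <- s) x j (X j w) + c)) -
   (\int[P]_w sin (x i (X i w))) *
     (\int[P]_w cos (\sum_(j <- s) x j (X j w) + (c - pi / 2)))).
  move=> t'P us'.
  have it' : i \notin t' by case: t'P => ->.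
  have gcE' w : \prod_(j <- t') g j (X j w) = \prod_(j <- t') gc j (X j w).
    by apply: eq_big_seq => j jt; rewrite /gc ifN//; apply: contraNneq it' => <-.
  have gsE' w : \prod_(j <- t') g j (X j w) = \prod_(j <- t') gs j (X j w).
    by apply: eq_big_seq => j jt; rewrite /gs ifN//; apply: contraNneq it' => <-.
  rewrite (Rint_eq _ (g := fun w =>
    (\prod_(j <- i :: t') gc j (X j w)) * cos (\sum_(j <- s) x j (X j w) + c) -
    (\prod_(j <- i :: t') gs j (X j w)) *
       cos (\sum_(j <- s) x j (X j w) + (c - pi / 2)))); last first.
    move=> w; rewrite E !big_cons -gcE' -gsE' /gc /gs eqxx; ring.
  rewrite RintB; last 2 first.
  - by apply: bmeas_L1; apply: bmeasM => //; apply: bmeas_prod => j; exact: bgX.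
  - by apply: bmeas_L1; apply: bmeasM => //; apply: bmeas_prod => j; exact: bgX.
  rewrite !IH// !big_cons {1}/gc {1}/gs eqxx.
  rewrite [X in _ * X * _ - _](eq_big_seq (fun j => \int[P]_w g j (X j w))); last first.
    by move=> j jt; rewrite /gc ifN//; apply: contraNneq it' => <-.
  rewrite [X in _ - _ * X * _](eq_big_seq (fun j => \int[P]_w g j (X j w))); last first.
    by move=> j jt; rewrite /gs ifN//; apply: contraNneq it' => <-.
  by ring.
rewrite (key t)//; last by right.
congr (_ * _); have := key [::] (or_introl erefl) us1.
rewrite big_nil mul1r => <-; apply: Rint_eq => w.
by rewrite big_nil mul1r.
Qed.

Lemma Rint_cos_sum_cons i (s : seq I) c : uniq (i :: s) ->
  \int[P]_w cos (\sum_(j <- i :: s) x j (X j w) + c) =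
  (\int[P]_w cos (x i (X i w))) * (\int[P]_w cos (\sum_(j <- s) x j (X j w) + c)) -
  (\int[P]_w sin (x i (X i w))) *
     (\int[P]_w cos (\sum_(j <- s) x j (X j w) + (c - pi / 2))).
Proof.
move=> us.
have us' : uniq (s ++ [:: i]) by rewrite cats1 rcons_uniq -cons_uniq.
have bS c' : bmeas (fun w => cos (\sum_(j <- s) x j (X j w) + c')).
  apply: bmeas_cos; apply: measurable_funD => //.
  by apply: measurable_sum => j; exact: mxX.
have := @Rint_prod_cos_sum s [:: i] (fun _ y => cos (x i y)) c us' (fun _ => bmeas_cos (mx i)).
rewrite big_seq1 => <-.
have := @Rint_prod_cos_sum s [:: i] (fun _ y => sin (x i y)) (c - pi / 2) us'
  (fun _ => bmeas_sin (mx i)).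
rewrite big_seq1 => <-.
rewrite -RintB.
- apply: Rint_eq => w; rewrite !big_seq1 big_cons -addrA cosD addrA.
  by rewrite cosBpihalf.
- apply: bmeas_L1; apply: bmeasM => //; apply: bmeas_prod => j.
  by apply: bmeas_cos; exact: measurableT_comp.
- apply: bmeas_L1; apply: bmeasM => //; apply: bmeas_prod => j.
  by apply: bmeas_sin; exact: measurableT_comp.
Qed.

Lemma cos_sum_approx (s : seq I) (rho : I -> R) c : uniq s ->
  (forall i, 0 <= rho i <= 1) ->
  `|\int[P]_w cos (\sum_(i <- s) x i (X i w) + c) - (\prod_(i <- s) rho i) * cos c| <=
  \sum_(i <- s) (`|\int[P]_w cos (x i (X i w)) - rho i| +
                 `|\int[P]_w sin (x i (X i w))|).
Proof.
move=> + rho01; elim: s c => [|i s IH] c us.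
  rewrite !big_nil mul1r (Rint_eq _ (g := fun=> cos c)) ?Rint_cst ?subrr ?normr0//.
  by move=> w; rewrite big_nil add0r.
rewrite Rint_cos_sum_cons// !big_cons.
have le1 c' : `|\int[P]_w cos (\sum_(j <- s) x j (X j w) + c')| <= 1.
  rewrite -[leRHS](Rint_cst P); apply: Rint_norm_le.
  - apply: (bmeas_cos _).1; apply: measurable_funD => //.
    by apply: measurable_sum => j; exact: mxX.
  - exact: L1_cst.
  - by move=> w; exact: cos_max.
move: us; rewrite cons_uniq => /andP[_ us].
have /andP[r0 r1] := rho01 i.
have := IH c us; have := le1 c; have := le1 (c - pi / 2).
set A := \int[P]_w cos (_ + c); set B := \int[P]_w cos (_ + (c - _)).
set a := \int[P]_w _; set b := \int[P]_w _; set S := \sum_(_ <- _) _.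
set r := rho i; set p := \prod_(_ <- _) _ => B1 A1 h.
(* One factor is exchanged: [a] is replaced by [r], the induction hypothesis compares [A] with
   [p cos c], and the sine term stays as an error. All multipliers are at most 1 in absolute
   value. *)
rewrite (_ : _ - _ = (a - r) * A + r * (A - p * cos c) - b * B); last by ring.
apply: le_trans (ler_normB _ _) _; rewrite normrM.
apply: (@le_trans _ _ (`|a - r| + S + `|b|)); last by rewrite addrAC.
apply: lerD; last by rewrite ler_piMr.
apply: le_trans (ler_normD _ _) _; rewrite !normrM; apply: lerD.
  by rewrite ler_piMr.
rewrite (ger0_norm r0); apply: le_trans h.
by rewrite ler_piMl.
Qed.

End independence.

Section second_moments.
Context {d} {T : measurableType d} {R : realType} (P : probability T R).
Implicit Types f g : T -> R.

Lemma L1_of_sqr f : measurable_fun [set: T] f -> L1 P (fun w => f w ^+ 2) -> L1 P f.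
Proof.
move=> mf f2; apply: (L1_le mf) (L1D f2 (L1_cst P 1)) => w.
rewrite -(real_normK (num_real (f w))); have := sqr_ge0 (`|f w| - 1).
have := normr_ge0 (f w); nra.
Qed.

Lemma L1M_of_sqr f g : measurable_fun [set: T] f -> measurable_fun [set: T] g ->
  L1 P (fun w => f w ^+ 2) -> L1 P (fun w => g w ^+ 2) ->
  L1 P (fun w => f w * g w).
Proof.
move=> mf mg f2 g2; apply: (L1_le (measurable_funM mf mg)) (L1D f2 g2) => w.
rewrite normrM -(real_normK (num_real (f w))) -(real_normK (num_real (g w))).
have := sqr_ge0 (`|f w| - `|g w|).
have := normr_ge0 (f w); have := normr_ge0 (g w); nra.
Qed.

Lemma L1_sqrD f g : measurable_fun [set: T] f -> measurable_fun [set: T] g ->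
  L1 P (fun w => f w ^+ 2) -> L1 P (fun w => g w ^+ 2) ->
  L1 P (fun w => (f w + g w) ^+ 2).
Proof.
move=> mf mg f2 g2; have fg := L1M_of_sqr mf mg f2 g2.
under eq_fun do rewrite sqrrD -mulr_natl.
by apply: L1D => //; apply: L1D => //; exact: L1Z.
Qed.

Lemma L1_sqr_sum I (s : seq I) (F : I -> T -> R) :
  (forall i, measurable_fun [set: T] (F i)) ->
  (forall i, L1 P (fun w => F i w ^+ 2)) ->
  L1 P (fun w => (\sum_(i <- s) F i w) ^+ 2).
Proof.
move=> mF F2; elim: s => [|i s IH].
  by under eq_fun do rewrite big_nil expr0n; exact: L1_cst.
under eq_fun do rewrite big_cons; apply: L1_sqrD => //.
exact: measurable_sum.
Qed.

Lemma chebyshev_sqr f (K : R) : 0 < K -> measurable_fun [set: T] f ->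
  L1 P (fun w => f w ^+ 2) ->
  measurable [set w | K < `|f w|] /\
  (P [set w | (K < `|f w|)%R] <= ((\int[P]_w (f w ^+ 2)) / K ^+ 2)%:E)%E.
Proof.
move=> K0 mf f2; set A := [set w | _].
have mA : measurable A.
  have -> : A = [set: T] `&` (fun w => `|f w|) @^-1` `]K, +oo[%classic.
    by apply/seteqP; split => w /=; rewrite in_itv /= andbT => // -[].
  apply: (measurableT_comp (@normr_measurable R setT) mf) => //.
split => //.
have PA : P A = (\int[P]_w \1_A w)%:E.
  have := @Rint_indic _ _ _ P _ T id A (@measurable_id _ _ setT) mA.
  by rewrite preimage_id => ->; rewrite fineK// fin_num_measure.
have i1 : L1 P (\1_A : T -> R).
  exact: (bmeas_L1 P (bmeas_indic (@measurable_id _ _ setT) mA)).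
rewrite PA lee_fin ler_pdivlMr ?exprn_gt0// mulrC -RintZ//.
apply: Rint_le => //; first exact: L1Z.
move=> w; rewrite indicE; have [|_] := boolP (w \in A); last by rewrite mulr0 sqr_ge0.
rewrite inE /A /= mulr1 => Kf.
by rewrite -(real_normK (num_real (f w))) lerXn2r ?nnegrE// ltW.
Qed.

End second_moments.

(** * Second moments of sums of independent variables *)

Section sums_of_independent_variables.
Context {d d'} {T : measurableType d} {T' : measurableType d'} {R : realType}.
Variables (P : probability T R) (I : choiceType) (X : I -> {RV P >-> T'}).
Hypothesis Xind : mutually_independent X.

Let mX i : measurable_fun [set: T] (X i).
Proof. exact: measurable_funPT. Qed.

Lemma Rint_pair_bounded i j (f g : T' -> R) : i != j -> bmeas f -> bmeas g ->
  \int[P]_w (f (X i w) * g (X j w)) =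
  (\int[P]_w f (X i w)) * \int[P]_w g (X j w).
Proof.
move=> ij bf bg; pose h k := if k == i then f else g.
have bh k : bmeas (h k) by rewrite /h; case: ifP.
have us : uniq [:: i; j] by rewrite /= inE ij.
have := Rint_prod_indep Xind us bh.
have ji : (j == i) = false by rewrite eq_sym (negbTE ij).
rewrite big_cons big_seq1 /h eqxx ji => <-.
by apply: Rint_eq => w; rewrite big_cons big_seq1 eqxx ji.
Qed.

(** The product rule is available for bounded functions; [f] and [g] are truncated where they exceed
    [n], and dominated convergence passes to the limit. *)
Lemma Rint_pair i j (f g : T' -> R) : i != j ->
  measurable_fun [set: T'] f -> measurable_fun [set: T'] g ->
  L1 P (fun w => f (X i w) ^+ 2) -> L1 P (fun w => g (X j w) ^+ 2) ->
  \int[P]_w (f (X i w) * g (X j w)) =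
  (\int[P]_w f (X i w)) * \int[P]_w g (X j w).
Proof.
move=> ij mf mg f2 g2.
pose tr (h : T' -> R) (n : nat) y := h y * \1_[set y | `|h y| <= n%:R] y.
have mtr h n : measurable_fun [set: T'] h -> measurable_fun [set: T'] (tr h n).
  move=> mh; apply: measurable_funM => //; apply: measurable_indic.
  have -> : [set y | `|h y| <= n%:R] =
      [set: T'] `&` (fun y => `|h y|) @^-1` `]-oo, n%:R]%classic.
    by apply/seteqP; split => w /=; rewrite in_itv /= => // -[].
  exact: (measurableT_comp (@normr_measurable R setT) mh).
have btr h n : measurable_fun [set: T'] h -> bmeas (tr h n).
  move=> mh; split; first exact: mtr.
  exists n%:R => y; rewrite /tr indicE.
  by have [|_] := boolP (y \in _); rewrite ?inE/= ?mulr1 ?mulr0 ?normr0 ?ler0n.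
have trle (h : T' -> R) n y : `|tr h n y| <= `|h y|.
  rewrite /tr normrM indicE.
  by case: (y \in _); rewrite ?normr1 ?normr0 ?mulr1 ?mulr0.
have trcvg (h : T' -> R) y : tr h n y @[n --> \oo] --> h y.
  apply: cvg_near_cst; near=> n; rewrite /tr indicE mem_set ?mulr1//=.
  rewrite (le_trans (ltW (truncnS_gt `|h y|)))// ler_nat.
  by near: n; exact: nbhs_infty_ge.
have mfX : measurable_fun [set: T] (fun w => f (X i w)) by exact: measurableT_comp.
have mgX : measurable_fun [set: T] (fun w => g (X j w)) by exact: measurableT_comp.
have cvg1 k (h : T' -> R) : measurable_fun [set: T'] h -> L1 P (fun w => h (X k w) ^+ 2) ->
   \int[P]_w tr h n (X k w) @[n --> \oo] --> \int[P]_w h (X k w).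
  move=> mh h2; have mhX : measurable_fun [set: T] (fun w => h (X k w)) by exact: measurableT_comp.
  apply: (Rint_dominated (g := fun w => `|h (X k w)|) _ _ _ _).2 => //.
  - by move=> n; apply: measurableT_comp => //; exact: mtr.
  - exact/L1_norm/L1_of_sqr.
have cvg2 : \int[P]_w (tr f n (X i w) * tr g n (X j w)) @[n --> \oo] -->
    \int[P]_w (f (X i w) * g (X j w)).
  apply: (Rint_dominated (g := fun w => `|f (X i w) * g (X j w)|) _ _ _ _).2.
  - by move=> n; apply: measurable_funM; apply: measurableT_comp => //; exact: mtr.
  - by move=> w; apply: cvgM; exact: trcvg.
  - exact/L1_norm/L1M_of_sqr.
  - by move=> n w; rewrite normrM [leRHS]normrM; apply: ler_pM => //; exact: trle.
have cvg3 : \int[P]_w (tr f n (X i w) * tr g n (X j w)) @[n --> \oo] -->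
    (\int[P]_w f (X i w)) * \int[P]_w g (X j w).
  under eq_cvg do rewrite (Rint_pair_bounded ij (btr _ _ mf) (btr _ _ mg)).
  by apply: cvgM; exact: cvg1.
by rewrite -(cvg_lim _ cvg2)//; exact: cvg_lim.
Unshelve. all: by end_near. Qed.

Lemma Rint_sqr_sum (s : seq I) (x : I -> T' -> R) : uniq s ->
  (forall i, measurable_fun [set: T'] (x i)) ->
  (forall i, L1 P (fun w => x i (X i w) ^+ 2)) ->
  (forall i, \int[P]_w x i (X i w) = 0) ->
  \int[P]_w ((\sum_(i <- s) x i (X i w)) ^+ 2) =
  \sum_(i <- s) \int[P]_w (x i (X i w) ^+ 2).
Proof.
move=> + mx x2 x0.
have mxX i : measurable_fun [set: T] (fun w => x i (X i w)) by exact: measurableT_comp.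
elim: s => [|i s IH] us.
  rewrite big_nil (Rint_eq _ (g := fun=> 0)) ?Rint_cst// => w.
  by rewrite big_nil expr0n.
move: us; rewrite cons_uniq => /andP[is_ us].
rewrite big_cons -IH//.
have xx j : L1 P (fun w => x i (X i w) * x j (X j w)) by exact: L1M_of_sqr.
have xS : \int[P]_w (\sum_(j <- s) x i (X i w) * x j (X j w)) = 0.
  rewrite Rint_sum// big_seq big1// => j js.
  rewrite (@Rint_pair i j (x i) (x j))// ?x0 ?mul0r//.
  by apply: contraNneq is_ => ->.
rewrite (Rint_eq _ (g := fun w => x i (X i w) ^+ 2 +
  (2 * \sum_(j <- s) x i (X i w) * x j (X j w) +
   (\sum_(j <- s) x j (X j w)) ^+ 2))); last first.
  by move=> w; rewrite big_cons sqrrD -mulr_sumr -mulr_natl; ring.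
have S2 : L1 P (fun w => (\sum_(j <- s) x j (X j w)) ^+ 2) by exact: L1_sqr_sum.
have xsL : L1 P (fun w => \sum_(j <- s) x i (X i w) * x j (X j w)) by exact: L1_sum.
rewrite RintD//; last by apply: L1D => //; exact: L1Z.
by rewrite RintD// ?RintZ// ?xS ?mulr0 ?add0r//; exact: L1Z.
Qed.

End sums_of_independent_variables.

(** * Second-order expansion of a characteristic function at the origin *)

Section characteristic_function_expansion.
Context {d} {T : measurableType d} {R : realType} (P : probability T R).
Variables (Y : T -> R) (t : nat -> R).
Hypotheses (mY : measurable_fun [set: T] Y) (Y2 : L1 P (fun w => Y w ^+ 2))
  (Y0 : \int[P]_w Y w = 0) (t0 : t n @[n --> \oo] --> 0).

Let s2 := \int[P]_w (Y w ^+ 2).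

(* The third-order bound gives pointwise convergence to [0] of the normalized
   remainder; the second-order bound dominates it by [Y ^+ 2]. *)
Let Rint_remainder (h : R -> R) : measurable_fun [set: R] h ->
  (forall y, `|h y| <= `|y| ^+ 3) -> (forall y, `|h y| <= y ^+ 2) ->
  \int[P]_w (h (t n * Y w)) / t n ^+ 2 @[n --> \oo] --> 0.
Proof.
move=> mh h3 h2.
have mhY n : measurable_fun [set: T] (fun w => h (t n * Y w)).
  by apply: measurableT_comp => //; exact: measurable_funM.
have bnd n w : `|h (t n * Y w)| <= t n ^+ 2 * Y w ^+ 2.
  by rewrite -exprMn; exact: h2.
have hL n : L1 P (fun w => h (t n * Y w)).
  by apply: (L1_le (mhY n) (bnd n)); exact: L1Z.
have E n : \int[P]_w (h (t n * Y w)) / t n ^+ 2 =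
    \int[P]_w ((t n ^+ 2)^-1 * h (t n * Y w)).
  by rewrite RintZ// mulrC.
have -> : (fun n => \int[P]_w (h (t n * Y w)) / t n ^+ 2) =
    (fun n => \int[P]_w ((t n ^+ 2)^-1 * h (t n * Y w))) by exact/funext.
rewrite -[X in _ --> X](Rint_cst P 0).
apply: (@Rint_dominated _ _ _ P (fun n w => (t n ^+ 2)^-1 * h (t n * Y w))
  (fun=> 0) (fun w => Y w ^+ 2) _ _ _ _).2 => //.
- by move=> n; exact: measurable_funM.
- move=> w; apply/norm_cvg0P.
  apply: (@squeeze_cvgr _ _ _ _ (cst 0) (fun n => `|t n| * `|Y w| ^+ 3)).
  + apply: nearW => n; rewrite normr_ge0 /= normrM normfV normrX.
    have [->|tn] := eqVneq (t n) 0; first by rewrite normr0 expr0n /= invr0 !mul0r.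
    rewrite mulrC ler_pdivrMr ?exprn_gt0 ?normr_gt0//.
    by apply: le_trans (h3 _) _; rewrite normrM exprMn exprS; lra.
  + exact: cvg_cst.
  + rewrite -(mul0r (`|Y w| ^+ 3)); apply: cvgMl.
    by rewrite -[X in _ --> X](@normr0 R R); exact: cvg_norm.
- move=> n w; have [->|tn] := eqVneq (t n) 0.
    by rewrite expr0n /= invr0 mul0r normr0 sqr_ge0.
  rewrite normrM ger0_norm ?invr_ge0 ?sqr_ge0// ler_pdivrMl ?exprn_even_gt0//.
Qed.

Let t2 : t n ^+ 2 @[n --> \oo] --> 0.
Proof.
rewrite -[X in _ --> X](mul0r (0 : R)); under eq_cvg do rewrite expr2.
exact: cvgM.
Qed.

(** Both terms equal [1 - t^2 s2 / 2] up to [o(t^2)]. Where [t n = 0] the quotient is 0, by the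
    convention [0^-1 = 0]. *)
Lemma Rint_cos_expansion :
  (\int[P]_w cos (t n * Y w) - expR (- (t n ^+ 2 * s2 / 2))) / t n ^+ 2
    @[n --> \oo] --> 0.
Proof.
have s20 : 0 <= s2 by apply: Rintegral_ge0 => w _; exact: sqr_ge0.
pose h (y : R) := cos y - 1 + y ^+ 2 / 2.
have mh : measurable_fun [set: R] h.
  apply: measurable_funD.
    by apply: measurable_funB => //; apply: continuous_measurable_fun; exact: continuous_cos.
  by apply: measurable_funM => //; exact: exprn_measurable.
have c1 := Rint_remainder mh (fun y => (cos_sub_bound y).1) (fun y => (cos_sub_bound y).2).
have mc n : bmeas (fun w => cos (t n * Y w)) by apply: bmeas_cos; exact: measurable_funM.
have E n : \int[P]_w (h (t n * Y w)) = \int[P]_w cos (t n * Y w) - (1 - t n ^+ 2 * s2 / 2).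
  rewrite (Rint_eq _ (g := fun w => cos (t n * Y w) +
    (- 1 + t n ^+ 2 / 2 * Y w ^+ 2))); last first.
    by move=> w; rewrite /h exprMn; lra.
  rewrite RintD; [|exact: bmeas_L1|by apply: L1D; [exact: L1_cst|exact: L1Z]].
  rewrite RintD; [|exact: L1_cst|exact: L1Z].
  by rewrite Rint_cst RintZ// /s2; lra.
have c2 : (expR (- (t n ^+ 2 * s2 / 2)) - (1 - t n ^+ 2 * s2 / 2)) / t n ^+ 2
    @[n --> \oo] --> 0.
  apply/norm_cvg0P.
  apply: (@squeeze_cvgr _ _ _ _ (cst 0) (fun n => t n ^+ 2 * (s2 / 2) ^+ 2)).
  - apply: nearW => n; rewrite normr_ge0 /= normrM normfV [X in _ / X]ger0_norm ?sqr_ge0//.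
    have [->|tn] := eqVneq (t n) 0; first by rewrite expr0n /= invr0 mulr0 mul0r.
    rewrite ler_pdivrMr ?exprn_even_gt0//.
    have x0 : 0 <= t n ^+ 2 * s2 / 2 by rewrite divr_ge0// mulr_ge0// sqr_ge0.
    by apply: le_trans (expRN_bound x0) _; rewrite -mulrA exprMn; lra.
  - exact: cvg_cst.
  - by rewrite -[X in _ --> X](mul0r ((s2 / 2) ^+ 2)); exact: cvgMl.
rewrite -[X in _ --> X](subr0 (0 : R)).
under eq_cvg => n.
  rewrite (_ : _ / _ = \int[P]_w (h (t n * Y w)) / t n ^+ 2 -
    (expR (- (t n ^+ 2 * s2 / 2)) - (1 - t n ^+ 2 * s2 / 2)) / t n ^+ 2); last first.
    by rewrite E -mulrBl; congr (_ / _); ring.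
  over.
exact: cvgB.
Qed.

Lemma Rint_sin_expansion :
  \int[P]_w sin (t n * Y w) / t n ^+ 2 @[n --> \oo] --> 0.
Proof.
pose h (y : R) := sin y - y.
have mh : measurable_fun [set: R] h.
  by apply: measurable_funB => //; apply: continuous_measurable_fun; exact: continuous_sin.
have c1 := Rint_remainder mh (fun y => (sin_sub_bound y).1) (fun y => (sin_sub_bound y).2).
have YL : L1 P Y by exact: L1_of_sqr.
have E n : \int[P]_w (h (t n * Y w)) = \int[P]_w sin (t n * Y w).
  rewrite RintB ?RintZ ?Y0 ?mulr0 ?subr0//; last exact: L1Z.
  by apply: bmeas_L1; apply: bmeas_sin; exact: measurable_funM.
by under eq_cvg do rewrite -E.
Qed.

End characteristic_function_expansion.

(** * Stochastic orders *)

Section stochastic_orders.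
Context {d} {T : measurableType d} {R : realType} (P : probability T R).
Implicit Types (X Y : nat -> T -> R) (E : set T).

(* The exceptional event is only required to contain the complement of [E], so
   that no measurability of [E] is needed. *)
Definition likely (del : R) E :=
  exists A, [/\ measurable A, (P A <= del%:E)%E & ~` A `<=` E].

Definition oP X := forall e del : R, 0 < e -> 0 < del ->
  \forall n \near \oo, likely del [set w | `|X n w| <= e].

Definition OP X := forall del : R, 0 < del ->
  exists2 K : R, 0 < K & \forall n \near \oo, likely del [set w | `|X n w| <= K].

Lemma likelyS del E E' : E `<=` E' -> likely del E -> likely del E'.
Proof. by move=> EE' [A [mA PA AE]]; exists A; split => // w /AE/EE'. Qed.

Lemma likelyT del E : 0 <= del -> (forall w, E w) -> likely del E.
Proof.
by move=> d0 Ew; exists set0; split => //; rewrite measure0 lee_fin.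
Qed.

Lemma likelyI del1 del2 E1 E2 : likely del1 E1 -> likely del2 E2 ->
  likely (del1 + del2) (E1 `&` E2).
Proof.
move=> [A [mA PA AE]] [B [mB PB BE]]; exists (A `|` B); split.
- exact: measurableU.
- by rewrite EFinD; apply: le_trans (measureU2 _ mA mB) _; exact: leeD.
- by move=> w; rewrite setCU => -[/AE ? /BE].
Qed.

(** Union bound; the denominator [#|I|.+1] is nonzero even for an empty index type. *)
Lemma likely_forall (I : finType) del (E : I -> set T) : 0 < del ->
  (forall i, likely (del / #|I|.+1%:R) (E i)) -> likely del [set w | forall i, E i w].
Proof.
move=> d0 h.
suff s : forall s : seq I, likely ((size s)%:R * (del / #|I|.+1%:R))
    [set w | forall i, i \in s -> E i w].
  have [A [mA PA AE]] := s (enum I); exists A; split => //.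
    apply: le_trans PA _; rewrite lee_fin -cardE mulrCA; apply: ler_piMr; first exact: ltW.
    by rewrite ler_pdivrMr ?ltr0n// mul1r ler_nat.
  by move=> w /AE h' i; apply: h'; rewrite mem_enum.
elim=> [|i s IH]; first by rewrite mul0r; exact: likelyT.
rewrite /= -natr1 mulrDl mul1r addrC.
apply: likelyS (likelyI (h i) IH) => w [/= iE sE] j.
by rewrite inE => /predU1P[->//|]; exact: sE.
Qed.

Lemma likely_of_sqr (f : T -> R) (K del : R) : 0 < K ->
  measurable_fun [set: T] f -> L1 P (fun w => f w ^+ 2) ->
  \int[P]_w (f w ^+ 2) <= del * K ^+ 2 ->
  likely del [set w | `|f w| <= K].
Proof.
move=> K0 mf f2 fK; have [mA PA] := chebyshev_sqr K0 mf f2.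
exists [set w | K < `|f w|]; split => //.
  by apply: le_trans PA _; rewrite lee_fin ler_pdivrMr ?exprn_gt0.
by move=> w /= /negP; rewrite -leNgt.
Qed.

Lemma oP_near X Y : (\forall n \near \oo, X n =1 Y n) -> oP X -> oP Y.
Proof.
move=> XY oX e del e0 d0; near=> n.
have XYn : X n =1 Y n by near: n.
have : likely del [set w | `|X n w| <= e] by near: n; exact: oX.
by apply: likelyS => w /=; rewrite XYn.
Unshelve. all: by end_near. Qed.

Lemma eq_oP X Y : (forall n w, X n w = Y n w) -> oP X -> oP Y.
Proof. by move=> XY; apply: oP_near; apply: nearW => n w; exact: XY. Qed.

Lemma eq_OP X Y : (forall n w, X n w = Y n w) -> OP X -> OP Y.
Proof.
move=> XY oX del d0; have [K K0 XK] := oX _ d0; exists K => //.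
apply: filterS XK => n; apply: likelyS => w /=; by rewrite XY.
Qed.

Lemma oPD X Y : oP X -> oP Y -> oP (fun n w => X n w + Y n w).
Proof.
move=> oX oY e del e0 d0.
have e2 : 0 < e / 2 by rewrite divr_gt0.
have d2 : 0 < del / 2 by rewrite divr_gt0.
near=> n.
have hX : likely (del / 2) [set w | `|X n w| <= e / 2] by near: n; exact: oX.
have hY : likely (del / 2) [set w | `|Y n w| <= e / 2] by near: n; exact: oY.
rewrite (splitr del); apply: likelyS (likelyI hX hY) => w [/= Xe Ye].
by apply: le_trans (ler_normD _ _) _; rewrite (splitr e); exact: lerD.
Unshelve. all: by end_near. Qed.

Lemma OPD X Y : OP X -> OP Y -> OP (fun n w => X n w + Y n w).
Proof.
move=> oX oY del d0.
have d2 : 0 < del / 2 by rewrite divr_gt0.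
have [K K0 XK] := oX _ d2; have [L L0 YL] := oY _ d2.
exists (K + L); first by rewrite addr_gt0.
near=> n.
have hX : likely (del / 2) [set w | `|X n w| <= K] by near: n; exact: XK.
have hY : likely (del / 2) [set w | `|Y n w| <= L] by near: n; exact: YL.
rewrite (splitr del); apply: likelyS (likelyI hX hY) => w [/= Xe Ye].
by apply: le_trans (ler_normD _ _) _; exact: lerD.
Unshelve. all: by end_near. Qed.

Lemma OPM X Y : OP X -> OP Y -> OP (fun n w => X n w * Y n w).
Proof.
move=> oX oY del d0.
have d2 : 0 < del / 2 by rewrite divr_gt0.
have [K K0 XK] := oX _ d2; have [L L0 YL] := oY _ d2.
exists (K * L); first by rewrite mulr_gt0.
near=> n.
have hX : likely (del / 2) [set w | `|X n w| <= K] by near: n; exact: XK.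
have hY : likely (del / 2) [set w | `|Y n w| <= L] by near: n; exact: YL.
rewrite (splitr del); apply: likelyS (likelyI hX hY) => w [/= Xe Ye].
by rewrite normrM; exact: ler_pM.
Unshelve. all: by end_near. Qed.

Lemma oPM X Y : oP X -> OP Y -> oP (fun n w => X n w * Y n w).
Proof.
move=> oX oY e del e0 d0.
have d2 : 0 < del / 2 by rewrite divr_gt0.
have [L L0 YL] := oY _ d2.
have eL : 0 < e / L by rewrite divr_gt0.
near=> n.
have hX : likely (del / 2) [set w | `|X n w| <= e / L] by near: n; exact: oX.
have hY : likely (del / 2) [set w | `|Y n w| <= L] by near: n; exact: YL.
rewrite (splitr del); apply: likelyS (likelyI hX hY) => w [/= Xe Ye].
rewrite normrM -(divfK (lt0r_neq0 L0) e).
by apply: ler_pM.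
Unshelve. all: by end_near. Qed.

Lemma oP_OP X : oP X -> OP X.
Proof. by move=> oX del d0; exists 1 => //; exact: oX. Qed.

Lemma oP_cvg (u : nat -> R) : u n @[n --> \oo] --> 0 -> oP (fun n _ => u n).
Proof.
move=> u0 e del e0 d0; near=> n; apply: likelyT; first exact: ltW.
move=> w /=; rewrite -normrN -[- _]sub0r; apply: ltW.
by near: n; move/cvgrPdist_lt : u0; apply.
Unshelve. all: by end_near. Qed.

Lemma OP_cst (c : R) : OP (fun _ _ => c).
Proof.
move=> del d0; exists (`|c| + 1); first by rewrite ltr_wpDl.
by apply: nearW => n; apply: likelyT; [exact: ltW|move=> w /=; rewrite lerDl].
Qed.

Lemma OP_of_oPB X c : oP (fun n w => X n w - c) -> OP X.
Proof.
move=> oX; apply: eq_OP (OPD (oP_OP oX) (OP_cst c)) => n w.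
by rewrite subrK.
Qed.

Lemma oPZ c X : oP X -> oP (fun n w => c * X n w).
Proof.
by move=> oX; apply: eq_oP (oPM oX (OP_cst c)) => n w; rewrite mulrC.
Qed.

Lemma OPZ c X : OP X -> OP (fun n w => c * X n w).
Proof. exact: OPM (OP_cst c). Qed.

Lemma oPB X Y : oP X -> oP Y -> oP (fun n w => X n w - Y n w).
Proof.
move=> oX oY; apply: eq_oP (oPD oX (oPZ (-1) oY)) => n w; by rewrite mulN1r.
Qed.

Lemma oP_sum I (s : seq I) (F : I -> nat -> T -> R) : (forall i, oP (F i)) ->
  oP (fun n w => \sum_(i <- s) F i n w).
Proof.
move=> oF; elim: s => [|i s IH].
  apply: (@eq_oP (fun _ _ => 0)); first by move=> n w; rewrite big_nil.
  by apply: (@oP_cvg (fun=> 0)); exact: cvg_cst.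
by apply: eq_oP (oPD (oF i) IH) => n w; rewrite big_cons.
Qed.

Lemma OP_sum I (s : seq I) (F : I -> nat -> T -> R) : (forall i, OP (F i)) ->
  OP (fun n w => \sum_(i <- s) F i n w).
Proof.
move=> oF; elim: s => [|i s IH].
  by apply: (@eq_OP (fun _ _ => 0)); [move=> n w; rewrite big_nil|exact: OP_cst].
by apply: eq_OP (OPD (oF i) IH) => n w; rewrite big_cons.
Qed.

Lemma oP_continuous (g : R -> R) c X : {for c, continuous g} ->
  oP (fun n w => X n w - c) -> oP (fun n w => g (X n w) - g c).
Proof.
move=> /cvgrPdist_lt cg oX e del e0 d0.
have [r /= r0 rP] := cg _ e0.
have r2 : 0 < r / 2 by rewrite divr_gt0.
apply: filterS (oX _ _ r2 d0) => n; apply: likelyS => w /= Xr.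
rewrite distrC; apply/ltW/rP => /=; rewrite distrC; apply: le_lt_trans Xr _.
by rewrite ltr_pdivrMr// ltr_pMr// ltr1n.
Qed.

Lemma OP_of_sqr X C : (forall n, measurable_fun [set: T] (X n)) ->
  (forall n, L1 P (fun w => X n w ^+ 2)) ->
  (\forall n \near \oo, \int[P]_w (X n w ^+ 2) <= C) -> OP X.
Proof.
move=> mX X2 XC del d0; exists (Num.sqrt ((`|C| + 1) / del)).
  by rewrite sqrtr_gt0 divr_gt0// ltr_wpDl.
apply: filterS XC => n XC; apply: likely_of_sqr => //.
  by rewrite sqrtr_gt0 divr_gt0// ltr_wpDl.
rewrite sqr_sqrtr; last by rewrite divr_ge0 ?ltW// ltr_wpDl.
rewrite mulrCA divff ?gt_eqF// mulr1; apply: le_trans XC _.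
by apply: le_trans (ler_norm _) _; rewrite lerDl.
Qed.

Lemma oP_of_sqr X : (forall n, measurable_fun [set: T] (X n)) ->
  (forall n, L1 P (fun w => X n w ^+ 2)) ->
  \int[P]_w (X n w ^+ 2) @[n --> \oo] --> 0 -> oP X.
Proof.
move=> mX X2 /cvgrPdist_le XC e del e0 d0.
have de : 0 < del * e ^+ 2 by rewrite mulr_gt0// exprn_gt0.
apply: filterS (XC _ de) => n; rewrite sub0r normrN => XC'.
by apply: likely_of_sqr => //; apply: le_trans (ler_norm _) _.
Qed.

Lemma tight (f : T -> R) del : measurable_fun [set: T] f -> 0 < del ->
  exists2 K : R, 0 < K & likely del [set w | `|f w| <= K].
Proof.
move=> mf d0.
pose A n := [set w | n%:R < `|f w|].
have mA n : measurable (A n).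
  have -> : A n = [set: T] `&` (fun w => `|f w|) @^-1` `]n%:R, +oo[%classic.
    by apply/seteqP; split => w /=; rewrite in_itv /= andbT => // -[].
  by apply: (measurableT_comp (@normr_measurable R setT) mf) => //.
have mid : measurable_fun [set: T] (@id T) by exact: measurable_id.
have [||||_ cv] := @Rint_dominated _ _ _ P (fun n => \1_(A n)) (fun=> 0) (fun=> 1).
- by move=> n; exact: measurable_indic.
- move=> w; apply: cvg_near_cst; near=> n; rewrite indicE memNset//=.
  apply/negP; rewrite -leNgt (le_trans (ltW (truncnS_gt `|f w|)))// ler_nat.
  by near: n; exact: nbhs_infty_ge.
- exact: L1_cst.
- by move=> n w; rewrite indicE; case: (_ \in _); rewrite ?normr1 ?normr0.
rewrite Rint_cst in cv; move/cvgrPdist_le : cv => /(_ _ d0) cv.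
near \oo => n.
exists n.+1%:R; first by rewrite ltr0n.
have h : `|0 - \int[P]_x \1_(A n) x| <= del by near: n; exact: cv.
exists (A n); split => //.
  have := @Rint_indic _ _ _ P _ T id (A n) mid (mA n).
  rewrite preimage_id => E; rewrite -(fineK (fin_num_measure P _ (mA n))) -E lee_fin.
  by move: h; rewrite sub0r normrN; apply: le_trans (ler_norm _).
move=> w /= /negP; rewrite -leNgt => /le_trans; apply; by rewrite ler_nat.
Unshelve. all: by end_near. Qed.

Lemma Rint_likely (f g : T -> R) (e del M : R) : bmeas f -> bmeas g ->
  0 <= e -> 0 <= M -> (forall w, `|f w - g w| <= M) ->
  likely del [set w | `|f w - g w| <= e] ->
  `|\int[P]_w f w - \int[P]_w g w| <= e + M * del.
Proof.
move=> bf bg e0 M0 fgM [A [mA PA AE]].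
have mid : measurable_fun [set: T] (@id T) by exact: measurable_id.
have bA : bmeas (\1_A : T -> R) by exact: (bmeas_indic mid mA).
rewrite -RintB; [|exact: bmeas_L1..].
apply: (@le_trans _ _ (\int[P]_w (e + M * \1_A w))).
  apply: Rint_norm_le.
  - by apply: measurable_funB; [exact: bf.1|exact: bg.1].
  - by apply: L1D; [exact: L1_cst|apply: L1Z; exact: bmeas_L1].
  - move=> w; rewrite indicE; have [wA|wA] := boolP (w \in A).
      by rewrite mulr1; apply: le_trans (fgM w) _; rewrite lerDr.
    by rewrite mulr0 addr0; apply: AE => /= Aw; rewrite mem_set in wA.
rewrite RintD; [|exact: L1_cst|by apply: L1Z; exact: bmeas_L1].
rewrite Rint_cst RintZ; last exact: bmeas_L1.
rewrite lerD2l ler_wpM2l//.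
have := @Rint_indic _ _ _ P _ T id A mid mA; rewrite preimage_id => ->.
by rewrite -lee_fin fineK// fin_num_measure.
Qed.

End stochastic_orders.

(** * Convergence of weighted sums of squares *)

Section weighted_squares.
Variables (R : realType) (D : nat) (lambda : 'I_D -> R).

(* A bounded substitute for [\sum_l lambda l * w l ^+ 2], to which it tends
   locally uniformly as [th] goes to 0. *)
Definition cos_form (th : R) (w : 'I_D -> R) : R :=
  \sum_l 2 * lambda l / th ^+ 2 * (1 - cos (th * w l)).

Lemma cos_form_bound th w : th != 0 ->
  `|cos_form th w| <= \sum_l 4 * `|lambda l| / th ^+ 2.
Proof.
move=> th0; apply: le_trans (ler_norm_sum _ _ _) _; apply: ler_sum => l _.
have t2 : 0 < th ^+ 2 by rewrite exprn_even_gt0.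
rewrite normrM -mulrA (normrM 2) (ger0_norm (_ : 0 <= 2))// normrM.
rewrite (ger0_norm (_ : 0 <= (th ^+ 2)^-1)) ?invr_ge0 ?sqr_ge0//.
have c2 : `|1 - cos (th * w l)| <= 2.
  have := cos_le1 (th * w l); have := cos_geN1 (th * w l).
  by move=> ? ?; rewrite ler_norml; apply/andP; split; lra.
have h0 : 0 <= 2 * (`|lambda l| / th ^+ 2).
  by rewrite mulr_ge0// divr_ge0// ltW.
by apply: le_trans (ler_wpM2l h0 c2) _; rewrite le_eqVlt; apply/orP; left; apply/eqP; ring.
Qed.

Lemma cos_form_approx th K w : 0 < th -> 0 <= K -> (forall l, `|w l| <= K) ->
  `|\sum_l lambda l * w l ^+ 2 - cos_form th w| <=
  th * (2 * K ^+ 3 * \sum_l `|lambda l|).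
Proof.
move=> th0 K0 wK; rewrite /cos_form -sumrB mulr_sumr mulr_sumr.
apply: le_trans (ler_norm_sum _ _ _) _; apply: ler_sum => l _.
have t2 : 0 < th ^+ 2 by rewrite exprn_gt0.
have -> : lambda l * w l ^+ 2 - 2 * lambda l / th ^+ 2 * (1 - cos (th * w l)) =
    2 * lambda l / th ^+ 2 * (cos (th * w l) - 1 + (th * w l) ^+ 2 / 2).
  by field; rewrite gt_eqF.
have [h _] := cos_sub_bound (th * w l).
rewrite normrM normrM (normrM 2) (ger0_norm (_ : 0 <= 2))//.
rewrite (ger0_norm (_ : 0 <= (th ^+ 2)^-1)) ?invr_ge0 ?sqr_ge0//.
have h0 : 0 <= 2 * `|lambda l| / th ^+ 2 by rewrite divr_ge0 ?mulr_ge0// ltW.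
apply: le_trans (ler_wpM2l h0 h) _; rewrite normrM (gtr0_norm th0) exprMn.
rewrite [leLHS](_ : _ = th * (2 * `|w l| ^+ 3 * `|lambda l|)); last first.
  by field; rewrite gt_eqF.
rewrite ler_pM2l// ler_wpM2r// ler_pM2l//.
by apply: lerXn2r => //; rewrite nnegrE.
Qed.

(** The order of the choices matters: [th] is made small for the box [|w l| <= K]; this fixes the
    range of [cos_form th] over all [w], and [p] then approximates [f] on that range. The three
    errors [e] compare [q] with the sum of squares, that sum with [cos_form], and [f] with [p]. *)
Lemma polynomial_approx (f : R -> R) (M K e : R) : continuous f ->
  (forall x, `|f x| <= M) -> 0 < K -> 0 < e ->
  exists th : R, exists p : {poly R}, exists eta : R,
  [/\ th != 0, 0 < eta, forall w, `|p.[cos_form th w]| <= M + e &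
      forall w q, (forall l, `|w l| <= K) ->
        `|q - \sum_l lambda l * w l ^+ 2| <= eta ->
        `|f q - p.[cos_form th w]| <= 3 * e].
Proof.
move=> cf fM K0 e0.
pose A := \sum_l `|lambda l|; have A0 : 0 <= A by apply: sumr_ge0.
have [d d0 dP] := heine_cantor (A * K ^+ 2) cf e0.
(* With this choice the error in [cos_form_approx] stays below the modulus [d]; the added 1 prevents
   a zero denominator when every [lambda l] is 0. *)
pose th := d / 2 / (2 * K ^+ 3 * A + 1).
have den0 : 0 < 2 * K ^+ 3 * A + 1.
  rewrite ltr_wpDl//; apply: mulr_ge0 => //; apply: mulr_ge0 => //.
  exact/exprn_ge0/ltW.
have th0 : 0 < th by rewrite !divr_gt0.
have thd : th * (2 * K ^+ 3 * A) < d.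
  apply: (@lt_le_trans _ _ (th * (2 * K ^+ 3 * A + 1))).
    by rewrite ltr_pM2l// ltrDl.
  by rewrite /th divfK ?gt_eqF//; lra.
pose T1 := \sum_l 4 * `|lambda l| / th ^+ 2.
have T10 : 0 <= T1.
  by apply: sumr_ge0 => l _; apply: divr_ge0; [exact: mulr_ge0|exact: sqr_ge0].
have [p pP] := weierstrass cf (ltr_wpDl T10 ltr01) e0.
have UT w : `|cos_form th w| <= T1 + 1.
  by apply: le_trans (cos_form_bound _ (lt0r_neq0 th0)) _; rewrite lerDl.
exists th, p, (d / 2); split; [exact: lt0r_neq0|by rewrite divr_gt0| |].
  move=> w; have := pP _ (UT w); have := fM (cos_form th w).
  set x := f _; set y := p.[_] => h1 h2.
  rewrite (_ : y = x - (x - y)); last by ring.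
  by apply: le_trans (ler_normB _ _) _; rewrite lerD// ltW.
move=> w q wK qw; set s := \sum_l _ in qw.
have sA : `|s| <= A * K ^+ 2.
  apply: le_trans (ler_norm_sum _ _ _) _; rewrite mulr_suml; apply: ler_sum => l _.
  rewrite normrM ler_wpM2l// normrX.
  by apply: lerXn2r => //; rewrite ?nnegrE// ltW.
have h1 : `|f s - f q| < e.
  apply: dP => //; rewrite distrC; apply: le_lt_trans qw _.
  by rewrite ltr_pdivrMr// ltr_pMr// ltr1n.
have h2 : `|f s - f (cos_form th w)| < e.
  apply: dP => //; apply: le_lt_trans thd.
  exact: (cos_form_approx th0 (ltW K0) wK).
have h3 := pP _ (UT w).
rewrite (_ : f q - _ = - (f s - f q) + (f s - f (cos_form th w)) +
  (f (cos_form th w) - p.[cos_form th w])); last by ring.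
apply: le_trans (ler_normD _ _) _.
have := ler_normD (- (f s - f q)) (f s - f (cos_form th w)); rewrite normrN.
lra.
Qed.

Definition shift (th : R) (l : 'I_D) (u : 'I_D -> R) (j : 'I_D) : R :=
  u j + th * (j == l)%:R.

(* The value, for independent standard normal [Z l], of
   E[cos (\sum_l u l * Z l) * cos_form th Z ^+ k]. *)
Fixpoint gauss_moment (th : R) k (u : 'I_D -> R) : R :=
  if k is k'.+1 then
    \sum_l 2 * lambda l / th ^+ 2 * (gauss_moment th k' u -
      2^-1 * (gauss_moment th k' (shift th l u) +
              gauss_moment th k' (shift (- th) l u)))
  else expR (- (\sum_l u l ^+ 2) / 2).

Lemma sum_shift th l u (w : 'I_D -> R) :
  \sum_j shift th l u j * w j = \sum_j u j * w j + th * w l.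
Proof.
rewrite /shift; under eq_bigr do rewrite mulrDl.
rewrite big_split /=; congr (_ + _); rewrite (bigD1 l)//= big1 => [|j /negbTE ->].
  by rewrite eqxx mulr1 addr0.
by rewrite mulr0 mul0r.
Qed.

Lemma measurable_cos_form d (T : measurableType d) th (w : 'I_D -> T -> R) :
  (forall l, measurable_fun [set: T] (w l)) ->
  bmeas (fun x => cos_form th (w ^~ x)).
Proof.
move=> mw; have [->|th0] := eqVneq th 0; last first.
  split; last by exists (\sum_l 4 * `|lambda l| / th ^+ 2) => x; exact: cos_form_bound.
  apply: measurable_sum => l; apply: measurable_funM => //.
  by apply: measurable_funB => //; apply: (bmeas_cos _).1; exact: measurable_funM.
split.
  apply: measurable_sum => l; apply: measurable_funM => //.
  by apply: measurable_funB => //; apply: (bmeas_cos _).1; exact: measurable_funM.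
exists 0 => x; rewrite /cos_form big1 ?normr0// => l _.
by rewrite expr0n /= invr0 mulr0 mul0r.
Qed.

Lemma bmeasX d (T : measurableType d) (f : T -> R) k :
  bmeas f -> bmeas (fun x => f x ^+ k).
Proof.
move=> [mf [M fM]]; split; first exact: measurable_funX.
exists (M ^+ k) => x; rewrite normrX; apply: lerXn2r => //; rewrite nnegrE//.
exact: le_trans (fM x).
Qed.

(** [cos a * (1 - cos b) = cos a - (cos (a + b) + cos (a - b)) / 2]: each factor [cos_form] is
    traded for shifts of [u] by [th] and [- th] in one coordinate, which is the recursion of
    [gauss_moment]. *)
Lemma cos_form_moment_cvg d (T : measurableType d) (P : probability T R) th
    (w : 'I_D -> nat -> T -> R) :
  (forall l n, measurable_fun [set: T] (w l n)) ->
  (forall u : 'I_D -> R, (forall l, lambda l = 0 -> u l = 0) ->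
    \int[P]_x cos (\sum_l u l * w l n x) @[n --> \oo] -->
      expR (- (\sum_l u l ^+ 2) / 2)) ->
  forall k (u : 'I_D -> R), (forall l, lambda l = 0 -> u l = 0) ->
  \int[P]_x (cos (\sum_l u l * w l n x) * cos_form th (fun l => w l n x) ^+ k)
    @[n --> \oo] --> gauss_moment th k u.
Proof.
move=> mw cw; elim=> [|k IH] u u0.
  rewrite /=.
  have -> : (fun n => \int[P]_x (cos (\sum_l u l * w l n x) *
      cos_form th (fun l => w l n x) ^+ 0)) =
    (fun n => \int[P]_x cos (\sum_l u l * w l n x)).
    by apply/funext => n; apply: Rint_eq => x; rewrite expr0 mulr1.
  exact: cw.
have bc n u' : bmeas (fun x => cos (\sum_l u' l * w l n x)).
  by apply: bmeas_cos; apply: measurable_sum => l; exact: measurable_funM.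
have bU n j : bmeas (fun x => cos_form th (fun l => w l n x) ^+ j).
  by apply: bmeasX; apply: (@measurable_cos_form _ _ th (fun l => w l n)).
pose J n u' := \int[P]_x (cos (\sum_l u' l * w l n x) *
  cos_form th (fun l => w l n x) ^+ k).
have JL n u' : L1 P (fun x => cos (\sum_l u' l * w l n x) *
  cos_form th (fun l => w l n x) ^+ k) by apply: bmeas_L1; exact: bmeasM.
have E n : \int[P]_x (cos (\sum_l u l * w l n x) *
      cos_form th (fun l => w l n x) ^+ k.+1) =
    \sum_l 2 * lambda l / th ^+ 2 * (J n u -
      2^-1 * (J n (shift th l u) + J n (shift (- th) l u))).
  rewrite /J; under [RHS]eq_bigr => l _.
    rewrite -RintD// -RintZ; last exact: L1D.
    rewrite -RintB//; last by apply: L1Z; exact: L1D.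
    rewrite -RintZ; last by apply: L1B => //; apply: L1Z; exact: L1D.
    over.
  rewrite -Rint_sum; last first.
    by move=> l; apply: L1Z; apply: L1B => //; apply: L1Z; exact: L1D.
  apply: Rint_eq => x; rewrite exprS mulrA {1}/cos_form mulr_sumr mulr_suml.
  apply: eq_bigr => l _; rewrite !sum_shift mulNr cosD cosB.
  set a := cos (\sum_(_ < _) _); set b := cos (_ * _); set s := sin _ * _.
  set g := _ ^+ k; set c := _ / _; by field.
have -> : (fun n => \int[P]_x (cos (\sum_l u l * w l n x) *
      cos_form th (fun l => w l n x) ^+ k.+1)) = (fun n =>
    \sum_l 2 * lambda l / th ^+ 2 * (J n u -
      2^-1 * (J n (shift th l u) + J n (shift (- th) l u)))) by apply/funext => n; exact: E.
apply: (@cvg_big _ _ +%R) => [|l _]; first exact: add_continuous.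
(* A shift in a direction with [lambda l = 0] would leave the admissible class of [u], but its
   coefficient is 0. *)
have [l0|l0] := eqVneq (lambda l) 0.
  by rewrite l0 mulr0 !mul0r; under eq_cvg do rewrite !mul0r; exact: cvg_cst.
have sh th' l' : (lambda l' = 0) -> shift th' l u l' = 0.
  move=> l'0; rewrite /shift u0// add0r; have [E'|_] := eqVneq l' l.
    by rewrite -E' l'0 eqxx in l0.
  by rewrite mulr0.
apply: cvgM; first exact: cvg_cst.
apply: cvgB; first exact: IH.
apply: cvgM; first exact: cvg_cst.
by apply: cvgD; apply: IH => l'; exact: sh.
Qed.

(** Counterpart for the limit, with a product of cosines in place of the cosine of a sum. This form
    suits [b l = sqrt (B l)], which has the law of [|Z l|]: the product is even in each variable.
    The product-to-sum formula acts on the [l]-th factor alone and yields the same recursion. *)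
Lemma cos_form_moment d (T : measurableType d) (P : probability T R) th
    (b : 'I_D -> T -> R) :
  (forall l, measurable_fun [set: T] (b l)) ->
  (forall u : 'I_D -> R, \int[P]_x (\prod_l cos (u l * b l x)) =
      expR (- (\sum_l u l ^+ 2) / 2)) ->
  forall k (u : 'I_D -> R),
  \int[P]_x ((\prod_l cos (u l * b l x)) * cos_form th (b ^~ x) ^+ k) =
  gauss_moment th k u.
Proof.
move=> mb cb; elim=> [|k IH] u.
  by rewrite /= -cb; apply: Rint_eq => x; rewrite expr0 mulr1.
have bc u' : bmeas (fun x => \prod_l cos (u' l * b l x)).
  by apply: bmeas_prod => l; apply: bmeas_cos; exact: measurable_funM.
have bU j : bmeas (fun x => cos_form th (b ^~ x) ^+ j).
  by apply: bmeasX; exact: measurable_cos_form.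
have JL u' : L1 P (fun x => (\prod_l cos (u' l * b l x)) * cos_form th (b ^~ x) ^+ k).
  by apply: bmeas_L1; exact: bmeasM.
rewrite /=; under [RHS]eq_bigr => l _.
  rewrite -!IH -RintD// -RintZ; last exact: L1D.
  rewrite -RintB//; last by apply: L1Z; exact: L1D.
  rewrite -RintZ; last by apply: L1B => //; apply: L1Z; exact: L1D.
  over.
rewrite -Rint_sum; last first.
  by move=> l; apply: L1Z; apply: L1B => //; apply: L1Z; exact: L1D.
apply: Rint_eq => x; rewrite exprS mulrA {1}/cos_form mulr_sumr mulr_suml.
apply: eq_bigr => l _.
have prodE v (th' : R) : \prod_j cos (shift th' l v j * b j x) =
    cos (v l * b l x + th' * b l x) * \prod_(j < D | j != l) cos (v j * b j x).
  rewrite (bigD1 l)//= /shift eqxx mulr1 mulrDl; congr (_ * _).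
  by apply: eq_bigr => j /negbTE ->; rewrite mulr0 addr0.
rewrite !prodE (bigD1 l)//= mulNr cosD cosB.
set a := cos (u l * _); set c := cos (th * _); set s := sin _ * _.
set g := _ ^+ k; set p := \prod_(_ < _ | _) _; set q := _ / _; by field.
Qed.

Lemma weighted_squares_cvg d d' (T : measurableType d) (T' : measurableType d')
    (P : probability T R) (P' : probability T' R) (Q : nat -> T -> R)
    (w : 'I_D -> nat -> T -> R) (b : 'I_D -> T' -> R) (f : R -> R) (M : R) :
  (forall n, measurable_fun [set: T] (Q n)) ->
  (forall l n, measurable_fun [set: T] (w l n)) ->
  (forall l, measurable_fun [set: T'] (b l)) ->
  oP P (fun n x => Q n x - \sum_l lambda l * w l n x ^+ 2) ->
  (forall l, OP P (w l)) ->
  (forall u : 'I_D -> R, (forall l, lambda l = 0 -> u l = 0) ->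
    \int[P]_x cos (\sum_l u l * w l n x) @[n --> \oo] -->
      expR (- (\sum_l u l ^+ 2) / 2)) ->
  (forall u : 'I_D -> R, \int[P']_x (\prod_l cos (u l * b l x)) =
      expR (- (\sum_l u l ^+ 2) / 2)) ->
  continuous f -> (forall x, `|f x| <= M) ->
  \int[P]_x f (Q n x) @[n --> \oo] -->
    \int[P']_x f (\sum_l lambda l * b l x ^+ 2).
Proof.
move=> mQ mw mb Qw Ow cw cb cf fM.
have M0 : 0 <= M by exact: le_trans (fM 0).
apply/cvgrPdist_le => e0 e0_gt0.
(* The final comparison costs [4 e + e + 4 e], which is below [e0 = 13 e]. *)
pose e := e0 / 13; have e_gt0 : 0 < e by rewrite divr_gt0.
(* On the exceptional event the two integrands differ by at most [2 M + e], so an event of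
   probability [del] costs at most [e]. *)
pose del := e / (2 * M + e); have den0 : 0 < 2 * M + e by rewrite ltr_wpDl// mulr_ge0.
have del0 : 0 < del by rewrite divr_gt0.
(* One half of [del] is shared among the coordinates by the union bound, the other half is for the
   error in [Q]. *)
pose delD := del / 2 / #|'I_D|.+1%:R.
have delD0 : 0 < delD by rewrite !divr_gt0.
have /choice[Kw KwP] : forall l, exists K : R, 0 < K /\ \forall n \near \oo,
    likely P delD [set x | `|w l n x| <= K].
  by move=> l; have [K K0 KP] := Ow l _ delD0; exists K.
have /choice[Kb KbP] : forall l, exists K : R, 0 < K /\
    likely P' delD [set x | `|b l x| <= K].
  by move=> l; have [K K0 KP] := tight P' (mb l) delD0; exists K.
pose K := 1 + \sum_l (Kw l + Kb l).
have KK0 l : 0 <= Kw l + Kb l by rewrite addr_ge0// ltW// ?(KwP l).1// (KbP l).1.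
have K0 : 0 < K by rewrite ltr_wpDr// sumr_ge0.
have KwK l : Kw l <= K.
  rewrite /K (bigD1 l)//= addrCA -addrA lerDl.
  by rewrite addr_ge0 ?(ltW (KbP l).1)// addr_ge0// sumr_ge0.
have KbK l : Kb l <= K.
  rewrite /K (bigD1 l)//= addrCA [Kw l + _]addrC -addrA lerDl.
  by rewrite addr_ge0 ?(ltW (KwP l).1)// addr_ge0// sumr_ge0.
have [th [p [eta [th0 eta0 pb pf]]]] := polynomial_approx cf fM K0 e_gt0.
have bp d1 (T1 : measurableType d1) (v : 'I_D -> T1 -> R) :
    (forall l, measurable_fun [set: T1] (v l)) ->
    bmeas (fun x => p.[cos_form th (v ^~ x)]).
  move=> mv; have [mU _] := measurable_cos_form th mv.
  split; last by exists (M + e) => x; exact: pb.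
  by apply: (measurableT_comp _ mU); apply: continuous_measurable_fun; exact: continuous_horner.
have bf d1 (T1 : measurableType d1) (v : T1 -> R) : measurable_fun [set: T1] v ->
    bmeas (fun x => f (v x)).
  move=> mv; split; last by exists M => x; exact: fM.
  by apply: (measurableT_comp _ mv); exact: continuous_measurable_fun.
have fp w' q : `|f q - p.[cos_form th w']| <= 2 * M + e.
  by apply: le_trans (ler_normB _ _) _; have := fM q; have := pb w'; lra.
have err : 3 * e + (2 * M + e) * del = 4 * e.
  have -> : (2 * M + e) * del = e by rewrite /del mulrCA divff ?mulr1// gt_eqF.
  by ring.
have ms : measurable_fun [set: T'] (fun x => \sum_l lambda l * b l x ^+ 2).
  by apply: measurable_sum => l; apply: measurable_funM => //; exact: measurable_funX.
have limit : `|\int[P']_x f (\sum_l lambda l * b l x ^+ 2) -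
     \int[P']_x p.[cos_form th (b ^~ x)]| <= 4 * e.
  rewrite -err; apply: Rint_likely; [exact: bf|exact: bp|lra|exact: ltW|by move=> x; exact: fp|].
  have h : likely P' (del / 2) [set x | forall l, `|b l x| <= Kb l].
    by apply: likely_forall => [|l]; [rewrite divr_gt0|exact: (KbP l).2].
  rewrite (splitr del); apply: likelyS (likelyI h h) => x [/= bK _].
  by apply: pf => [l|]; [exact: le_trans (bK l) (KbK l)|rewrite subrr normr0 ltW].
have seq_ : \forall n \near \oo, `|\int[P]_x f (Q n x) -
     \int[P]_x p.[cos_form th (fun l => w l n x)]| <= 4 * e.
  have d2 : 0 < del / 2 by rewrite divr_gt0.
  have wl : \forall n \near \oo, forall l, likely P delD [set x | `|w l n x| <= Kw l].
    by apply: filter_forall => l; exact: (KwP l).2.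
  near=> n; rewrite -err.
  apply: Rint_likely; [exact: bf|exact: (bp _ _ (fun l => w l n))|lra|exact: ltW| |].
    by move=> x; exact: fp.
  have h : likely P (del / 2) [set x | forall l, `|w l n x| <= Kw l].
    by apply: likely_forall; [rewrite divr_gt0|near: n; exact: wl].
  have h' : likely P (del / 2) [set x | `|Q n x - \sum_l lambda l * w l n x ^+ 2| <= eta].
    by near: n; exact: Qw.
  rewrite (splitr del); apply: likelyS (likelyI h h') => x [/= wK Qx].
  by apply: pf => // l; exact: le_trans (wK l) (KwK l).
(* The moments of [cos_form] alone are the case [u = 0]. *)
have u00 : forall l, lambda l = 0 -> (fun=> 0 : R) l = 0 by [].
have pcvg : \int[P]_x p.[cos_form th (fun l => w l n x)] @[n --> \oo] -->
    \int[P']_x p.[cos_form th (b ^~ x)].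
  have bU n k : L1 P (fun x => p`_k * cos_form th (fun l => w l n x) ^+ k).
    apply: L1Z; apply: bmeas_L1; apply: bmeasX.
    by apply: (@measurable_cos_form _ _ th (fun l => w l n)).
  have bU' k : L1 P' (fun x => p`_k * cos_form th (b ^~ x) ^+ k).
    by apply: L1Z; apply: bmeas_L1; apply: bmeasX; exact: measurable_cos_form.
  have bU1 n k : L1 P (fun x => cos_form th (fun l => w l n x) ^+ k).
    apply: bmeas_L1; apply: bmeasX.
    by apply: (@measurable_cos_form _ _ th (fun l => w l n)).
  have bU1' k : L1 P' (fun x => cos_form th (b ^~ x) ^+ k).
    by apply: bmeas_L1; apply: bmeasX; exact: measurable_cos_form.
  have -> : (fun n => \int[P]_x p.[cos_form th (fun l => w l n x)]) =
     (fun n => \sum_(k < size p) p`_k * \int[P]_x (cos_form th (fun l => w l n x) ^+ k)).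
    apply/funext => n; under [RHS]eq_bigr do rewrite -RintZ//.
    by rewrite -Rint_sum//; apply: Rint_eq => x; rewrite horner_coef.
  have -> : \int[P']_x p.[cos_form th (b ^~ x)] =
      \sum_(k < size p) p`_k * \int[P']_x (cos_form th (b ^~ x) ^+ k).
    under [RHS]eq_bigr do rewrite -RintZ//.
    by rewrite -Rint_sum//; apply: Rint_eq => x; rewrite horner_coef.
  apply: (@cvg_big _ _ +%R) => [|k _]; first exact: add_continuous.
  apply: cvgM; first exact: cvg_cst.
  have -> : \int[P']_x (cos_form th (b ^~ x) ^+ k) = gauss_moment th k (fun=> 0).
    rewrite -(cos_form_moment th mb cb); apply: Rint_eq => x.
    by rewrite big1 ?mul1r// => l _; rewrite mul0r cos0.
  have -> : (fun n => \int[P]_x (cos_form th (fun l => w l n x) ^+ k)) =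
     (fun n => \int[P]_x (cos (\sum_l (fun=> 0) l * w l n x) *
       cos_form th (fun l => w l n x) ^+ k)).
    apply/funext => n; apply: Rint_eq => x.
    by rewrite big1 ?cos0 ?mul1r// => l _; rewrite mul0r.
  exact: cos_form_moment_cvg.
move/cvgrPdist_le : pcvg => /(_ _ e_gt0) pcvg.
near=> n.
have h1 : `|\int[P]_x f (Q n x) -
     \int[P]_x p.[cos_form th (fun l => w l n x)]| <= 4 * e by near: n; exact: seq_.
have h2 : `|\int[P']_x p.[cos_form th (b ^~ x)] -
   \int[P]_x p.[cos_form th (fun l => w l n x)]| <= e by near: n; exact: pcvg.
move: limit h1 h2; set a := \int[P']_x f _; set c := \int[P']_x _.
set g := \int[P]_x f _; set h := \int[P]_x _ => n1 n2 n3.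
rewrite (_ : a - g = (a - c) + (c - h) - (g - h)); last by ring.
apply: le_trans (ler_normB _ _) _.
have := ler_normD (a - c) (c - h).
have : e * 13 = e0 by rewrite /e divfK.
lra.
Unshelve. all: by end_near. Qed.

End weighted_squares.

(** * Central limit theorem for grouped sums *)

Section identically_distributed_variables.
Context {d d'} {T : measurableType d} {T' : measurableType d'} {R : realType}.
Variables (P : probability T R) (X Y : {RV P >-> T'}).
Hypothesis XY : identically_distributed X Y.

Let integral_ident (f : T' -> \bar R) :
  (\int[distribution P X]_y f y = \int[distribution P Y]_y f y)%E.
Proof. by apply: eq_measure_integral => A mA _; exact: XY. Qed.

Lemma L1_ident (g : T' -> R) : measurable_fun [set: T'] g ->
  L1 P (fun w => g (X w)) -> L1 P (fun w => g (Y w)).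
Proof.
move=> mg /integrableP[_ gX]; apply/integrableP; split.
  by apply/measurable_EFinP; apply: measurableT_comp => //; exact: measurable_funPT.
apply: le_lt_trans gX; rewrite le_eqVlt; apply/orP; left; apply/eqP.
have mg' : measurable_fun [set: T'] (fun y => `|(g y)%:E|%E).
  by apply: measurableT_comp => //; exact/measurable_EFinP.
have h := @ge0_integral_distribution _ _ _ _ _ P _ (fun y => `|(g y)%:E|%E) mg'
  (fun y => abse_ge0 _).
transitivity (\int[distribution P Y]_y `|(g y)%:E|)%E; first by rewrite h.
by rewrite -integral_ident h.
Qed.

Lemma Rint_ident (g : T' -> R) : measurable_fun [set: T'] g ->
  L1 P (fun w => g (X w)) -> \int[P]_w g (X w) = \int[P]_w g (Y w).
Proof.
move=> mg gX; have gY := L1_ident mg gX.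
have mg' : measurable_fun [set: T'] (EFin \o g) by exact/measurable_EFinP.
rewrite /Rintegral; congr fine.
transitivity (\int[distribution P X]_y (g y)%:E)%E.
  by rewrite (integral_distribution mg').
by rewrite integral_ident (integral_distribution mg').
Qed.

End identically_distributed_variables.

Lemma cvg_prod_seq (R : realType) I (s : seq I) (F : nat -> I -> R) (l : I -> R) :
  (forall i, F n i @[n --> \oo] --> l i) ->
  \prod_(i <- s) F n i @[n --> \oo] --> \prod_(i <- s) l i.
Proof.
move=> Fl; elim: s => [|i s IH].
  by under eq_cvg do rewrite big_nil; rewrite big_nil; exact: cvg_cst.
by under eq_cvg do rewrite big_cons; rewrite big_cons; exact: cvgM.
Qed.

Section grouped_sums.
Context {d d'} {T : measurableType d} {T' : measurableType d'} {R : realType}.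
Variables (P : probability T R) (a : nat) (X : 'I_a -> nat -> {RV P >-> T'}).
Hypothesis Xind : mutually_independent (fun ik : 'I_a * nat => X ik.1 ik.2).
Hypothesis Xid : forall i k, identically_distributed (X i k) (X i 0%N).
Variable F : 'I_a -> T' -> R.
Hypothesis mF : forall i, measurable_fun [set: T'] (F i).
Hypothesis F2 : forall i, L1 P (fun w => F i (X i 0%N w) ^+ 2).
Hypothesis F0 : forall i, \int[P]_w F i (X i 0%N w) = 0.

Definition grouped_sum (N : 'I_a -> nat) (t : 'I_a -> R) (w : T) : R :=
  \sum_(i < a) t i * \sum_(k < N i) F i (X i k w).

Let s2 i := \int[P]_w (F i (X i 0%N w) ^+ 2).

(** Flattens the double sum to a duplicate-free list of pairs, the form in which the results on
    independent families apply. *)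
Let idx (N : 'I_a -> nat) : seq ('I_a * nat) :=
  [seq (i, k) | i <- enum 'I_a, k <- iota 0 (N i)].

Let idx_uniq N : uniq (idx N).
Proof.
apply: allpairs_uniq_dep; first exact: enum_uniq.
  by move=> i _; exact: iota_uniq.
by move=> [i k] [i' k'] _ _ /= [-> ->].
Qed.

Let big_idx (U : Type) (x0 : U) (op : Monoid.com_law x0) N (h : 'I_a -> nat -> U) :
  \big[op/x0]_(ik <- idx N) h ik.1 ik.2 =
  \big[op/x0]_(i < a) \big[op/x0]_(k < N i) h i k.
Proof.
rewrite /idx big_allpairs_dep /= big_enum; apply: eq_bigr => i _.
by rewrite (_ : iota 0 _ = index_iota 0 (N i)) ?big_mkord// /index_iota subn0.
Qed.

Let grouped_sumE N t w : grouped_sum N t w =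
  \sum_(ik <- idx N) t ik.1 * F ik.1 (X ik.1 ik.2 w).
Proof.
rewrite (@big_idx _ _ +%R N (fun i k => t i * F i (X i k w))).
by apply: eq_bigr => i _; rewrite mulr_sumr.
Qed.

Let F2k i k : L1 P (fun w => F i (X i k w) ^+ 2).
Proof.
have sym : identically_distributed (X i 0%N) (X i k) by move=> B /(Xid i k).
apply: (L1_ident sym (g := fun y => F i y ^+ 2)) (F2 i).
exact: measurable_funX.
Qed.

Let s2k i k : \int[P]_w (F i (X i k w) ^+ 2) = s2 i.
Proof.
apply: (Rint_ident (g := fun y => F i y ^+ 2) (@Xid i k)) => //.
exact: measurable_funX.
Qed.

Let mFX i k : measurable_fun [set: T] (fun w => F i (X i k w)).
Proof. by apply: measurableT_comp => //; exact: measurable_funPT. Qed.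

Let F0k i k : \int[P]_w F i (X i k w) = 0.
Proof.
rewrite -(F0 i); apply: (Rint_ident (@Xid i k)) => //.
exact: L1_of_sqr.
Qed.

Lemma measurable_grouped_sum N t : measurable_fun [set: T] (grouped_sum N t).
Proof.
by apply: measurable_sum => i; apply: measurable_funM => //; exact: measurable_sum.
Qed.

Lemma L1_grouped_sum_sqr N t : L1 P (fun w => grouped_sum N t w ^+ 2).
Proof.
under eq_fun do rewrite grouped_sumE.
apply: L1_sqr_sum => ik; first exact: measurable_funM.
by under eq_fun do rewrite exprMn; exact: L1Z.
Qed.

Lemma Rint_grouped_sum_sqr N t : \int[P]_w (grouped_sum N t w ^+ 2) =
  \sum_(i < a) (N i)%:R * t i ^+ 2 * s2 i.
Proof.
pose x (ik : 'I_a * nat) y := t ik.1 * F ik.1 y.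
transitivity (\sum_(ik <- idx N) \int[P]_w (x ik (X ik.1 ik.2 w) ^+ 2)).
  rewrite -(Rint_sqr_sum Xind)//.
  - by apply: Rint_eq => w; rewrite grouped_sumE.
  - by move=> ik; exact: measurable_funM.
  - by move=> ik; rewrite /x; under eq_fun do rewrite exprMn; exact: L1Z.
  - by move=> ik; rewrite RintZ ?F0k ?mulr0//; exact: L1_of_sqr.
transitivity (\sum_(ik <- idx N) (fun i (k : nat) => t i ^+ 2 * s2 i) ik.1 ik.2).
  apply: eq_bigr => ik _; rewrite /x; under eq_Rintegral do rewrite exprMn.
  by rewrite RintZ// s2k.
rewrite (@big_idx _ _ +%R N (fun i _ => t i ^+ 2 * s2 i)); apply: eq_bigr => i _.
by rewrite sumr_const card_ord -[LHS]mulr_natl mulrA.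
Qed.

Variables (n : nat -> 'I_a -> nat) (t : nat -> 'I_a -> R) (q : 'I_a -> R).
Hypothesis t0 : forall i, t nu i @[nu --> \oo] --> 0.
Hypothesis nt : forall i, (n nu i)%:R * t nu i ^+ 2 @[nu --> \oo] --> q i.

Lemma Rint_grouped_sum_sqr_cvg :
  \int[P]_w (grouped_sum (n nu) (t nu) w ^+ 2) @[nu --> \oo] -->
    \sum_(i < a) q i * s2 i.
Proof.
under eq_cvg do rewrite Rint_grouped_sum_sqr.
apply: (@cvg_big _ _ +%R) => [|i _]; first exact: add_continuous.
by apply: cvgM => //; exact: cvg_cst.
Qed.

(** The per-variable error in [cos_sum_approx] is [o(t^2)] by the expansions at the origin, and
    [n t^2] converges, so the total error vanishes. The product of the Gaussian factors [rho] is
    [expR (- n t^2 s2 / 2)] over the groups. *)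
Lemma grouped_clt :
  \int[P]_w cos (grouped_sum (n nu) (t nu) w) @[nu --> \oo] -->
    expR (- (\sum_(i < a) q i * s2 i) / 2).
Proof.
pose rho nu i := expR (- (t nu i ^+ 2 * s2 i / 2)).
have s20 i : 0 <= s2 i by apply: Rintegral_ge0 => w _; exact: sqr_ge0.
have rho01 nu i : 0 <= rho nu i <= 1.
  rewrite expR_ge0 /= -[leRHS]expR0 ler_expR oppr_le0.
  by rewrite divr_ge0// mulr_ge0// sqr_ge0.
pose err nu i := `|\int[P]_w cos (t nu i * F i (X i 0%N w)) - rho nu i| +
                 `|\int[P]_w sin (t nu i * F i (X i 0%N w))|.
have bnd nu : `|\int[P]_w cos (grouped_sum (n nu) (t nu) w) -
    \prod_(i < a) rho nu i ^+ n nu i| <= \sum_(i < a) (n nu i)%:R * err nu i.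
  pose x (ik : 'I_a * nat) y := t nu ik.1 * F ik.1 y.
  have mx ik : measurable_fun [set: T'] (x ik) by exact: measurable_funM.
  have := cos_sum_approx Xind mx 0 (idx_uniq (n nu)) (fun ik => rho01 nu ik.1).
  rewrite cos0 mulr1 (@big_idx _ _ *%R (n nu) (fun i k => rho nu i)).
  under [X in `|_ - X|]eq_bigr do rewrite prodr_const card_ord.
  rewrite (Rint_eq _ (g := fun w => cos (grouped_sum (n nu) (t nu) w))); last first.
    by move=> w; rewrite addr0 grouped_sumE.
  move=> h; apply: le_trans h _; rewrite le_eqVlt; apply/orP; left; apply/eqP.
  transitivity (\sum_(ik <- idx (n nu)) (fun i (k : nat) => err nu i) ik.1 ik.2).
    apply: eq_bigr => -[i k] _ /=; rewrite /err /x /=.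
    have bc := bmeas_cos (mx (i, k)); have bs := bmeas_sin (mx (i, k)).
    have bX (g : T' -> R) : bmeas g -> bmeas (fun w => g (X i k w)).
      move=> [mg [M gM]]; split; last by exists M => w.
      by apply: measurableT_comp => //; exact: measurable_funPT.
    rewrite (Rint_ident (@Xid i k) (g := fun y => cos (t nu i * F i y)) bc.1);
      last exact: (bmeas_L1 P (bX _ bc)).
    by rewrite (Rint_ident (@Xid i k) (g := fun y => sin (t nu i * F i y)) bs.1) //;
      exact: (bmeas_L1 P (bX _ bs)).
  rewrite (@big_idx _ _ +%R (n nu) (fun i _ => err nu i)); apply: eq_bigr => i _.
  by rewrite sumr_const card_ord mulr_natl.
have err0 i : (n nu i)%:R * err nu i @[nu --> \oo] --> 0.
  have h1 := Rint_cos_expansion (mFX i 0%N) (F2 i) (t0 i).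
  have h2 := Rint_sin_expansion (mFX i 0%N) (F2 i) (F0 i) (t0 i).
  (* Dividing and multiplying by [t^2] is harmless at [t = 0], because [err] is 0 there. *)
  have -> : (fun nu => (n nu i)%:R * err nu i) = (fun nu =>
     ((n nu i)%:R * t nu i ^+ 2) *
     (`|(\int[P]_w cos (t nu i * F i (X i 0%N w)) - rho nu i) / t nu i ^+ 2| +
      `|\int[P]_w sin (t nu i * F i (X i 0%N w)) / t nu i ^+ 2|)).
    apply/funext => nu; rewrite -mulrA; congr (_ * _).
    have [tz|tz] := eqVneq (t nu i) 0.
      rewrite /err /rho tz expr0n /= !mul0r oppr0 expR0.
      rewrite (Rint_eq _ (g := fun=> 1)); last by move=> w; rewrite mul0r cos0.
      rewrite [X in _ + `|X|](Rint_eq _ (g := fun=> 0)); last by move=> w; rewrite mul0r sin0.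
      by rewrite !Rint_cst subrr normr0 addr0.
    have t2 : 0 < t nu i ^+ 2 by rewrite exprn_even_gt0.
    rewrite /err mulrDr !normrM !normfV (gtr0_norm t2).
    by congr (_ + _); rewrite mulrCA divff ?mulr1// gt_eqF.
  rewrite -(mulr0 (q i)) -[X in q i * X](addr0 (0 : R)) -{1 2}(@normr0 R R).
  by apply: cvgM; [exact: nt|apply: cvgD; exact: cvg_norm].
have errS : \sum_(i < a) (n nu i)%:R * err nu i @[nu --> \oo] --> 0.
  suff : \sum_(i < a) (n nu i)%:R * err nu i @[nu --> \oo] --> \sum_(i < a) (0 : R).
    by rewrite big1.
  by apply: (@cvg_big _ _ +%R) => [|i _]; [exact: add_continuous|exact: err0].
have rhoS : \prod_(i < a) rho nu i ^+ n nu i @[nu --> \oo] -->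
    expR (- (\sum_(i < a) q i * s2 i) / 2).
  have -> : - (\sum_(i < a) q i * s2 i) / 2 = \sum_(i < a) - (q i * s2 i) / 2.
    by rewrite -sumrN mulr_suml.
  rewrite expR_sum.
  apply: cvg_prod_seq => i.
  have -> : (fun nu => rho nu i ^+ n nu i) =
      (fun nu => expR (- ((n nu i)%:R * t nu i ^+ 2 * s2 i) / 2)).
    apply/funext => nu; rewrite /rho -expRM_natl; congr expR.
    by rewrite -mulr_natl; ring.
  apply: continuous_cvg; first exact: continuous_expR.
  apply: cvgMl; apply: cvgN; apply: cvgMl; exact: nt.
rewrite -[X in _ --> X](add0r (expR _)).
have -> : (fun nu => \int[P]_w cos (grouped_sum (n nu) (t nu) w)) = (fun nu =>
  (\int[P]_w cos (grouped_sum (n nu) (t nu) w) - \prod_(i < a) rho nu i ^+ n nu i) +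
  \prod_(i < a) rho nu i ^+ n nu i) by apply/funext => nu; rewrite subrK.
apply: cvgD => //; apply/norm_cvg0P.
apply: (@squeeze_cvgr _ _ _ _ (cst 0) _ _ _ _ _ errS) => //.
- by apply: nearW => nu; rewrite normr_ge0 bnd.
- exact: cvg_cst.
Qed.

End grouped_sums.

(** * Linearization of the empirical correlations *)

Section borel_matrices.
Variable R : realType.

Lemma measurable_coord m n i j :
  measurable_fun [set: 'M[R]_(m, n)] (fun A : 'M[R]_(m, n) => A i j).
Proof.
apply: (measurability _ (RGenOpens.measurableE R)) => _ [_ [x [y ->] <-]].
rewrite setTI; apply: sub_sigma_algebra.
apply: open_comp; first by move=> A _; exact: coord_continuous.
exact: interval_open.
Qed.

End borel_matrices.

Section linearization.
Context {d} {T : measurableType d} {R : realType} (P : probability T R).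
Variable s : nat -> R.
Hypothesis s0 : (s n)^-1 @[n --> \oo] --> 0.
Hypothesis s_neq0 : \forall n \near \oo, s n != 0.

(** Reads [x = x0 + X / s + o_P(1 / s)] with [X] bounded in probability. Closure under products and
    smooth maps turns the delta method into a calculus on scalar entries. *)
Definition linearized (x : nat -> T -> R) (x0 : R) (X : nat -> T -> R) :=
  oP P (fun n w => s n * (x n w - x0) - X n w) /\ OP P X.

Lemma linearized_oP x x0 X : linearized x x0 X -> oP P (fun n w => x n w - x0).
Proof.
move=> [xX OX].
have h : oP P (fun n w => (s n)^-1 * ((s n * (x n w - x0) - X n w) + X n w)).
  apply: oPM; first exact: oP_cvg.
  by apply: OPD => //; exact: oP_OP.
apply: oP_near h; apply: filterS s_neq0 => n sn w.
by rewrite subrK mulKf.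
Qed.

Lemma linearizedM x x0 X y y0 Y : linearized x x0 X -> linearized y y0 Y ->
  linearized (fun n w => x n w * y n w) (x0 * y0)
    (fun n w => X n w * y0 + x0 * Y n w).
Proof.
move=> lx ly; have oy := linearized_oP ly; have Oy := OP_of_oPB oy.
have [xX OX] := lx; have [yY OY] := ly; split; last first.
  by apply: OPD; [apply: OPM => //; exact: OP_cst|exact: OPZ].
have h := oPD (oPD (oPM xX Oy) (oPM oy OX)) (oPZ x0 yY).
by apply: eq_oP h => n w; ring.
Qed.

(** Differentiability in the form of Caratheodory: the slope [g] is continuous at [x0] and [g x0] is
    the derivative. As the factorization holds at every [z], it can be applied pointwise to the
    random argument. *)
Lemma linearized_map (h g : R -> R) x x0 X : {for x0, continuous g} ->
  (forall z, h z = h x0 + g z * (z - x0)) -> linearized x x0 X ->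
  linearized (fun n w => h (x n w)) (h x0) (fun n w => g x0 * X n w).
Proof.
move=> cg hg lx; have ox := linearized_oP lx; have [xX OX] := lx.
split; last exact: OPZ.
have og := oP_continuous cg ox; have Og := OP_of_oPB og.
apply: eq_oP (oPD (oPM xX Og) (oPM og OX)) => n w.
by rewrite [h (x n w)]hg; ring.
Qed.

Lemma eq_linearized x y x0 y0 X Y : (forall n w, x n w = y n w) -> x0 = y0 ->
  (forall n w, X n w = Y n w) -> linearized x x0 X -> linearized y y0 Y.
Proof.
move=> xy <- XY [xX OX]; split; last exact: eq_OP OX.
by apply: eq_oP xX => n w; rewrite xy XY.
Qed.

End linearization.

Lemma corr_mxE (R : realType) d (V : 'M[R]_d) j k :
  corr_mx V j k = (Num.sqrt (V j j))^-1 * V j k * (Num.sqrt (V k k))^-1.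
Proof. by rewrite /corr_mx /diag_isqrt mul_mx_diag mul_diag_mx !mxE. Qed.

(** For [x > 0] the slope is the explicit conjugate expression [psi], visibly continuous at [v]. For
    [x <= 0], where the inverse root is 0 by convention, the plain difference quotient keeps the
    identity true; that branch is away from [v]. *)
Lemma isqrt_expansion (R : realType) (v : R) : 0 < v -> exists g : R -> R,
  [/\ {for v, continuous g}, g v = - (2 * v * Num.sqrt v)^-1 &
      forall x, (Num.sqrt x)^-1 = (Num.sqrt v)^-1 + g x * (x - v)].
Proof.
move=> v0; have sv0 : 0 < Num.sqrt v by rewrite sqrtr_gt0.
pose psi x := - (Num.sqrt x * Num.sqrt v * (Num.sqrt x + Num.sqrt v))^-1.
pose g x := if 0 < x then psi x else ((Num.sqrt x)^-1 - (Num.sqrt v)^-1) / (x - v).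
have gv : g v = psi v by rewrite /g v0.
exists g; split.
- have cpsi : psi x @[x --> v] --> psi v.
    apply: cvgN; apply: cvgV.
      by rewrite mulf_neq0 ?mulf_neq0 ?gt_eqF ?addr_gt0.
    apply: cvgM; first by apply: cvgMl; exact: sqrt_continuous.
    by apply: cvgD; [exact: sqrt_continuous|exact: cvg_cst].
  rewrite /prop_for /continuous_at gv; apply: cvg_trans cpsi; apply: near_eq_cvg.
  near=> x; rewrite /g ifT//.
  by near: x; exact: lt_nbhsr.
- rewrite gv /psi; congr (- _^-1); rewrite -expr2 sqr_sqrtr ?ltW//; ring.
- move=> x; rewrite /g; case: ifPn => [x0|].
    have sx0 : 0 < Num.sqrt x by rewrite sqrtr_gt0.
    have alg (p q : R) : p != 0 -> q != 0 -> p + q != 0 ->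
        p^-1 = q^-1 + - (p * q * (p + q))^-1 * (p ^+ 2 - q ^+ 2).
      by move=> p0 q0 pq; field; rewrite p0 q0 pq.
    have := alg _ _ (lt0r_neq0 sx0) (lt0r_neq0 sv0) (lt0r_neq0 (addr_gt0 sx0 sv0)).
    by rewrite (sqr_sqrtr (ltW x0)) (sqr_sqrtr (ltW v0)).
  rewrite -leNgt => x0; rewrite divfK; first by rewrite addrC subrK.
  by rewrite subr_eq0 lt_eqF// (le_lt_trans x0).
Unshelve. all: by end_near. Qed.

(** * Empirical covariance and correlation in one group *)

Section sample_covariance.
Context {disp} {Omega : measurableType disp} {R : realType}.
Variables (P : probability Omega R) (d : nat).
Variable e : nat -> Omega -> 'cV[R]_d.
Variables (V : 'M[R]_d) (mu : 'cV[R]_d) (n : nat -> nat) (s : nat -> R).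
Hypothesis s0 : (s nu)^-1 @[nu --> \oo] --> 0.
Hypothesis s_neq0 : \forall nu \near \oo, s nu != 0.
Hypothesis n_oo : n nu @[nu --> \oo] --> \oo.
Hypothesis sn0 : s nu / (n nu)%:R @[nu --> \oo] --> 0.

(** The scaled error of the second-moment matrix of the residuals about their true mean 0: a sum of
    independent terms, unlike the empirical covariance. *)
Definition Zmx (nu : nat) (w : Omega) : 'M[R]_d := \matrix_(j, k)
  (s nu / (n nu)%:R * \sum_(l < n nu) (e l w j 0 * e l w k 0 - V j k)).

Hypothesis OZ : forall j k, OP P (fun nu w => Zmx nu w j k).
Hypothesis Oe : forall j, OP P (fun nu w => s nu / (n nu)%:R * \sum_(l < n nu) e l w j 0).

Let Vh nu w : 'M[R]_d := sample_cov (n nu) (fun k => mu + e k w).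
Let eb nu w j := (n nu)%:R^-1 * \sum_(l < n nu) e l w j 0.
Let A nu w j k := (n nu)%:R^-1 * \sum_(l < n nu) e l w j 0 * e l w k 0.

Let n_ge2 : \forall nu \near \oo, (2 <= n nu)%N.
Proof. exact: (n_oo (nbhs_infty_ge 2)). Qed.

Let sum_cst (c : R) k : \sum_(l < k) c = k%:R * c.
Proof. by rewrite sumr_const card_ord mulr_natl. Qed.

Let VhE nu w j k : (2 <= n nu)%N ->
  ((n nu)%:R - 1) * Vh nu w j k = (n nu)%:R * (A nu w j k - eb nu w j * eb nu w k).
Proof.
move=> n2; have n1 : ((n nu)%:R - 1 : R) != 0.
  by rewrite subr_eq0 -[1]/(1%:R) eqr_nat; move: n2; case: (n nu) => [|[|]].
have n0 : (n nu)%:R != 0 :> R by rewrite pnatr_eq0; move: n2; case: (n nu).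
have dev l i : (mu + e l w - sample_mean (n nu) (fun k => mu + e k w)) i 0 =
    e l w i 0 - eb nu w i.
  rewrite /sample_mean big_split /= sumr_const card_ord !mxE summxE mulrDr.
  by rewrite -/(eb nu w i) mulmxnE -[mu i 0 *+ _]mulr_natl mulKf//; ring.
rewrite /Vh /sample_cov mxE summxE mulrA divff// mul1r.
under eq_bigr => l _.
  rewrite mxE big_ord_recl big_ord0 addr0 [_^T _ _]mxE !dev.
  rewrite (_ : _ * _ = e l w j 0 * e l w k 0 - eb nu w k * e l w j 0 -
     eb nu w j * e l w k 0 + eb nu w j * eb nu w k); last by ring.
  over.
rewrite !big_split /= !sumrN sum_cst -!mulr_sumr.
have sE i : \sum_(l < n nu) e l w i 0 = (n nu)%:R * eb nu w i by rewrite /eb mulVKf.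
have AE : \sum_(l < n nu) e l w j 0 * e l w k 0 = (n nu)%:R * A nu w j k.
  by rewrite /A mulVKf.
by rewrite (sE j) (sE k) AE; ring.
Qed.

(** With [A] the second moment and [eb] the mean of the residuals, the difference is [s / (n - 1) *
    (A - eb_j eb_k) - eb_k * (s * eb_j)]. The first term is small because [s / n] is, the second
    because [s * eb_j] is bounded in probability. *)
Lemma linearized_sample_cov j k :
  linearized P s (fun nu w => Vh nu w j k) (V j k) (fun nu w => Zmx nu w j k).
Proof.
split => //.
have se i : OP P (fun nu w => s nu * eb nu w i).
  by apply: eq_OP (Oe i) => nu w; rewrite /eb; ring.
have oe i : oP P (fun nu w => eb nu w i).
  apply: oP_near (oPM (oP_cvg P s0) (se i)).
  by apply: filterS s_neq0 => nu sn w; rewrite mulKf.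
have OA : OP P (fun nu w => A nu w j k).
  apply: (@OP_of_oPB _ _ _ _ _ (V j k)).
  apply: oP_near (oPM (oP_cvg P s0) (OZ j k)).
  near=> nu => w.
  have sn : s nu != 0 by near: nu.
  have n2 : (2 <= n nu)%N by near: nu; exact: n_ge2.
  have n0 : (n nu)%:R != 0 :> R by rewrite pnatr_eq0; move: n2; case: (n nu).
  rewrite mxE big_split /= sum_cst mulrA mulKf//.
  by rewrite /A; field.
have sn1 : s nu / ((n nu)%:R - 1) @[nu --> \oo] --> 0.
  apply/norm_cvg0P.
  apply: (@squeeze_cvgr _ _ _ _ (cst 0) (fun nu => 2 * `|s nu / (n nu)%:R|)).
  - near=> nu.
    have n2 : (2 <= n nu)%N by near: nu; exact: n_ge2.
    have n2R : 2 <= (n nu)%:R :> R by rewrite ler_nat.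
    rewrite normr_ge0 /= !normrM !normfV mulrCA ler_wpM2l//.
    rewrite (ger0_norm (_ : 0 <= (n nu)%:R))// ger0_norm; last by lra.
    rewrite ler_pdivlMr ?(lt_le_trans _ n2R)// mulrC ler_pdivrMr; lra.
  - exact: cvg_cst.
  - rewrite -(mulr0 2) -[X in 2 * X](@normr0 R R).
    by apply: cvgM; [exact: cvg_cst|exact: cvg_norm].
have h1 := oPM (oP_cvg P sn1) (OPD OA (OPZ (-1) (OPM (oP_OP (oe j)) (oP_OP (oe k))))).
have h2 := oPM (oe k) (se j).
apply: oP_near (oPB h1 h2); near=> nu => w.
have n2 : (2 <= n nu)%N by near: nu; exact: n_ge2.
have n0 : (n nu)%:R != 0 :> R by rewrite pnatr_eq0; move: n2; case: (n nu).
have n1 : ((n nu)%:R - 1 : R) != 0.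
  by rewrite subr_eq0 -[1]/(1%:R) eqr_nat; move: n2; case: (n nu) => [|[|]].
have ZE : Zmx nu w j k = s nu * (A nu w j k - V j k).
  rewrite mxE big_split /= sum_cst /A.
  by field.
have -> : Vh nu w j k = (n nu)%:R * (A nu w j k - eb nu w j * eb nu w k) /
    ((n nu)%:R - 1) by rewrite -VhE// mulrC mulKf.
by rewrite ZE; field.
Unshelve. all: by end_near. Qed.

Hypothesis V_gt0 : forall j, 0 < V j j.

(** A correlation is a product of two inverse roots of variances and a covariance. The rules for
    products and maps yield its linear part, which [M_mx_vech] identifies with [M]. *)
Lemma linearized_corr (l : 'I_(dim_vechm d)) :
  linearized P s (fun nu w => vechm (corr_mx (Vh nu w)) l 0)
    (vechm (corr_mx V) l 0)
    (fun nu w => (M_mx V (vechm (corr_mx V)) *m vech (Zmx nu w)) l 0).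
Proof.
have [q [_ ql]] := vechm_strict_upper l.
have [g1 [cg1 g1v g1E]] := isqrt_expansion (V_gt0 q.1).
have [g2 [cg2 g2v g2E]] := isqrt_expansion (V_gt0 q.2).
have l1 := linearized_map s0 s_neq0 cg1 g1E (linearized_sample_cov q.1 q.1).
have l2 := linearized_map s0 s_neq0 cg2 g2E (linearized_sample_cov q.2 q.2).
have := linearizedM s0 s_neq0 (linearizedM s0 s_neq0 l1 (linearized_sample_cov q.1 q.2)) l2.
apply: eq_linearized => [nu w||nu w].
- by rewrite (vechm_nth _ q) ql corr_mxE.
- by rewrite (vechm_nth _ q) ql corr_mxE.
rewrite (M_mx_vech _ _ _ ql) (vechm_nth _ q) ql corr_mxE g1v g2v.
rewrite !sqrtrM ?(ltW (V_gt0 _))//.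
set Z1 := Zmx nu w q.1 q.1; set Z2 := Zmx nu w q.2 q.2; set Z3 := Zmx nu w _ _.
set V3 := V q.1 q.2.
(* With [p] and [r] the standard deviations: the product rule on the left, the entry of [M] on the
   right. *)
have alg (p r z1 z2 z3 v : R) : p != 0 -> r != 0 ->
  (- (2 * p ^+ 2 * p)^-1 * z1 * v + p^-1 * z3) * r^-1 +
    p^-1 * v * (- (2 * r ^+ 2 * r)^-1 * z2) =
  (p * r)^-1 * z3 - 2^-1 * (p^-1 * v * r^-1) * ((p * p)^-1 * z1 + (r * r)^-1 * z2).
  by move=> p0 r0; field; rewrite p0 r0.
have := alg (Num.sqrt (V q.1 q.1)) (Num.sqrt (V q.2 q.2)) Z1 Z2 Z3 V3.
rewrite !(gt_eqF (_ : 0 < Num.sqrt _)) ?sqrtr_gt0 ?V_gt0//.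
by rewrite !sqr_sqrtr ?(ltW (V_gt0 _))// => ->.
Qed.

End sample_covariance.

Lemma vech_entry d (l : 'I_(dim_vech d)) : exists q : 'I_d * 'I_d,
  forall (K : nmodType) (A : 'M[K]_d), vech A l 0 = A q.1 q.2.
Proof.
have ls : (l < size (upper_pairs d))%N by rewrite size_upper_pairs.
case E : (upper_pairs d) => [|q0 s]; first by rewrite E in ls.
by exists (nth q0 (upper_pairs d) l) => K A; rewrite (vech_nth _ q0).
Qed.

Lemma norm_le_enorm (R : realType) d (x : 'cV[R]_d) j : `|x j 0| <= enorm x.
Proof.
rewrite -sqrtr_sqr ler_sqrt ?sumr_ge0// => [|k _]; last exact: sqr_ge0.
by rewrite (bigD1 j)//= lerDl sumr_ge0// => k _; exact: sqr_ge0.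
Qed.

Lemma fine_expectation d (T : measurableType d) (R : realType)
  (P : probability T R) (f : T -> R) : fine 'E_P[f]%E = \int[P]_w f w.
Proof. by rewrite unlock. Qed.

(** * Moments of the residuals and of their outer products *)

Section model_moments.
Context {disp} {Omega : measurableType disp} {R : realType}.
Variables (P : probability Omega R) (d a : nat).
Variable eps : 'I_a -> nat -> {RV P >-> 'cV[R]_d}.
Hypothesis eps_mean : forall i, mean P (eps i 0%N) = 0.
Hypothesis eps_moment4 :
  forall i, ('E_P[fun w => (enorm (eps i 0%N w) ^+ 4)%R] < +oo)%E.

Let me_ i k j : measurable_fun [set: Omega] (fun w => (eps i k w : 'cV[R]_d) j 0).
Proof.
exact: (measurableT_comp (measurable_coord j 0) (measurable_funPT (eps i k))).
Qed.

Let enorm4_L1 i : L1 P (fun w => enorm (eps i 0%N w) ^+ 4).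
Proof.
have mf : measurable_fun [set: Omega] (fun w => enorm (eps i 0%N w) ^+ 4).
  apply: measurable_funX; rewrite /enorm.
  apply: (measurableT_comp (f := @Num.sqrt R)).
    by apply: continuous_measurable_fun; exact: sqrt_continuous.
  by apply: measurable_sum => j; exact: measurable_funX.
apply/integrableP; split; first exact/measurable_EFinP.
have := eps_moment4 i; rewrite unlock; apply: le_lt_trans.
rewrite le_eqVlt; apply/orP; left; apply/eqP; apply: eq_integral => w _.
by rewrite /= ger0_norm// exprn_ge0// sqrtr_ge0.
Qed.

(** The fourth moment enters here, through [|x_j x_k| <= |x|^2]. *)
Lemma eps_prod_sqr_L1 i j k :
  L1 P (fun w => ((eps i 0%N w : 'cV[R]_d) j 0 * (eps i 0%N w : 'cV[R]_d) k 0) ^+ 2).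
Proof.
apply: (L1_le _ _ (enorm4_L1 i)) => [|w].
  by apply: measurable_funX; exact: measurable_funM.
rewrite normrX -[4%N]/((2 * 2)%N) exprM; apply: lerXn2r; rewrite ?nnegrE ?sqr_ge0//.
by rewrite normrM expr2; apply: ler_pM => //; exact: norm_le_enorm.
Qed.

Lemma eps_prod_L1 i j k :
  L1 P (fun w => (eps i 0%N w : 'cV[R]_d) j 0 * (eps i 0%N w : 'cV[R]_d) k 0).
Proof.
by apply: L1_of_sqr (eps_prod_sqr_L1 i j k); exact: measurable_funM.
Qed.

Lemma eps_sqr_L1 i j : L1 P (fun w => (eps i 0%N w : 'cV[R]_d) j 0 ^+ 2).
Proof. by under eq_fun do rewrite expr2; exact: eps_prod_L1. Qed.

Lemma Rint_eps i j : \int[P]_w (eps i 0%N w : 'cV[R]_d) j 0 = 0.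
Proof.
have /matrixP /(_ j 0) := eps_mean i.
by rewrite !mxE fine_expectation.
Qed.

Lemma V_Rint i j k : V_ eps i j k =
  \int[P]_w ((eps i 0%N w : 'cV[R]_d) j 0 * (eps i 0%N w : 'cV[R]_d) k 0).
Proof.
rewrite /V_ /cov_mx mxE covariance.unlock !fine_expectation !Rint_eps.
by apply: Rint_eq => w; rewrite !fctE /= !subr0.
Qed.

(** The summand of a linear functional of the linearized statistic; at a residual it has mean 0 and
    variance [c Sigma c^T]. *)
Definition score i (c : 'rV[R]_(dim_vech d)) (y : 'cV[R]_d) : R :=
  (c *m (vech (y *m y^T) - vech (V_ eps i))) 0 0.

Let outerE (y : 'cV[R]_d) j k : (y *m y^T) j k = y j 0 * y k 0.
Proof. by rewrite mxE big_ord_recl big_ord0 addr0 !mxE. Qed.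

Let scoreE i c y : score i c y =
  \sum_l c 0 l * (vech (y *m y^T) l 0 - vech (V_ eps i) l 0).
Proof. by rewrite /score mxE; apply: eq_bigr => l _; rewrite !mxE. Qed.

Lemma measurable_vech_outer l :
  measurable_fun [set: 'cV[R]_d] (fun y : 'cV[R]_d => vech (y *m y^T) l 0).
Proof.
have [q qE] := vech_entry l; under eq_fun do rewrite qE outerE.
by apply: measurable_funM; exact: measurable_coord.
Qed.

Lemma measurable_score i c : measurable_fun [set: 'cV[R]_d] (score i c).
Proof.
rewrite (funext (scoreE i c)); apply: measurable_sum => l.
apply: measurable_funM => //; apply: measurable_funB => //.
exact: measurable_vech_outer.
Qed.

Let Dl i l w := vech ((eps i 0%N w : 'cV[R]_d) *m (eps i 0%N w)^T) l 0 - vech (V_ eps i) l 0.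

Let mDl i l : measurable_fun [set: Omega] (Dl i l).
Proof.
apply: measurable_funB => //.
exact: (measurableT_comp (measurable_vech_outer l) (measurable_funPT (eps i 0%N))).
Qed.

Let Dl2_L1 i l : L1 P (fun w => Dl i l w ^+ 2).
Proof.
have [q qE] := vech_entry l; rewrite /Dl; under eq_fun do rewrite !qE outerE.
apply: L1_sqrD => //; first exact: measurable_funM.
  exact: eps_prod_sqr_L1.
exact: L1_cst.
Qed.

Let Dl_L1 i l : L1 P (Dl i l).
Proof. exact: L1_of_sqr. Qed.

Let Rint_vech i l :
  \int[P]_w vech ((eps i 0%N w : 'cV[R]_d) *m (eps i 0%N w)^T) l 0 = vech (V_ eps i) l 0.
Proof.
have [q qE] := vech_entry l; rewrite qE V_Rint; apply: Rint_eq => w.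
by rewrite qE outerE.
Qed.

Let Dl0 i l : \int[P]_w Dl i l w = 0.
Proof.
rewrite /Dl RintB; [|idtac|exact: L1_cst].
  by rewrite Rint_cst Rint_vech subrr.
have [q qE] := vech_entry l; under eq_fun do rewrite qE outerE.
exact: eps_prod_L1.
Qed.

Lemma Rint_score i c : \int[P]_w score i c (eps i 0%N w) = 0.
Proof.
under eq_Rintegral do rewrite scoreE.
rewrite (@Rint_sum _ _ _ P _ _ (fun l w => c 0 l * Dl i l w)); last by move=> l; exact: L1Z.
by rewrite big1// => l _; rewrite RintZ// Dl0 mulr0.
Qed.

Lemma score_sqr_L1 i c : L1 P (fun w => score i c (eps i 0%N w) ^+ 2).
Proof.
under eq_fun do rewrite scoreE.
apply: (@L1_sqr_sum _ _ _ P _ _ (fun l w => c 0 l * Dl i l w)) => l; first exact: measurable_funM.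
by under eq_fun do rewrite exprMn; exact: L1Z.
Qed.

Lemma Sigma_Rint i l k : Sigma_ eps i l k = \int[P]_w (Dl i l w * Dl i k w).
Proof.
rewrite /Sigma_ /cov_mx mxE covariance.unlock !fine_expectation !Rint_vech.
by apply: Rint_eq => w.
Qed.

Lemma Rint_score_sqr i (c : 'rV[R]_(dim_vech d)) :
  \int[P]_w (score i c (eps i 0%N w) ^+ 2) = (c *m Sigma_ eps i *m c^T) 0 0.
Proof.
have DD l k : L1 P (fun w => Dl i l w * Dl i k w) by exact: L1M_of_sqr.
rewrite (Rint_eq _ (g := fun w => \sum_l \sum_k (c 0 k * c 0 l) * (Dl i k w * Dl i l w))).
  rewrite Rint_sum; last by move=> l; apply: L1_sum => k; exact: L1Z.
  rewrite mulmx_tr_sum; apply: eq_bigr => l _.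
  rewrite Rint_sum; last by move=> k; exact: L1Z.
  rewrite mxE mulr_suml; apply: eq_bigr => k _.
  by rewrite RintZ// Sigma_Rint; ring.
move=> w; rewrite scoreE expr2 mulr_sumr; apply: eq_bigr => l _.
by rewrite mulr_suml; apply: eq_bigr => k _; rewrite /Dl; ring.
Qed.

Lemma Sigma_sym i : (Sigma_ eps i)^T = Sigma_ eps i.
Proof.
apply/matrixP => l k; rewrite mxE !Sigma_Rint; apply: Rint_eq => w.
by rewrite mulrC.
Qed.

End model_moments.

Lemma measurable_isqrt (R : realType) :
  measurable_fun [set: R] (fun x : R => (Num.sqrt x)^-1).
Proof.
have -> : (fun x : R => (Num.sqrt x)^-1) = (fun x : R => powR (Num.sqrt x) (-1)).
  by apply/funext => x; rewrite powR_inv1.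
apply: (measurableT_comp (f := fun x : R => powR x (-1))).
  exact: measurable_powR.
by apply: continuous_measurable_fun; exact: sqrt_continuous.
Qed.

(** * Asymptotics of the stacked statistic *)

Section asymptotics.
Context {disp} {Omega : measurableType disp} {R : realType}.
Variables (P : probability Omega R) (d a : nat).
Hypothesis ha : (1 <= a)%N.
Variable mu : 'I_a -> 'cV[R]_d.
Variable eps : 'I_a -> nat -> {RV P >-> 'cV[R]_d}.
Hypothesis eps_indep : mutually_independent (fun ik : 'I_a * nat => eps ik.1 ik.2).
Hypothesis eps_ident : forall i k, identically_distributed (eps i k) (eps i 0%N).
Hypothesis eps_mean : forall i, mean P (eps i 0%N) = 0.
Hypothesis eps_moment4 :
  forall i, ('E_P[fun w => (enorm (eps i 0%N w) ^+ 4)%R] < +oo)%E.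
Hypothesis V_diag_gt0 : forall i j, 0 < V_ eps i j j.
Variables (n : nat -> 'I_a -> nat) (kappa : 'I_a -> R).
Hypothesis n_oo : forall i, n nu i @[nu --> \oo] --> \oo.
Hypothesis kappa_itv : forall i, 0 < kappa i <= 1.
Hypothesis n_kappa : forall i,
  (n nu i)%:R / (\sum_(i' < a) n nu i')%:R @[nu --> \oo] --> kappa i.

Let s nu : R := Num.sqrt (\sum_(i < a) n nu i)%:R.
Let t nu i : R := s nu / (n nu i)%:R.

Let n_gt0 i : \forall nu \near \oo, (0 < n nu i)%N.
Proof. exact: ((@n_oo i) _ (nbhs_infty_ge 1)). Qed.

Let ninv i : (n nu i)%:R^-1 @[nu --> \oo] --> (0 : R).
Proof.
have h : (k%:R^-1 : R) @[k --> \oo] --> 0.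
  by rewrite -(cvg_shiftS (fun k : nat => k%:R^-1 : R)); exact: cvg_harmonic.
exact: (cvg_comp _ _ (@n_oo i) h).
Qed.

Let i0 : 'I_a := Ordinal ha.

Let s_gt0 : \forall nu \near \oo, 0 < s nu.
Proof.
apply: filterS (n_gt0 i0) => nu n0; rewrite sqrtr_gt0 ltr0n.
by rewrite (bigD1 i0)//= ltn_addr.
Qed.

Let s_neq0 : \forall nu \near \oo, s nu != 0.
Proof. by apply: filterS s_gt0 => nu /lt0r_neq0. Qed.

Let s_sqr nu : s nu ^+ 2 = (\sum_(i < a) n nu i)%:R.
Proof. by rewrite sqr_sqrtr. Qed.

Let s_inv0 : (s nu)^-1 @[nu --> \oo] --> 0.
Proof.
have N0 : (\sum_(i < a) n nu i)%:R^-1 @[nu --> \oo] --> (0 : R).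
  rewrite -[X in _ --> X](mulr0 (kappa i0)).
  apply: cvg_trans (cvgM (@n_kappa i0) (ninv i0)).
  apply: near_eq_cvg; apply: filterS (n_gt0 i0) => nu n0 /=.
  by rewrite mulrAC divff ?mul1r// pnatr_eq0 -lt0n.
have : Num.sqrt ((\sum_(i < a) n nu i)%:R^-1) @[nu --> \oo] --> Num.sqrt (0 : R).
  by apply: continuous_cvg => //; exact: sqrt_continuous.
rewrite sqrtr0; apply: cvg_trans; apply: near_eq_cvg; apply: nearW => nu.
by rewrite /s sqrtrV.
Qed.

(** [n_i t_i^2] is [N / n_i], the source of the factors [kappa_i^-1] in [Upsilon]. *)
Let nt i : (n nu i)%:R * t nu i ^+ 2 @[nu --> \oo] --> (kappa i)^-1.
Proof.
have k0 : kappa i != 0 by have /andP[/lt0r_neq0] := kappa_itv i.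
have h : ((n nu i)%:R / (\sum_(i' < a) n nu i')%:R)^-1 @[nu --> \oo] -->
    (kappa i)^-1 by exact: cvgV.
apply: cvg_trans h; apply: near_eq_cvg.
apply: filterS (n_gt0 i) => nu n0.
have n0' : (n nu i)%:R != 0 :> R by rewrite pnatr_eq0 -lt0n.
by rewrite /t expr_div_n s_sqr invf_div; field.
Qed.

Let t0 i : t nu i @[nu --> \oo] --> 0.
Proof.
have h : t nu i ^+ 2 @[nu --> \oo] --> 0.
  have h' : (n nu i)%:R * t nu i ^+ 2 * (n nu i)%:R^-1 @[nu --> \oo] --> (kappa i)^-1 * 0.
    by apply: cvgM; [exact: nt|exact: ninv].
  rewrite mulr0 in h'; apply: cvg_trans h'; apply: near_eq_cvg.
  apply: filterS (n_gt0 i) => nu n0 /=.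
  by rewrite mulrAC divff ?mul1r// pnatr_eq0 -lt0n.
have : Num.sqrt (t nu i ^+ 2) @[nu --> \oo] --> Num.sqrt (0 : R).
  by apply: continuous_cvg => //; exact: sqrt_continuous.
rewrite sqrtr0; apply: cvg_trans; apply: near_eq_cvg; apply: nearW => nu.
by rewrite sqrtr_sqr ger0_norm// divr_ge0// sqrtr_ge0.
Qed.

Section linear_statistics.
Variable F : 'I_a -> 'cV[R]_d -> R.
Hypothesis mF : forall i, measurable_fun [set: 'cV[R]_d] (F i).
Hypothesis F2 : forall i, L1 P (fun w => F i (eps i 0%N w) ^+ 2).
Hypothesis F0 : forall i, \int[P]_w F i (eps i 0%N w) = 0.

Let var_cvg := Rint_grouped_sum_sqr_cvg eps_indep eps_ident mF F2 F0 nt.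

Lemma grouped_sum_OP : OP P (fun nu => grouped_sum eps F (n nu) (t nu)).
Proof.
have vc := var_cvg; set v := \sum_(i < a) _ in vc.
apply: (@OP_of_sqr _ _ _ _ _ (v + 1)) => [nu|nu|].
- exact: measurable_grouped_sum.
- exact: L1_grouped_sum_sqr.
- move/cvgrPdist_le : vc => /(_ 1 ltr01); apply: filterS => nu.
  by rewrite distrC ler_norml => /andP[_]; rewrite lerBlDr addrC.
Qed.

Lemma grouped_sum_oP :
  \sum_(i < a) (kappa i)^-1 * \int[P]_w (F i (eps i 0%N w) ^+ 2) = 0 ->
  oP P (fun nu => grouped_sum eps F (n nu) (t nu)).
Proof.
move=> v0; have vc := var_cvg; rewrite v0 in vc.
apply: oP_of_sqr => // nu.
- exact: measurable_grouped_sum.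
- exact: L1_grouped_sum_sqr.
Qed.

End linear_statistics.

(** A sum over one group is a grouped sum whose summands in the other groups are 0. *)
Let OP_single i (f : 'cV[R]_d -> R) : measurable_fun [set: 'cV[R]_d] f ->
  L1 P (fun w => f (eps i 0%N w) ^+ 2) -> \int[P]_w f (eps i 0%N w) = 0 ->
  OP P (fun nu w => s nu / (n nu i)%:R * \sum_(k < n nu i) f (eps i k w)).
Proof.
move=> mf f2 f0; pose F i' := if i' == i then f else cst 0.
have mF i' : measurable_fun [set: 'cV[R]_d] (F i') by rewrite /F; case: ifP.
have F2 i' : L1 P (fun w => F i' (eps i' 0%N w) ^+ 2).
  rewrite /F; case: eqP => [->//|_].
  by under eq_fun do rewrite expr0n; exact: L1_cst.
have F0 i' : \int[P]_w F i' (eps i' 0%N w) = 0.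
  by rewrite /F; case: eqP => [->//|_]; rewrite Rint_cst.
apply: eq_OP (grouped_sum_OP mF F2 F0) => nu w.
rewrite /grouped_sum (bigD1 i)//= [X in _ + X]big1 => [|i' /negbTE i'i].
  by rewrite addr0 /F eqxx.
by rewrite /F i'i big1 ?mulr0.
Qed.

Let me_ i k j : measurable_fun [set: Omega] (fun w => (eps i k w : 'cV[R]_d) j 0).
Proof.
exact: (measurableT_comp (measurable_coord j 0) (measurable_funPT (eps i k))).
Qed.

Let Z i nu w := Zmx (eps i) (V_ eps i) (n ^~ i) s nu w.

Let OZ i j k : OP P (fun nu w => Z i nu w j k).
Proof.
have := @OP_single i (fun y => y j 0 * y k 0 - V_ eps i j k) _ _ _.
move=> h; apply: eq_OP (h _ _ _) => [nu w||| ].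
- by rewrite /Z /Zmx [RHS]mxE.
- by apply: measurable_funB => //; apply: measurable_funM; exact: measurable_coord.
- apply: L1_sqrD => //; first exact: measurable_funM.
    exact: eps_prod_sqr_L1.
  exact: L1_cst.
- rewrite RintB; [|exact: eps_prod_L1|exact: L1_cst].
  by rewrite Rint_cst -V_Rint// subrr.
Qed.

Let Oe i j : OP P (fun nu w =>
  s nu / (n nu i)%:R * \sum_(l < n nu i) (eps i l w : 'cV[R]_d) j 0).
Proof.
apply: (@OP_single i (fun y => y j 0)); first exact: measurable_coord.
- exact: eps_sqr_L1.
- exact: Rint_eps.
Qed.

Let M i := M_mx (V_ eps i) (r_ eps i).

Definition lin_stat nu w : 'cV[R]_(dim_stack a d) :=
  \mxcol_(i < a) (M i *m vech (Z i nu w)).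

Definition err_stat nu w : 'cV[R]_(dim_stack a d) :=
  s nu *: (rhat eps mu (n nu) w - r_stack eps).

(** [tagnat.sig1] and [tagnat.sig2] decode a stacked index into its group and its position within
    the group. *)
Let rhatE nu w p : rhat eps mu (n nu) w p 0 =
  vechm (corr_mx (sample_cov (n nu (tagnat.sig1 p))
    (fun k => obs eps mu (tagnat.sig1 p) k w))) (tagnat.sig2 p) 0.
Proof. by rewrite /rhat [LHS]mxE. Qed.

Lemma err_stat_lin_stat p : oP P (fun nu w => err_stat nu w p 0 - lin_stat nu w p 0).
Proof.
have h i l := (linearized_corr (mu i) s_inv0 s_neq0 (@n_oo i) (@t0 i)
  (OZ i) (Oe i) (V_diag_gt0 i) l).1.
apply: eq_oP (h (tagnat.sig1 p) (tagnat.sig2 p)) => nu w.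
have -> : lin_stat nu w p 0 =
    (M (tagnat.sig1 p) *m vech (Z (tagnat.sig1 p) nu w)) (tagnat.sig2 p) 0.
  by rewrite /lin_stat [LHS]mxE.
have -> : err_stat nu w p 0 = s nu * (rhat eps mu (n nu) w p 0 - r_stack eps p 0).
  by rewrite /err_stat [LHS]mxE [X in _ * X]mxE [X in _ * (_ + X)]mxE.
have -> : r_stack eps p 0 = r_ eps (tagnat.sig1 p) (tagnat.sig2 p) 0.
  by rewrite /r_stack [LHS]mxE.
by rewrite rhatE.
Qed.

Let weight (u : 'rV[R]_(dim_stack a d)) i : 'rV[R]_(dim_vech d) := submxrow u i *m M i.

Let F u i := score eps i (weight u i).

(** Cutting [u] into blocks [u_i] makes the functional a grouped sum of scores with weights
    [u_i M_i], so vector statements reduce to scalar ones, in the manner of Cramer and Wold. *)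
Lemma lin_statE (u : 'rV[R]_(dim_stack a d)) nu w :
  (u *m lin_stat nu w) 0 0 = grouped_sum eps (F u) (n nu) (t nu) w.
Proof.
rewrite -{1}(submxrowK u) /lin_stat mul_mxrow_mxcol summxE; apply: eq_bigr => i _.
have -> : vech (Z i nu w) = t nu i *: \sum_(k < n nu i)
    (vech ((eps i k w : 'cV[R]_d) *m (eps i k w)^T) - vech (V_ eps i)).
  apply/colP => l; have [q qE] := vech_entry l.
  rewrite qE [LHS]mxE [RHS]mxE summxE; congr (_ * _); apply: eq_bigr => k _.
  rewrite [RHS]mxE [X in _ = _ + X]mxE !qE; congr (_ - _).
  by rewrite mxE big_ord_recl big_ord0 addr0 [_^T _ _]mxE.
rewrite mulmxA -/(weight u i) -scalemxAr mulmx_sumr [LHS]mxE summxE.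
by congr (_ * _); apply: eq_bigr => k _.
Qed.

Let U := Upsilon eps kappa.

Lemma lin_stat_variance (u : 'rV[R]_(dim_stack a d)) :
  \sum_(i < a) (kappa i)^-1 * \int[P]_w (F u i (eps i 0%N w) ^+ 2) =
  (u *m U *m u^T) 0 0.
Proof.
rewrite -[in RHS](submxrowK u) /U /Upsilon mul_mxrow_mxdiag tr_mxrow.
rewrite mul_mxrow_mxcol summxE; apply: eq_bigr => i _.
rewrite Rint_score_sqr// -scalemxAr -scalemxAl [RHS]mxE; congr (_ * _).
by rewrite /weight trmx_mul /Upsilon_ !mulmxA.
Qed.

(** The form of [Upsilon] at a vector is a limiting variance, hence nonnegative. *)
Lemma psd_Upsilon : psd U.
Proof.
split.
  rewrite /U /Upsilon tr_mxdiag; apply: eq_mxdiag => i.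
  rewrite linearZ /= /Upsilon_; congr (_ *: _); move: (M_mx _ _) => N.
  by rewrite !trmx_mul trmxK Sigma_sym// mulmxA.
move=> x; have := lin_stat_variance x^T; rewrite trmxK => <-.
apply: sumr_ge0 => i _; apply: mulr_ge0.
  by rewrite invr_ge0 ltW//; have /andP[] := kappa_itv i.
by apply: Rintegral_ge0 => w _; exact: sqr_ge0.
Qed.

Let mFu u i : measurable_fun [set: 'cV[R]_d] (F u i).
Proof. exact: measurable_score. Qed.

Let F2u u i : L1 P (fun w => F u i (eps i 0%N w) ^+ 2).
Proof. exact: score_sqr_L1. Qed.

Let F0u u i : \int[P]_w F u i (eps i 0%N w) = 0.
Proof. exact: Rint_score. Qed.

Lemma lin_stat_OP (u : 'rV[R]_(dim_stack a d)) : OP P (fun nu w => (u *m lin_stat nu w) 0 0).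
Proof.
apply: eq_OP (grouped_sum_OP (mFu u) (F2u u) (F0u u)) => nu w.
by rewrite lin_statE.
Qed.

(** In a degenerate direction of [Upsilon] the second moments tend to 0. This disposes of the
    remainder term in [quadratic_form_decomposition]. *)
Lemma lin_stat_oP (u : 'rV[R]_(dim_stack a d)) : (u *m U *m u^T) 0 0 = 0 ->
  oP P (fun nu w => (u *m lin_stat nu w) 0 0).
Proof.
rewrite -lin_stat_variance => /(grouped_sum_oP (mFu u) (F2u u) (F0u u)).
by apply: eq_oP => nu w; rewrite lin_statE.
Qed.

Lemma measurable_lin_stat (u : 'rV[R]_(dim_stack a d)) nu :
  measurable_fun [set: Omega] (fun w => (u *m lin_stat nu w) 0 0).
Proof.
rewrite (funext (lin_statE u nu)); apply: measurable_grouped_sum.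
exact: mFu.
Qed.

Lemma lin_stat_clt (u : 'rV[R]_(dim_stack a d)) :
  \int[P]_w cos ((u *m lin_stat nu w) 0 0) @[nu --> \oo] -->
  expR (- ((u *m U *m u^T) 0 0) / 2).
Proof.
rewrite -lin_stat_variance.
have := grouped_clt eps_indep eps_ident (mFu u) (F2u u) (F0u u) t0 nt.
by under [X in X -> _]eq_cvg do under eq_Rintegral do rewrite -lin_statE.
Qed.

Lemma measurable_rhat nu p :
  measurable_fun [set: Omega] (fun w => rhat eps mu (n nu) w p 0).
Proof.
rewrite (funext (fun w => rhatE nu w p)).
set i := tagnat.sig1 p; set l := tagnat.sig2 p.
have [q [_ ql]] := vechm_strict_upper l.
under eq_fun do rewrite (vechm_nth _ q) ql corr_mxE.
have mobs k j : measurable_fun [set: Omega] (fun w => obs eps mu i k w j 0).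
  by under eq_fun do rewrite mxE; apply: measurable_funD.
have mS j k : measurable_fun [set: Omega]
    (fun w => sample_cov (n nu i) (fun k => obs eps mu i k w) j k).
  have mdev l' j' : measurable_fun [set: Omega] (fun w =>
      (obs eps mu i l' w - sample_mean (n nu i) (fun k => obs eps mu i k w)) j' 0).
    rewrite /sample_mean; under eq_fun do rewrite mxE [X in _ + X]mxE [X in _ - X]mxE summxE.
    apply: measurable_funB; first exact: mobs.
    by apply: measurable_funM => //; apply: measurable_sum => k'; exact: mobs.
  rewrite /sample_cov; under eq_fun do rewrite mxE summxE.
  apply: measurable_funM => //; apply: measurable_sum => l'.
  under eq_fun do rewrite mxE big_ord_recl big_ord0 addr0 [_^T _ _]mxE.
  by apply: measurable_funM; exact: mdev.
apply: measurable_funM; first apply: measurable_funM => //.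
  exact: (measurableT_comp (@measurable_isqrt R) (mS _ _)).
exact: (measurableT_comp (@measurable_isqrt R) (mS _ _)).
Qed.

End asymptotics.

(** * The quadratic form *)

Section chi2.
Context {d} {T : measurableType d} {R : realType} (P : probability T R) (D : nat).
Variable B : 'I_D -> {RV P >-> R}.
Hypothesis B_indep : mutually_independent B.
Hypothesis B_chi2 : forall l, chi2_1_distributed (B l).

Let mB l : measurable_fun [set: T] (B l).
Proof. exact: measurable_funPT. Qed.

Lemma Rint_chi2 l (g : R -> R) (M : R) : measurable_fun [set: R] g ->
  (forall x, `|g x| <= M) ->
  \int[P]_w g (B l w) = \int[normal_prob 0 1]_z g (z ^+ 2).
Proof.
move=> mg gM.
transitivity (\int[P]_w (cst 1 w * g (B l w))).
  by apply: Rint_eq => w; rewrite mul1r.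
transitivity (\int[normal_prob 0 1]_z (cst 1 z * g (z ^+ 2))); last first.
  by apply: Rint_eq => z; rewrite mul1r.
have msqr : measurable_fun [set: R] (fun z : R => z ^+ 2) by exact: exprn_measurable.
apply: (@eq_Rint_of_indic _ _ _ _ _ _ R P (normal_prob 0 1) (cst 1) (cst 1)
  (B l) (fun z : R => z ^+ 2) g M) => //; [exact: L1_cst|exact: L1_cst|].
move=> C mC; have h := B_chi2 l mC.
transitivity (\int[P]_w \1_C (B l w)); first by apply: Rint_eq => w; rewrite mul1r.
transitivity (\int[normal_prob 0 1]_z \1_C (z ^+ 2)); last first.
  by apply: Rint_eq => z; rewrite mul1r.
by rewrite !Rint_indic//; congr fine; exact: h.
Qed.

(** The law only gives nonnegativity almost surely, expressed by [likely] at level 0; it is what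
    makes [sqrt (B l)] square back to [B l]. *)
Lemma chi2_ge0 : likely P 0 [set w | forall l, 0 <= B l w].
Proof.
have B0 l : P (B l @^-1` `]-oo, 0[%classic) = 0%E.
  have m0 : measurable (`]-oo, 0[%classic : set R) by exact: measurable_itv.
  have -> : P (B l @^-1` `]-oo, 0[%classic) = distribution P (B l) `]-oo, 0[%classic by [].
  rewrite (B_chi2 l m0) (_ : _ @^-1` _ = set0) ?measure0//.
  apply/seteqP; split => // z /=; rewrite in_itv /= => z0.
  by have := sqr_ge0 z; rewrite leNgt z0.
have mB0 l : measurable (B l @^-1` `]-oo, 0[%classic).
  rewrite -[X in measurable X]setTI; exact: mB.
have B0' l : likely P 0 [set w | 0 <= B l w].
  exists (B l @^-1` `]-oo, 0[%classic); split => //; first by rewrite B0.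
  by move=> w /=; rewrite in_itv /= => /negP; rewrite -leNgt.
suff : forall s : seq 'I_D, likely P 0 [set w | forall l, l \in s -> 0 <= B l w].
  by move=> /(_ (enum 'I_D)); apply: likelyS => w /= h l; apply: h; rewrite mem_enum.
elim=> [|l s IH]; first exact: likelyT.
have := likelyI (B0' l) IH; rewrite addr0; apply: likelyS.
by move=> w [/= Bl Bs] k; rewrite inE => /predU1P[->//|]; exact: Bs.
Qed.

(** [sqrt (B l)] has the law of [|Z|] for a standard normal [Z], and evenness of the cosine turns
    its transform into the normal characteristic function. *)
Lemma Rint_prod_cos_sqrt_chi2 (u : 'I_D -> R) :
  \int[P]_w (\prod_l cos (u l * Num.sqrt (B l w))) =
  expR (- (\sum_l u l ^+ 2) / 2).
Proof.
have bc l : bmeas (fun x : R => cos (u l * Num.sqrt x)).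
  apply: bmeas_cos; apply: measurable_funM => //.
  by apply: continuous_measurable_fun; exact: sqrt_continuous.
rewrite (Rint_prod_indep B_indep (index_enum_uniq _) bc).
rewrite -sumrN mulr_suml expR_sum; apply: eq_bigr => l _.
rewrite (Rint_chi2 l (bc l).1 (M := 1)); last by move=> x; exact: cos_max.
transitivity (\int[normal_prob 0 1]_z cos (u l * z)); last first.
  by rewrite normal_prob_char_fun mulNr.
apply: Rint_eq => z /=; rewrite sqrtr_sqr.
have [z0|z0] := leP 0 z; first by rewrite ger0_norm.
by rewrite ltr0_norm// mulrN cosN.
Qed.

End chi2.

Lemma measurable_qform {d} {T : measurableType d} {R : realType} m
    (x : T -> 'cV[R]_m) (K : T -> 'M[R]_m) :
  (forall j, measurable_fun [set: T] (fun w => x w j 0)) ->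
  (forall j k, measurable_fun [set: T] (fun w => K w j k)) ->
  measurable_fun [set: T] (fun w => ((x w)^T *m K w *m x w) 0 0).
Proof.
move=> mx mK.
have -> : (fun w => ((x w)^T *m K w *m x w) 0 0) =
    (fun w => \sum_k (\sum_j x w j 0 * K w j k) * x w k 0).
  apply/funext => w; rewrite mxE; apply: eq_bigr => k _; congr (_ * _).
  by rewrite mxE; apply: eq_bigr => j _; rewrite mxE.
apply: measurable_sum => k; apply: measurable_funM => //.
by apply: measurable_sum => j; exact: measurable_funM.
Qed.

Section quadratic_forms.
Context {d} {T : measurableType d} {R : realType} (P : probability T R).

Lemma qformE m (x y : 'cV[R]_m) (K : 'M[R]_m) :
  (x^T *m K *m y) 0 0 = \sum_k \sum_j x j 0 * K j k * y k 0.
Proof.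
rewrite mxE; apply: eq_bigr => k _; rewrite mxE mulr_suml.
by apply: eq_bigr => j _; rewrite mxE.
Qed.

Lemma qformZ m (c : R) (x : 'cV[R]_m) (K : 'M[R]_m) :
  ((c *: x)^T *m K *m (c *: x)) 0 0 = c ^+ 2 * (x^T *m K *m x) 0 0.
Proof.
rewrite !qformE mulr_sumr; apply: eq_bigr => k _; rewrite mulr_sumr.
by apply: eq_bigr => j _; rewrite !mxE; ring.
Qed.

Lemma oP_qform m (x : nat -> T -> 'cV[R]_m) (K : nat -> T -> 'M[R]_m) :
  (forall j, OP P (fun n w => x n w j 0)) ->
  (forall j k, oP P (fun n w => K n w j k)) ->
  oP P (fun n w => ((x n w)^T *m K n w *m x n w) 0 0).
Proof.
move=> Ox oK.
apply: (@eq_oP _ _ _ _ (fun n w => \sum_k \sum_j K n w j k * (x n w j 0 * x n w k 0))).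
  move=> n w; rewrite qformE; apply: eq_bigr => k _; apply: eq_bigr => j _; ring.
by apply: oP_sum => k; apply: oP_sum => j; apply: oPM => //; exact: OPM.
Qed.

Lemma oP_qformB m (x y : nat -> T -> 'cV[R]_m) (K : 'M[R]_m) :
  (forall j, oP P (fun n w => x n w j 0 - y n w j 0)) ->
  (forall j, OP P (fun n w => y n w j 0)) ->
  oP P (fun n w => ((x n w)^T *m K *m x n w) 0 0 - ((y n w)^T *m K *m y n w) 0 0).
Proof.
move=> oxy Oy.
have Ox j : OP P (fun n w => x n w j 0).
  by apply: eq_OP (OPD (oP_OP (oxy j)) (Oy j)) => n w; rewrite subrK.
apply: (@eq_oP _ _ _ _ (fun n w => \sum_k \sum_j K j k *
   ((x n w j 0 - y n w j 0) * x n w k 0 + (x n w k 0 - y n w k 0) * y n w j 0))).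
  move=> n w; rewrite !qformE -sumrB; apply: eq_bigr => k _.
  by rewrite -sumrB; apply: eq_bigr => j _; ring.
apply: oP_sum => k; apply: oP_sum => j; apply: oPZ.
by apply: oPD; exact: oPM.
Qed.

Lemma OP_mulmx m p (C : 'M[R]_(m, p)) (x : nat -> T -> 'cV[R]_p) j :
  (forall k, OP P (fun n w => x n w k 0)) -> OP P (fun n w => (C *m x n w) j 0).
Proof.
move=> Ox; apply: (@eq_OP _ _ _ _ (fun n w => \sum_k C j k * x n w k 0)).
  by move=> n w; rewrite mxE.
by apply: OP_sum => k; exact: OPZ.
Qed.

(** The matrix norm is the maximum norm, so it controls every entry. The event where it exceeds [e]
    is the preimage of an open set, which gives the measurable exceptional set that [likely] asks
    for. *)
Lemma cvg_in_probability_oP m p (X : nat -> {RV P >-> 'M[R]_(m, p)}) (A : 'M[R]_(m, p)) :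
  cvg_in_probability P (fun n => X n : T -> 'M[R]_(m, p)) A ->
  forall j k, oP P (fun n w => (X n w : 'M[R]_(m, p)) j k - A j k).
Proof.
move=> XA j k e del e0 d0.
have := XA _ e0 => /fine_cvgP[_ /cvgrPdist_le /(_ _ d0)].
apply: filterS => n /= h.
have mS : measurable [set w | e < `|(X n w : 'M[R]_(m, p)) - A|].
  have mO : measurable [set B : 'M[R]_(m, p) | e < `|B - A|].
    apply: sub_sigma_algebra.
    apply: (@open_comp _ _ (fun B : 'M[R]_(m, p) => `|B - A|) [set x | e < x]).
      move=> B _; apply: (@continuous_comp _ _ _ (fun B : 'M[R]_(m, p) => B - A)).
        by apply: continuousB; [exact: id|exact: cst_continuous].
      exact: norm_continuous.
    exact: open_gt.
  by have := measurable_funPT (X n) measurableT _ mO; rewrite setTI.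
exists [set w | e < `|(X n w : 'M[R]_(m, p)) - A|]; split => //.
  rewrite -(fineK (fin_num_measure P _ mS)) lee_fin.
  by move: h; rewrite sub0r normrN; apply: le_trans; exact: ler_norm.
move=> w /= /negP; rewrite -leNgt; apply: le_trans.
rewrite [leRHS]mx_normrE; apply: le_trans (le_bigmax _ _ (j, k)).
by rewrite !mxE.
Qed.

End quadratic_forms.

Theorem theorem3p2 (R : realType)
  (disp : measure_display) (Omega : measurableType disp)
  (P : probability Omega R)
  (d a : nat) (hd : (2 <= d)%N) (ha : (1 <= a)%N)
  (mu : 'I_a -> 'cV[R]_d)
  (eps : 'I_a -> nat -> {RV P >-> 'cV[R]_d})
  (eps_indep : mutually_independent (fun ik : 'I_a * nat => eps ik.1 ik.2))
  (eps_ident : forall i k, identically_distributed (eps i k) (eps i 0%N))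
  (eps_mean : forall i, mean P (eps i 0%N) = 0)
  (eps_moment4 : forall i, ('E_P[fun w => (enorm (eps i 0%N w) ^+ 4)%R] < +oo)%E)
  (V_diag_gt0 : forall i j, 0 < V_ eps i j j)
  (n : nat -> 'I_a -> nat) (kappa : 'I_a -> R)
  (n_oo : forall i, n nu i @[nu --> \oo] --> \oo)
  (kappa_itv : forall i, 0 < kappa i <= 1)
  (n_kappa : forall i,
    (n nu i)%:R / (\sum_(i' < a) n nu i')%:R @[nu --> \oo] --> kappa i)
  (m : nat) (C : 'M[R]_(m, dim_stack a d)) (zeta : 'cV[R]_m)
  (EN : nat -> {RV P >-> 'M[R]_m}) (E : 'M[R]_m)
  (E_sym : E^T = E)
  (EN_cvg : cvg_in_probability P (fun nu => EN nu : Omega -> 'M[R]_m) E)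
  (H0 : C *m r_stack eps = zeta)
  (lambda : 'I_(dim_stack a d) -> R)
  (lambda_eig : eigenvalues_of
    (sqrt_mx (Upsilon eps kappa) *m C^T *m E *m C
      *m sqrt_mx (Upsilon eps kappa)) lambda)
  (disp' : measure_display) (Omega' : measurableType disp')
  (P' : probability Omega' R)
  (B : 'I_(dim_stack a d) -> {RV P' >-> R})
  (B_indep : mutually_independent B)
  (B_chi2 : forall l, chi2_1_distributed (B l)) :
  cvg_in_distribution P P'
    (fun nu => Qhat eps mu (n nu) C zeta (EN nu))
    (fun w => \sum_l lambda l * B l w).
Proof.
move=> f cf [M fM].
pose K := C^T *m E *m C.
have Ks : K^T = K by rewrite /K !trmx_mul trmxK E_sym mulmxA.
have lE : eigenvalues_of (sqrt_mx (Upsilon eps kappa) *m K *m sqrt_mx (Upsilon eps kappa)) lambda.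
  by move: lambda_eig; rewrite /K !mulmxA.
have psdU : psd (Upsilon eps kappa) by exact: psd_Upsilon.
have [G [N [W [GG NN KE]]]] := quadratic_form_decomposition psdU Ks lE.
pose Yl := lin_stat eps n; pose Yh := err_stat mu eps n.
have rowE (A : 'M[R]_(dim_stack a d)) l nu w :
    (A *m Yl nu w) l 0 = (row l A *m Yl nu w) 0 0.
  by rewrite -row_mul [RHS]mxE.
have Ol (u : 'rV[R]_(dim_stack a d)) : OP P (fun nu w => (u *m Yl nu w) 0 0).
  exact: (lin_stat_OP eps_indep eps_ident eps_mean eps_moment4 n_oo kappa_itv n_kappa).
have OAl (A : 'M[R]_(dim_stack a d)) l : OP P (fun nu w => (A *m Yl nu w) l 0).
  by apply: eq_OP (Ol (row l A)) => nu w; rewrite rowE.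
have OYl p : OP P (fun nu w => Yl nu w p 0).
  by apply: eq_OP (OAl 1%:M p) => nu w; rewrite mul1mx.
have oYhl p : oP P (fun nu w => Yh nu w p 0 - Yl nu w p 0) by exact: err_stat_lin_stat.
have OYh p : OP P (fun nu w => Yh nu w p 0).
  by apply: eq_OP (OPD (oP_OP (oYhl p)) (OYl p)) => nu w; rewrite subrK.
have mAl (A : 'M[R]_(dim_stack a d)) l nu :
    measurable_fun [set: Omega] (fun w => (A *m Yl nu w) l 0).
  by rewrite (funext (rowE A l nu)); exact: measurable_lin_stat.
pose Q nu w := Qhat eps mu (n nu) C zeta (EN nu) w.
have mQ nu : measurable_fun [set: Omega] (Q nu).
  apply: measurable_funM => //; apply: measurable_qform.
    move=> j; rewrite (_ : (fun w => _) =
      (fun w => \sum_k C j k * rhat eps mu (n nu) w k 0 - zeta j 0)); last first.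
      by apply/funext => w; rewrite 3!mxE.
    apply: measurable_funB => //; apply: measurable_sum => k.
    by apply: measurable_funM => //; exact: measurable_rhat.
  move=> j k.
  exact: (measurableT_comp (measurable_coord j k) (measurable_funPT (EN nu))).
(* Under the null hypothesis [C rhat - zeta = C (rhat - r)], and the factor [N] is the square of the
   scaling [s] in [err_stat]. *)
have QE nu w : Q nu w = ((C *m Yh nu w)^T *m EN nu w *m (C *m Yh nu w)) 0 0.
  rewrite /Q /Qhat -H0 -mulmxBr /Yh /err_stat.
  by rewrite -scalemxAr qformZ sqr_sqrtr.
(* Three errors: replacing [EN] by [E], replacing [rhat] by its linearization, and the degenerate
   remainder of the decomposition. *)
have Qo : oP P (fun nu w => Q nu w - \sum_l lambda l * (G *m Yl nu w) l 0 ^+ 2).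
  have h1 : oP P (fun nu w => ((C *m Yh nu w)^T *m (EN nu w - E) *m (C *m Yh nu w)) 0 0).
    apply: oP_qform => [j|j k]; first exact: OP_mulmx.
    by apply: eq_oP (cvg_in_probability_oP EN_cvg j k) => nu w;
      rewrite [RHS]mxE [X in _ = _ + X]mxE.
  have h2 := oP_qformB K oYhl OYl.
  have h3 : oP P (fun nu w => ((N *m Yl nu w)^T *m (W *m Yl nu w)) 0 0).
    apply: (@eq_oP _ _ _ _ (fun nu w => \sum_j (N *m Yl nu w) j 0 * (W *m Yl nu w) j 0)).
      by move=> nu w; rewrite [RHS]mxE; apply: eq_bigr => j _; rewrite [X in _ = X * _]mxE.
    apply: oP_sum => j; apply: oPM; last exact: OAl.
    (* Each row of [N] is a degenerate direction: its variance is a diagonal entry of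
       [N Upsilon N^T = 0]. *)
    have NNj : (row j N *m Upsilon eps kappa *m (row j N)^T) 0 0 = 0.
      have /matrixP /(_ j j) := NN; rewrite [RHS]mxE => <-.
      by rewrite -row_mul tr_row mxE [RHS]mxE; apply: eq_bigr => k _; rewrite !mxE.
    have := lin_stat_oP eps_indep eps_ident eps_mean eps_moment4 n_oo kappa_itv n_kappa NNj.
    by apply: eq_oP => nu w; rewrite rowE.
  apply: eq_oP (oPD (oPD h1 h2) h3) => nu w.
  rewrite QE (KE (Yl nu w)) mulmxBr mulmxBl.
  have mxB (X Y : 'M[R]_1) : (X - Y) 0 0 = X 0 0 - Y 0 0 by rewrite !mxE.
  rewrite mxB.
  have -> : (C *m Yh nu w)^T *m E *m (C *m Yh nu w) = (Yh nu w)^T *m K *m Yh nu w.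
    by rewrite /K trmx_mul !mulmxA.
  by ring.
have cosl (u : 'I_(dim_stack a d) -> R) : (forall l, lambda l = 0 -> u l = 0) ->
    \int[P]_w cos (\sum_l u l * (G *m Yl nu w) l 0) @[nu --> \oo] -->
      expR (- (\sum_l u l ^+ 2) / 2).
  move=> u0; pose ur : 'rV[R]_(dim_stack a d) := \row_l u l.
  have uE nu w : \sum_l u l * (G *m Yl nu w) l 0 = (ur *m G *m Yl nu w) 0 0.
    by rewrite -mulmxA [RHS]mxE; apply: eq_bigr => l _; rewrite [ur _ _]mxE.
  (* [G Upsilon G^T] is known on the indices with nonzero [lambda] only; the other terms drop out
     because [u] vanishes there. *)
  have -> : \sum_l u l ^+ 2 = (ur *m G *m Upsilon eps kappa *m (ur *m G)^T) 0 0.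
    rewrite trmx_mul !mulmxA -(mulmxA ur) -(mulmxA ur) mulmx_tr_sum.
    apply: eq_bigr => k _; rewrite [ur 0 k]mxE.
    have [k0|k0] := eqVneq (lambda k) 0; first by rewrite u0// mulr0 expr0n.
    rewrite expr2; congr (_ * _).
    rewrite mxE (bigD1 k)//= big1 => [|l lk].
      by rewrite GG// eqxx mulr1 addr0 mxE.
    rewrite [ur _ _]mxE; have [l0|l0] := eqVneq (lambda l) 0; first by rewrite u0// mul0r.
    by rewrite GG// (negbTE lk) mulr0.
  under eq_fun do under eq_Rintegral do rewrite uE.
  exact: (lin_stat_clt eps_indep eps_ident eps_mean eps_moment4 n_oo kappa_itv n_kappa).
pose b l w := Num.sqrt (B l w).
have mb l : measurable_fun [set: Omega'] (b l).
  apply: (measurableT_comp (f := @Num.sqrt R)); last exact: measurable_funPT.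
  by apply: continuous_measurable_fun; exact: sqrt_continuous.
have cv := weighted_squares_cvg mQ (fun l nu => mAl G l nu) mb Qo (fun l => OAl G l) cosl
  (Rint_prod_cos_sqrt_chi2 B_indep B_chi2) cf fM.
have mf : measurable_fun [set: R] f by exact: continuous_measurable_fun.
have bf d1 (T1 : measurableType d1) (v : T1 -> R) : measurable_fun [set: T1] v ->
    bmeas (fun x => f (v x)).
  by move=> mv; split; [exact: measurableT_comp|exists M => x].
have mS : measurable_fun [set: Omega'] (fun w => \sum_l lambda l * B l w).
  by apply: measurable_sum => l; apply: measurable_funM => //; exact: measurable_funPT.
have mS' : measurable_fun [set: Omega'] (fun w => \sum_l lambda l * b l w ^+ 2).
  by apply: measurable_sum => l; apply: measurable_funM => //; exact: measurable_funX.
(* The squares [b l ^+ 2] equal [B l] almost surely, so the comparison has error 0 outside an event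
   of probability 0. *)
have limE : \int[P']_w f (\sum_l lambda l * b l w ^+ 2) = \int[P']_w f (\sum_l lambda l * B l w).
  apply/eqP; rewrite -subr_eq0 -normr_le0.
  have M0 : 0 <= M by exact: le_trans (fM 0).
  suff: `|\int[P']_w f (\sum_l lambda l * b l w ^+ 2) -
    \int[P']_w f (\sum_l lambda l * B l w)| <= 0 + (M + M) * 0 by rewrite mulr0 addr0.
  apply: (Rint_likely (P := P')); [exact: bf mS'|exact: bf mS|by []|by rewrite addr_ge0| |].
    by move=> w; apply: le_trans (ler_normB _ _) _; exact: lerD.
  apply: likelyS (chi2_ge0 B_chi2) => w /= B0.
  rewrite (eq_bigr (fun l => lambda l * B l w)) ?subrr ?normr0// => l _.
  by rewrite sqr_sqrtr.
(* The expectations in the goal are extended real integrals; they are finite because [f] is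
   bounded. *)
rewrite unlock.
have -> : (fun nu => \int[P]_w ((f \o Qhat eps mu (n nu) C zeta (EN nu)) w)%:E)%E =
    (fun nu => (\int[P]_w f (Q nu w))%:E).
  by apply/funext => nu; rewrite -integral_Rint//; apply: bmeas_L1; exact: bf.
rewrite (_ : (\int[P']_w _)%E = (\int[P']_w f (\sum_l lambda l * B l w))%:E); last first.
  by rewrite -integral_Rint//; apply: bmeas_L1; exact: bf.
by rewrite -limE; apply/fine_cvgP; split; [exact: nearW|exact: cv].
Qed.
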